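(* The maps $M\mapsto\underline{H}_M(x)$ and $M\mapsto H_M(x)$, from the class of all matroids (on finite subsets of the positive integers) to $\mathbb{Z}[x]$, are valuative invariants.
   Context: For a matroid $M$ on $E$, its base polytope $\mathscr{P}(M)\subseteq\mathbb{R}^E$ is the convex hull of the indicator vectors of the bases of $M$. A matroid subdivision $\mathcal{S}$ of $\mathscr{P}(M)$ is a polyhedral subdivision all of whose cells (hence all faces) are base polytopes of matroids on $E$; $\mathcal{S}^{\mathrm{int}}$ denotes the set of polytopes of $\mathcal{S}$ (cells and their faces) not contained in the boundary of $\mathscr{P}(M)$. A map $f$ from matroids to an abelian group is a valuative invariant if (i) $f(M)=f(N)$ whenever $M\cong N$, and (ii) for every matroid $M$ and every matroid subdivision $\mathcal{S}$ of $\mathscr{P}(M)$, $f(M)=\sum_{\mathscr{P}_i\in\mathcal{S}^{\mathrm{int}}}(-1)^{\dim\mathscr{P}(M)-\dim\mathscr{P}_i}f(\mathscr{P}_i)$, where $f$ is evaluated on the matroid whose base polytope is $\mathscr{P}_i$. For a loopless matroid $M$ on $E$ with lattice of flats $\mathcal{L}(M)$: $\underline{\mathrm{CH}}(M)=\mathbb{Q}[x_F: F\in\mathcal{L}(M)\setminus\{\varnothing,E\}]/(I+J)$, $I$ generated by $x_{F_1}x_{F_2}$ for incomparable $F_1,F_2$, $J$ by $\sum_{F\ni i}x_F-\sum_{F\ni j}x_F$ for $i,j\in E$; $\mathrm{CH}(M)=\mathbb{Q}[x_F,y_i: F\in\mathcal{L}(M)\setminus\{E\},\, i\in E]/(I'+J')$,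 $I'$ generated by $y_i-\sum_{F\not\ni i}x_F$, $J'$ by $x_{F_1}x_{F_2}$ for incomparable $F_1,F_2$ and $y_ix_F$ for $i\notin F$. Variables of degree $1$; $\underline{H}_M$, $H_M$ are the Hilbert series. For matroids with loops, by convention $\underline{H}_M(x)=0$ and $H_M(x)=H_{M\setminus\{\text{loops}\}}(x)$. *)

(* Defs.v *)
From HB Require Import structures.
From mathcomp Require Import all_boot all_order all_algebra.
From mathcomp Require Import finmap mpoly.
From Stdlib Require Import Rdefinitions ClassicalEpsilon.

Set Implicit Arguments.
Unset Strict Implicit.
Unset Printing Implicit Defensive.

Import GRing.Theory.
Local Open Scope fset_scope.
Local Open Scope ring_scope.

Record matroid := Matroid { ground : {fset nat}; bases : {fset {fset nat}} }.

Definition is_matroid (M : matroid) : Prop :=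
  [/\ (forall e, e \in ground M -> (0 < e)%nat),
      bases M != fset0,
      (forall B, B \in bases M -> B `<=` ground M) &
      (forall B1 B2, B1 \in bases M -> B2 \in bases M ->
        forall a, a \in B1 `\` B2 ->
        exists2 b, b \in B2 `\` B1 & (B1 `\ a) `|` [fset b] \in bases M)].

Definition fimg (s : nat -> nat) (B : {fset nat}) : {fset nat} := [fset s x | x in B].

Definition matroid_iso (M N : matroid) : Prop :=
  exists s : nat -> nat,
    [/\ {in ground M &, injective s},
        [fset s x | x in ground M] = ground N &
        bases N = [fset fimg s B | B in bases M]].

Definition mrank (M : matroid) (A : {fset nat}) : nat :=
  (\max_(B <- bases M) #|` A `&` B|)%nat.

Definition is_flat (M : matroid) (F : {fset nat}) : bool :=
  (F `<=` ground M) &&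
  all (fun e => mrank M F < mrank M (F `|` [fset e]))%nat (ground M `\` F).

Definition flats (M : matroid) : {fset {fset nat}} :=
  [fset F in fpowerset (ground M) | is_flat M F].

Definition loops (M : matroid) : {fset nat} :=
  [fset e in ground M | all (fun B => e \notin B) (bases M)].

Definition loopless (M : matroid) : bool := loops M == fset0.

Definition delete_loops (M : matroid) : matroid :=
  Matroid (ground M `\` loops M) (bases M).

Definition incomparable (F1 F2 : {fset nat}) : bool :=
  ~~ (F1 `<=` F2) && ~~ (F2 `<=` F1).

Section Hilbert.
Variable n : nat.
Implicit Types (p : {mpoly rat[n]}) (gens ps : seq {mpoly rat[n]}).

Definition is_homog (k : nat) p : bool := all (fun m => mdeg m == k) (msupp p).

Definition in_ideal gens p : Prop :=
  exists cs : seq {mpoly rat[n]}, size cs = size gens /\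
    p = \sum_(i < size gens) cs`_i * gens`_i.

Definition lincomb (c : seq rat) ps : {mpoly rat[n]} :=
  \sum_(i < size ps) c`_i *: ps`_i.

(** the degree-k part of Q[X]/(gens) has a basis of d elements *)
Definition graded_basis_size gens (k d : nat) : Prop :=
  exists ps, [/\ size ps = d, all (is_homog k) ps,
    (forall c : seq rat, size c = d -> in_ideal gens (lincomb c ps) ->
        forall i, (i < d)%nat -> c`_i = 0) &
    (forall p, is_homog k p -> exists c : seq rat,
        size c = d /\ in_ideal gens (p - lincomb c ps))].

Definition hilb_coef gens (k : nat) : nat :=
  epsilon (inhabits 0%nat) (graded_basis_size gens k).

Definition hilb_series gens : {poly int} :=
  epsilon (inhabits 0) (fun h : {poly int} => forall k, h`_k = (hilb_coef gens k)%:Z).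

End Hilbert.

(** Generic construction: variables indexed by a list of labels [ls];
    the variable with index i : 'I_(size ls) has label nth x0 ls i. *)
Section Presentation.
Variables (L : Type) (x0 : L) (ls : seq L).
Local Notation n := (size ls).
Definition lab (i : 'I_n) : L := nth x0 ls i.
Definition Xv (i : 'I_n) : {mpoly rat[n]} := 'X_i.
Definition sumX (P : L -> bool) : {mpoly rat[n]} :=
  \sum_(i < n | P (lab i)) Xv i.
Definition quad_gens (P : L -> L -> bool) : seq {mpoly rat[n]} :=
  flatten [seq [seq Xv i * Xv j | j <- enum 'I_n & P (lab i) (lab j)] | i <- enum 'I_n].
End Presentation.

(** ** Reduced Chow ring: Q[x_F : F in L(M) \ {0, E}] / (I + J) *)
Definition red_labels (M : matroid) : seq {fset nat} :=
  enum_fset [fset F in flats M | (F != fset0) && (F != ground M)].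

Definition red_gens (M : matroid) : seq {mpoly rat[size (red_labels M)]} :=
  let ls := red_labels M in
  quad_gens fset0 ls incomparable ++
  flatten [seq [seq sumX fset0 ls (fun F => i \in F) - sumX fset0 ls (fun F => j \in F)
                 | j <- enum_fset (ground M)] | i <- enum_fset (ground M)].

(** ** Augmented Chow ring: Q[x_F (F in L(M)\{E}), y_i (i in E)] / (I' + J') *)
Definition aug_labels (M : matroid) : seq ({fset nat} + nat) :=
  [seq inl F | F <- enum_fset [fset F in flats M | F != ground M]] ++
  [seq inr i | i <- enum_fset (ground M)].

Definition is_x (l : {fset nat} + nat) : bool := if l is inl _ then true else false.

Definition aug_gens (M : matroid) : seq {mpoly rat[size (aug_labels M)]} :=
  let ls := aug_labels M in
  let x0 := inl fset0 in
  [seq sumX x0 ls (fun l => l == inr i)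
       - sumX x0 ls (fun l => if l is inl F then i \notin F else false)
     | i <- enum_fset (ground M)] ++
  quad_gens x0 ls (fun l1 l2 => match l1, l2 with
                                | inl F1, inl F2 => incomparable F1 F2
                                | inr i, inl F => i \notin F
                                | _, _ => false end).

Definition red_H (M : matroid) : {poly int} :=
  if loopless M then hilb_series (red_gens M) else 0.

Definition aug_H (M : matroid) : {poly int} :=
  let M' := delete_loops M in hilb_series (aug_gens M').

(** points of R^E are represented by functions nat -> R (vanishing off E) *)
Definition point := nat -> R.
Definition pset := point -> Prop.

Definition conv_bases (bs : {fset {fset nat}}) : pset := fun x =>
  exists lam : {fset nat} -> R,
    [/\ (forall B, B \in bs -> Rle R0 (lam B)),
        \big[Rplus/R0]_(B <- bs) lam B = R1 &
        forall i, x i = \big[Rplus/R0]_(B <- bs) (Rmult (lam B) (if i \in B then R1 else R0))].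

Definition base_polytope (M : matroid) : pset := conv_bases (bases M).

Definition dotE (E : {fset nat}) (w x : point) : R :=
  \big[Rplus/R0]_(i <- E) (Rmult (w i) (x i)).

Definition pset_eq (P Q : pset) : Prop := forall x, P x <-> Q x.

(** F is a face of the polytope Q in R^E (possibly empty) *)
Definition is_face (E : {fset nat}) (Q F : pset) : Prop :=
  exists (w : point) (c : R),
    (forall x, Q x -> Rle (dotE E w x) c) /\
    pset_eq F (fun x => Q x /\ dotE E w x = c).

Definition nonempty (P : pset) : Prop := exists x, P x.

Definition boundary (E : {fset nat}) (Q : pset) : pset := fun x =>
  exists F, is_face E Q F /\ ~ pset_eq F Q /\ F x.

Definition aff_indep (ps : seq point) : Prop :=
  forall c : seq R, size c = size ps ->
    \big[Rplus/R0]_(i < size ps) nth R0 c i = R0 ->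
    (forall j, \big[Rplus/R0]_(i < size ps) (Rmult (nth R0 c i) ((nth (fun _ => R0) ps i) j)) = R0) ->
    forall i, (i < size ps)%nat -> nth R0 c i = R0.

Definition all_in (Q : pset) (ps : seq point) : Prop :=
  forall i, (i < size ps)%nat -> Q (nth (fun _ => R0) ps i).

Definition has_dim (Q : pset) (d : nat) : Prop :=
  (exists ps, [/\ size ps = d.+1, all_in Q ps & aff_indep ps]) /\
  ~ (exists ps, [/\ size ps = d.+2, all_in Q ps & aff_indep ps]).

Definition pdim (Q : pset) : nat := epsilon (inhabits 0%nat) (has_dim Q).

(** A matroid subdivision of P(M): a finite set S of polytopes (cells and all
    their nonempty faces), each the base polytope of a matroid on E, given by
    its family of bases. *)
Definition matroid_subdivision (M : matroid) (S : {fset {fset {fset nat}}}) : Prop :=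
  let E := ground M in
  [/\ (forall bs, bs \in S -> is_matroid (Matroid E bs)),
      (forall bs F, bs \in S -> is_face E (conv_bases bs) F -> nonempty F ->
         exists2 bs', bs' \in S & pset_eq (conv_bases bs') F),
      (forall bs1 bs2, bs1 \in S -> bs2 \in S ->
         let I := fun x => conv_bases bs1 x /\ conv_bases bs2 x in
         ~ nonempty I \/ (is_face E (conv_bases bs1) I /\ is_face E (conv_bases bs2) I)) &
      pset_eq (base_polytope M) (fun x => exists2 bs, bs \in S & conv_bases bs x)].

Definition interior_cell (M : matroid) (bs : {fset {fset nat}}) : bool :=
  if excluded_middle_informative
       (~ (forall x, conv_bases bs x -> boundary (ground M) (base_polytope M) x))
  then true else false.

Definition valuative (G : zmodType) (f : matroid -> G) : Prop :=
  (forall M N, is_matroid M -> is_matroid N -> matroid_iso M N -> f M = f N) /\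
  (forall M S, is_matroid M -> matroid_subdivision M S ->
     f M = \sum_(bs <- S | interior_cell M bs)
              f (Matroid (ground M) bs) *~ ((-1) ^+ (pdim (base_polytope M)
                                                 - pdim (conv_bases bs))%nat)).

(* Main.v *)
Require Import Defs.
From HB Require Import structures.
From mathcomp Require Import all_boot all_order all_algebra.
From mathcomp Require Import finmap mpoly.
From mathcomp Require Import boolp reals Rstruct ring lra zify.

(** Both Hilbert series are sums, over the chains of flats, of weights that depend
    only on the ranks of the flats; and the indicator function of prescribing the
    ranks along a chain of sets is valuative.

    Hilbert series.  Put [x_E := - sum_(F containing i) x_F] in the reduced ring and
    [x_E := - sum_(F <> E) x_F] in the augmented one (eliminating the [y_i] and the
    variable of the empty flat).  With [h_G = sum_(H >= G) x_H], either ring becomes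
    Q[x_F : F nonempty flat] modulo [x_F x_G] (F, G incomparable),
    [x_F h_G ^ (r G - r F)] (F < G) and [h_G ^ (r G + s)], where [s = 0] in the reduced
    and [s = 1] in the augmented case; this uses only submodularity.  Adjoining the
    flats one at a time, larger ones first, [x_G] satisfies one monic equation
    [P = (x_G + h) ^ c] and is annihilated by the relations [J] of the interval above
    [G], and [P(0) J = 0]: this is the algebra of a blow-up, and it adds
    [x_G ^ i * (ring of the interval)] for [0 < i < c].  Iterating gives the
    Feichtner-Yuzvinsky basis.

    Valuativity.  The Euler characteristic shows that if a relatively open bounded
    convex set of dimension [d] is a finite disjoint union of such sets of dimensions
    [d_i], then [(-1)^d = sum_i (-1)^(d_i)].  The relative interior of P(M) is the
    disjoint union of those of the interior cells, and this remains true after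
    intersecting with open half spaces [x(A_j) > s_j - 1/2].  When the [A_j] form a chain,
    some basis attains all the ranks [r(A_j)], so a cell meets the half spaces iff
    [r(A_j) >= s_j] for all j.  Hence every function of the ranks along a chain of
    sets is valuative, and so are the two series: whether a flat of a chain is
    closed can be tested inside the next flat of the chain, by an alternating sum of
    rank conditions on sets that lie between the two. *)

Set Implicit Arguments.
Unset Strict Implicit.
Unset Printing Implicit Defensive.

Import GRing.Theory Num.Theory Order.TTheory.
Local Open Scope fset_scope.
Local Open Scope ring_scope.

(** * Ideals and blow-ups *)

Section Ideals.
Variable R : comNzRingType.
Implicit Types (S I J : R -> Prop) (x y : R).

(** [hilb_coef] and [pdim] are values chosen by [epsilon], so neither is known before a witness is
    exhibited and its uniqueness proved: hence an explicit basis in each degree, with a spanning and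
    an independence proof, rather than exact sequences. Independence is division with remainder by a
    monic polynomial in the newest variable, for which iterated univariate polynomial rings are the
    convenient model; the given multivariate presentations are compared with it by substitutions.
    The shift [s] of the exponents has one origin: star_i = sum_(H containing i) x_H satisfies
    star_i^(s+1) = 0, being zero in the reduced ring and -y_i, of square zero, in the augmented one.
    On the polyhedral side the obstacle is that closedness of a set Z concerns all the sets Z + e at
    once, and these do not form a chain; in the alternating sum each term involves a single set Z +
    U. Such a set must also be comparable with the other members of the chain, which is why U is
    taken inside the next flat. *)

Definition is_ideal I := 
  [/\ I 0, forall x y, I x -> I y -> I (x + y) & forall a x, I x -> I (a * x)].

Inductive ideal S : R -> Prop :=
| ideal_zero : ideal S 0
| ideal_cons a x y : S x -> ideal S y -> ideal S (a * x + y).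

Lemma ideal_is_ideal S : is_ideal (ideal S).
Proof.
split; first exact: ideal_zero.
- move=> x y; elim=> [|a z t Sz _ IH] Iy; first by rewrite add0r.
  by rewrite -addrA; apply: ideal_cons Sz (IH Iy).
- move=> a x; elim=> [|b z t Sz _ IH]; first by rewrite mulr0; apply: ideal_zero.
  by rewrite mulrDr mulrA; apply: ideal_cons.
Qed.

Lemma ideal_gen S x : S x -> ideal S x.
Proof. by move=> Sx; rewrite -[x]mul1r -[_ * _]addr0; apply: ideal_cons => //; apply: ideal_zero. Qed.

Lemma ideal_min S I : is_ideal I -> (forall x, S x -> I x) -> forall x, ideal S x -> I x.
Proof.
move=> [I0 ID IM] SI x; elim=> [//|a y z Sy _ Iz].
by apply: ID => //; apply: IM; apply: SI.
Qed.

Section Closure.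
Variables (I : R -> Prop) (idI : is_ideal I).

Lemma ideal_has0 : I 0. Proof. by case: idI. Qed.
Lemma ideal_add x y : I x -> I y -> I (x + y). Proof. by case: idI => _ h _; apply: h. Qed.
Lemma ideal_mull a x : I x -> I (a * x). Proof. by case: idI => _ _; apply. Qed.
Lemma ideal_mulr a x : I x -> I (x * a). Proof. by rewrite mulrC; apply: ideal_mull. Qed.
Lemma ideal_opp x : I x -> I (- x). Proof. by rewrite -mulN1r; apply: ideal_mull. Qed.
Lemma ideal_sub x y : I x -> I y -> I (x - y).
Proof. by move=> Ix Iy; apply: ideal_add => //; apply: ideal_opp. Qed.
Lemma ideal_sum (T : Type) (r : seq T) (P : pred T) (F : T -> R) :
  (forall i, P i -> I (F i)) -> I (\sum_(i <- r | P i) F i).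
Proof. by move=> IF; elim/big_ind: _ => //; [exact: ideal_has0 | exact: ideal_add]. Qed.
Lemma ideal_sum_seq (T : eqType) (r : seq T) (P : pred T) (F : T -> R) :
  (forall i, i \in r -> P i -> I (F i)) -> I (\sum_(i <- r | P i) F i).
Proof.
by move=> IF; rewrite big_seq_cond; apply: ideal_sum => i /andP[]; apply: IF.
Qed.
Lemma ideal_eqmod x y : I (x - y) -> I x <-> I y.
Proof.
move=> Ixy; split=> [Ix|Iy]; last by rewrite -[x](subrK y); apply: ideal_add.
by rewrite -[y](subKr x); apply: ideal_sub.
Qed.
(** The multiplier [a] stays a single factor, since only [a * x - a * y], not [x - y], is known to
    lie in the ideal. This is how h_A is exchanged for another upper sum under a power, next to a
    variable x_F. *)
Lemma ideal_subX a x y c : I (a * x - a * y) -> I (a * x ^+ c - a * y ^+ c).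
Proof.
move=> Ixy; elim: c => [|c IH]; first by rewrite !expr0 subrr; apply: ideal_has0.
have -> : a * x ^+ c.+1 - a * y ^+ c.+1 =
  x ^+ c * (a * x - a * y) + y * (a * x ^+ c - a * y ^+ c) by rewrite !exprS; ring.
by apply: ideal_add; apply: ideal_mull.
Qed.
Lemma is_ideal_colon b : is_ideal (fun x => I (x * b)).
Proof.
split=> [|x y Ix Iy|a x Ix]; rewrite ?mul0r ?mulrDl -?mulrA; first exact: ideal_has0.
  exact: ideal_add.
exact: ideal_mull.
Qed.
End Closure.

End Ideals.

Section BlowUp.
Variable R : comNzRingType.
Implicit Types (I J : R -> Prop).

Lemma ideal_preim (R' : comNzRingType) (f : {rmorphism R' -> R}) I :
  is_ideal I -> is_ideal (fun x => I (f x)).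
Proof.
move=> idI; split=> [|x y Ix Iy|a x Ix]; rewrite ?rmorph0 ?rmorphD ?rmorphM.
- exact: ideal_has0.
- exact: ideal_add.
- exact: ideal_mull.
Qed.

Definition coefs_in I (p : {poly R}) := forall i, I p`_i.

Lemma coefs_in_ideal I : is_ideal I -> is_ideal (coefs_in I : {poly R} -> Prop).
Proof.
move=> idI; split=> [i|p q Ip Iq i|a p Ip i]; rewrite ?coef0 ?coefD ?coefM.
- exact: ideal_has0.
- exact: ideal_add.
- by apply: (ideal_sum idI) => j _; apply: ideal_mull.
Qed.

(** Modelled on the Chow ring of a blow-up: [I] gives the relations of the base, [J] the kernel of
    restriction to the centre, ['X] is up to sign the exceptional divisor, and [P] will be monic
    with the class of the centre as constant term. *)
Definition blowup_ideal I J (P : {poly R}) (f : {poly R}) : Prop :=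
  exists u v q, [/\ coefs_in I u, coefs_in J v & f = u + v * 'X + q * P].

Lemma blowup_ideal_is_ideal I J P :
  is_ideal I -> is_ideal J -> is_ideal (blowup_ideal I J P).
Proof.
move=> /coefs_in_ideal idI /coefs_in_ideal idJ; split.
- exists 0, 0, 0; split; [exact: (ideal_has0 idI)|exact: (ideal_has0 idJ)|].
  by rewrite !mul0r !addr0.
- move=> f g [u [v [q [Iu Jv ->]]]] [u' [v' [q' [Iu' Jv' ->]]]].
  exists (u + u'), (v + v'), (q + q'); split; [exact: (ideal_add idI)|exact: (ideal_add idJ)|].
  by ring.
- move=> a f [u [v [q [Iu Jv ->]]]].
  exists (a * u), (a * v), (a * q); split; [exact: (ideal_mull idI)|exact: (ideal_mull idJ)|].
  by ring.
Qed.

(* [P] becomes monic modulo [J], so that a remainder of size at most [c] in the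
   blow-up ideal has all its coefficients in [J], and so has the quotient [q];
   the constant coefficient of [q * P] is then in [I] since [P`_0 J <= I]. *)
Lemma blowup_normal_form I J P c (f : {poly R}) :
  is_ideal I -> is_ideal J -> (forall x, I x -> J x) ->
  P \is monic -> size P = c.+1 ->
  (forall x, J x -> I (x * P`_0)) ->
  (size f <= c)%N -> blowup_ideal I J P f -> I f`_0 /\ coefs_in J f.
Proof.
move=> idI idJ IJ monP szP P0 szf [u [v [q [Iu Jv ef]]]].
have Jw : coefs_in J (u + v * 'X).
  apply: (ideal_add (coefs_in_ideal idJ)); first by move=> i; apply: IJ.
  exact: (ideal_mulr (coefs_in_ideal idJ)).
(* Descending induction on [i]: the coefficient of degree [i + c] of [q * P] is that of [q] at [i]
   plus products with later coefficients of [q], and [f] has no term in that degree. *)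
have Jq : coefs_in J q.
  move=> i; have [m] := ubnP (size q - i); elim: m i => // m IH i lm.
  have [lt_i|le_i] := ltnP i (size q); last first.
    by rewrite nth_default //; apply: ideal_has0.
  have : f`_(i + c) = 0 by rewrite nth_default // (leq_trans szf) // leq_addl.
  rewrite ef coefD coefMr (bigD1 (inord c : 'I_(i + c).+1)) //=.
  rewrite inordK ?ltnS ?leq_addl // addnK.
  have /monicP := monP; rewrite lead_coefE szP /= => ->; rewrite mulr1.
  rewrite addrCA => /eqP; rewrite addr_eq0 => /eqP ->; apply: (ideal_opp idJ).
  apply: (ideal_add idJ) => //.
  apply: (ideal_sum idJ) => j nj; have [lt_cj|le_jc] := ltnP c j.
    by rewrite [P`_j]nth_default ?szP // mulr0; apply: ideal_has0.
  apply: (ideal_mulr idJ); apply: IH.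
  have ne : (j : nat) != c.
    by apply: contraNneq nj => ejc; apply/eqP/val_inj; rewrite /= inordK // ltnS leq_addl.
  have lj : (j < c)%N by rewrite ltn_neqAle ne.
  lia.
split; last first.
  by rewrite ef; apply: (ideal_add (coefs_in_ideal idJ)) => //; apply: (ideal_mulr (coefs_in_ideal idJ)).
rewrite ef !coefD coefMX /= addr0 coef0M.
by apply: (ideal_add idI) => //; apply: P0.
Qed.

End BlowUp.

(** * The Feichtner-Yuzvinsky basis *)

(* The polynomial ring with one variable for each member of [ls], as an iterated
   univariate polynomial ring whose outermost variable is the head of [ls]. *)
Fixpoint tower (L : Type) (ls : seq L) : comNzRingType :=
  if ls is _ :: ls' then {poly tower ls'} else rat.

Fixpoint tower_const (L : Type) (ls : seq L) : {rmorphism rat -> tower ls} :=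
  match ls return {rmorphism rat -> tower ls} with
  | [::] => idfun
  | _ :: ls' => (polyC \o tower_const ls' : {rmorphism rat -> {poly tower ls'}})
  end.

Fixpoint tower_var (L : eqType) (ls : seq L) (F : L) : tower ls :=
  match ls return tower ls with
  | [::] => 0
  | G :: ls' => if F == G then 'X else (tower_var ls' F)%:P
  end.

Fixpoint tower_homog (L : Type) (ls : seq L) (k : nat) : tower ls -> Prop :=
  match ls return tower ls -> Prop with
  | [::] => fun q => (k == 0)%N || (q == 0)
  | _ :: ls' => fun p : {poly tower ls'} => forall i,
      if (i <= k)%N then tower_homog (k - i) p`_i else p`_i = 0
  end.

Fixpoint tower_eval (L : Type) (A : comNzRingType) (e : {rmorphism rat -> A})
  (v : L -> A) (ls : seq L) : {rmorphism tower ls -> A} :=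
  match ls return {rmorphism tower ls -> A} with
  | [::] => e
  | G :: ls' => (horner_morph (fun x => mulrC (v G) (tower_eval e v ls' x))
                : {rmorphism {poly tower ls'} -> A})
  end.

Section Tower.
Variable L : eqType.
Implicit Types (ls : seq L) (F G : L).

Lemma tower_eval_const (A : comNzRingType) (e : {rmorphism rat -> A}) v ls q :
  tower_eval e v ls (tower_const ls q) = e q.
Proof. by elim: ls => //= G ls IH; rewrite horner_morphC. Qed.

Lemma tower_eval_var (A : comNzRingType) (e : {rmorphism rat -> A}) (v : L -> A) ls F :
  F \in ls -> tower_eval e v ls (tower_var ls F) = v F.
Proof.
elim: ls => //= G ls IH; rewrite inE; case: eqP => [-> _|_ /= Fls].
  by rewrite horner_morphX.
by rewrite horner_morphC IH.
Qed.

Lemma tower_homog0 ls k : tower_homog k (0 : tower ls).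
Proof. by elim: ls k => [|G ls IH] k /=; [rewrite eqxx orbT|move=> i; rewrite coef0; case: ifP]. Qed.

Lemma tower_homogD ls k (x y : tower ls) :
  tower_homog k x -> tower_homog k y -> tower_homog k (x + y).
Proof.
elim: ls k x y => [|G ls IH] k /= x y.
  by case: eqP => //= _ /eqP -> /eqP ->; rewrite addr0.
move=> hx hy i; have := hx i; have := hy i; rewrite coefD.
by case: ifP => _; [move=> ? ?; apply: IH|move=> -> ->; rewrite addr0].
Qed.

Lemma tower_homog_sum ls k (T : Type) (r : seq T) (P : pred T) (F : T -> tower ls) :
  (forall i, P i -> tower_homog k (F i)) -> tower_homog k (\sum_(i <- r | P i) F i).
Proof. by move=> h; elim/big_ind: _ => //; [exact: tower_homog0|exact: tower_homogD]. Qed.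

Lemma tower_homogM ls k m (x y : tower ls) :
  tower_homog k x -> tower_homog m y -> tower_homog (k + m) (x * y).
Proof.
elim: ls k m x y => [|G ls IH] k m /= x y.
  by rewrite addn_eq0; case: eqP => //= _; [move=> _|move=> /eqP -> _];
    [case: eqP => //= _ /eqP ->; rewrite mulr0|rewrite mul0r].
move=> hx hy i; rewrite coefM; case: ifP => lei.
- apply: tower_homog_sum => j _; have := hx j; have := hy (i - j)%N.
  case: ifP => h1; case: ifP => h2;
    try by [move=> _ ->; rewrite mul0r; apply: tower_homog0
           |move=> -> _; rewrite mulr0; apply: tower_homog0].
  have lj : (j <= i)%N by rewrite -ltnS.
  move=> ? ?; have -> : (k + m - i = (k - j) + (m - (i - j)))%N by lia.
  exact: IH.
- apply: big1 => j _; have := hx j; have := hy (i - j)%N.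
  case: ifP => h1; case: ifP => h2; do ?by [move=> _ ->; rewrite mul0r | move=> -> _; rewrite mulr0].
  by case: j h1 h2 => j /=; rewrite ltnS => ji *; lia.
Qed.

Lemma tower_homogN ls k (x : tower ls) : tower_homog k x -> tower_homog k (- x).
Proof.
elim: ls k x => [|G ls IH] k /= x; first by rewrite oppr_eq0.
by move=> hx i; have := hx i; rewrite coefN; case: ifP => _; [apply: IH|move=> ->; rewrite oppr0].
Qed.

Lemma tower_homog_polyC G ls k (x : tower ls) :
  tower_homog k x -> @tower_homog _ (G :: ls) k x%:P.
Proof.
by move=> hx [|i] /=; rewrite coefC /= ?subn0 //; case: ifP => // _; apply: tower_homog0.
Qed.

Lemma tower_homog_const ls q : tower_homog 0 (tower_const ls q).
Proof. by elim: ls => //= G ls IH; apply: (@tower_homog_polyC G). Qed.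

Lemma tower_homog1 ls : tower_homog 0 (1 : tower ls).
Proof. by rewrite -(rmorph1 (tower_const ls)); apply: tower_homog_const. Qed.

Lemma tower_homogX ls k (x : tower ls) n : tower_homog k x -> tower_homog (k * n) (x ^+ n).
Proof.
move=> hx; elim: n => [|n IH]; first by rewrite muln0; apply: tower_homog1.
by rewrite exprS mulnS; apply: tower_homogM.
Qed.

Lemma tower_homog_top G ls : @tower_homog _ (G :: ls) 1 'X.
Proof.
move=> [|[|i]] /=; rewrite coefX /= //; first exact: tower_homog0.
exact: tower_homog1.
Qed.

Lemma tower_homog_var ls F : tower_homog 1 (tower_var ls F).
Proof.
elim: ls => //= G ls IH; case: eqP => _; first exact: (tower_homog_top G).
exact: (@tower_homog_polyC G).
Qed.

(** Without repetitions in [ls] every variable of the tower is some [tower_var]; of a repeated label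
    only the outermost variable would be reached. *)
Lemma tower_const_var_ind ls (P : tower ls -> Prop) :
  (forall q, P (tower_const ls q)) -> (forall F, F \in ls -> P (tower_var ls F)) ->
  (forall x y, P x -> P y -> P (x + y)) -> (forall x y, P x -> P y -> P (x * y)) ->
  uniq ls -> forall x, P x.
Proof.
elim: ls P => [|G ls IH] P /= Pc Pv PD PM; first by move=> _ x; apply: Pc.
move=> /andP[Gls uls] p.
have PC x : P x%:P.
  apply: (IH (fun x => P x%:P)) => //.
  - by move=> F Fls; have := Pv F; rewrite inE Fls orbT; case: eqP Fls Gls => [-> ->//|_ _ _]; apply.
  - by move=> a b Pa Pb; rewrite polyCD; apply: PD.
  - by move=> a b Pa Pb; rewrite polyCM; apply: PM.
elim/poly_ind: p => [|p c IHp]; first by rewrite -polyC0.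
by apply: PD => //; apply: PM => //; have := Pv G; rewrite inE eqxx; apply.
Qed.

End Tower.

(** * Rational linear combinations modulo an ideal *)

Section Combinations.
Variables (R : comNzRingType) (e : {rmorphism rat -> R}).
Implicit Types (cs : seq rat) (bs : seq R) (I : R -> Prop).

Definition comb cs bs : R := \sum_(p <- zip cs bs) e p.1 * p.2.

Definition indep I bs :=
  forall cs, size cs = size bs -> I (comb cs bs) -> all (eq_op^~ 0) cs.
Definition spans I bs f := exists2 cs, size cs = size bs & I (f - comb cs bs).

Lemma comb_cat cs1 cs2 bs1 bs2 : size cs1 = size bs1 ->
  comb (cs1 ++ cs2) (bs1 ++ bs2) = comb cs1 bs1 + comb cs2 bs2.
Proof. by move=> h; rewrite /comb zip_cat // big_cat. Qed.

Lemma comb0 n bs : comb (nseq n 0) bs = 0.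
Proof.
elim: n bs => [|n IH] [|b bs]; rewrite /comb /= ?big_nil //.
by rewrite big_cons /= rmorph0 mul0r add0r; apply: IH.
Qed.

Lemma combD cs1 cs2 bs : size cs1 = size bs -> size cs2 = size bs ->
  comb [seq p.1 + p.2 | p <- zip cs1 cs2] bs = comb cs1 bs + comb cs2 bs.
Proof.
elim: bs cs1 cs2 => [|b bs IH] [|c1 cs1] [|c2 cs2] //=; rewrite /comb /= ?big_nil ?addr0 //.
move=> [s1] [s2]; rewrite !big_cons /= [X in _ + X = _]IH // rmorphD /comb; ring.
Qed.

Section Spans.
Variables (I : R -> Prop) (idI : is_ideal I).

Lemma spans0 bs f : I f -> spans I bs f.
Proof. by exists (nseq (size bs) 0); rewrite ?size_nseq // comb0 subr0. Qed.

Lemma spansD bs f g : spans I bs f -> spans I bs g -> spans I bs (f + g).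
Proof.
move=> [c1 s1 I1] [c2 s2 I2]; exists [seq p.1 + p.2 | p <- zip c1 c2].
  by rewrite size_map size1_zip // s1 s2.
rewrite combD //; have -> : f + g - (comb c1 bs + comb c2 bs) =
  (f - comb c1 bs) + (g - comb c2 bs) by ring.
exact: ideal_add.
Qed.

Lemma spans_sum bs (T : Type) (r : seq T) (P : pred T) (F : T -> R) :
  (forall i, P i -> spans I bs (F i)) -> spans I bs (\sum_(i <- r | P i) F i).
Proof.
move=> h; elim/big_ind: _ => //; last exact: spansD.
by apply: spans0; apply: ideal_has0.
Qed.

Lemma spans_catl bs1 bs2 f : spans I bs1 f -> spans I (bs1 ++ bs2) f.
Proof.
move=> [c s Ic]; exists (c ++ nseq (size bs2) 0); first by rewrite !size_cat s size_nseq.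
by rewrite comb_cat // comb0 addr0.
Qed.

Lemma spans_catr bs1 bs2 f : spans I bs2 f -> spans I (bs1 ++ bs2) f.
Proof.
move=> [c s Ic]; exists (nseq (size bs1) 0 ++ c); first by rewrite !size_cat s size_nseq.
by rewrite comb_cat ?size_nseq // comb0 add0r.
Qed.

Lemma spans_flatten (T : eqType) (s : seq T) (B : T -> seq R) i f :
  i \in s -> spans I (B i) f -> spans I (flatten (map B s)) f.
Proof.
elim: s => //= j s IH; rewrite inE => /orP[/eqP <-|/IH h /h]; first exact: spans_catl.
exact: spans_catr.
Qed.
End Spans.

End Combinations.

Lemma comb_map (R R' : comNzRingType) (e : {rmorphism rat -> R}) (e' : {rmorphism rat -> R'})
  (f : R -> R') (bs : seq R) cs :
  f 0 = 0 -> (forall x y, f (x + y) = f x + f y) ->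
  (forall q x, f (e q * x) = e' q * f x) ->
  comb e' cs (map f bs) = f (comb e cs bs).
Proof.
move=> f0 fD fe; elim: bs cs => [|b bs IH] [|c cs]; rewrite /comb /= ?big_nil ?f0 //.
by rewrite !big_cons /= fD fe [X in _ + X = _]IH.
Qed.

(** Submodularity is stated against an arbitrary common lower bound [Z], which stands in for the
    meet; in the recursion [Z] is the flat at which the current interval starts. *)
Record ranked_lattice (L : eqType) := RankedLattice {
  flat : pred L;
  le : rel L;
  join : L -> L -> L;
  rk : L -> nat;
  flat_le_refl : reflexive le;
  flat_le_anti : antisymmetric le;
  flat_le_trans : transitive le;
  flat_join : forall F G, flat F -> flat G -> flat (join F G);
  le_joinl : forall F G, flat F -> flat G -> le F (join F G);
  le_joinr : forall F G, flat F -> flat G -> le G (join F G);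
  join_least : forall F G H, flat F -> flat G -> flat H ->
    le F H -> le G H -> le (join F G) H;
  rk_lt : forall F G, flat F -> flat G -> le F G -> F != G -> (rk F < rk G)%N;
  rk_submod : forall Z F G, flat Z -> flat F -> flat G -> le Z F -> le Z G ->
    (rk (join F G) + rk Z <= rk F + rk G)%N }.

Section FY.
Variables (L : eqType) (X : ranked_lattice L).
Local Notation flat := (flat X).
Local Notation le := (le X).
Local Notation join := (join X).
Local Notation rk := (rk X).
Implicit Types (ls : seq L) (F G H A Z : L).

Definition below F G := le F G && (F != G).

(* Each member of [ls] comes before all the flats that contain it properly. *)
Fixpoint admissible ls : Prop :=
  if ls is G :: ls' then
    [/\ flat G, all (fun F => ~~ le F G) ls', (forall H, flat H -> below G H -> H \in ls')
      & admissible ls']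
  else True.

Lemma below_trans F G H : below F G -> below G H -> below F H.
Proof.
move=> /andP[lFG nFG] /andP[lGH nGH]; rewrite /below (flat_le_trans lFG lGH) /=.
by apply: contra nGH => /eqP eFH; rewrite eFH in lFG *; apply/eqP; apply: (flat_le_anti (r := X)); rewrite lGH.
Qed.

Lemma below_rk F G : flat F -> flat G -> below F G -> (rk F < rk G)%N.
Proof. by move=> fF fG /andP[]; apply: rk_lt. Qed.

Lemma admissible_flat ls F : admissible ls -> F \in ls -> flat F.
Proof. by elim: ls => //= G ls IH [fG _ _ /IH h]; rewrite inE => /orP[/eqP ->|]. Qed.

Lemma admissible_up ls F H : admissible ls -> F \in ls -> flat H -> le F H -> H \in ls.
Proof.
elim: ls => //= G ls IH [fG _ up /IH h]; rewrite !inE => /orP[/eqP ->|Fls] fH lH.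
  by case: eqP => //= /eqP nGH; apply: up => //; rewrite /below lH eq_sym.
by rewrite h ?orbT.
Qed.

Lemma admissible_uniq ls : admissible ls -> uniq ls.
Proof.
elim: ls => //= G ls IH [_ /allP nle _ /IH ->]; rewrite andbT.
by apply/negP => /nle; rewrite flat_le_refl.
Qed.

Definition upsum ls G : tower ls := \sum_(H <- ls | le G H) tower_var ls H.

Lemma tower_var_cons G ls F : G \notin ls -> F \in ls ->
  tower_var (G :: ls) F = (tower_var ls F)%:P.
Proof. by move=> Gls Fls /=; case: eqP Fls Gls => // -> ->. Qed.

Lemma upsum_cons G ls A : G \notin ls ->
  upsum (G :: ls) A = (if le A G then 'X else 0) + (upsum ls A)%:P.
Proof.
move=> Gls; rewrite /upsum big_cons raddf_sum /= eqxx.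
have -> : \sum_(H <- ls | le A H) tower_var (G :: ls) H =
          \sum_(H <- ls | le A H) (tower_var ls H)%:P.
  rewrite big_seq_cond [RHS]big_seq_cond; apply: eq_bigr => H /andP[Hls _].
  exact: tower_var_cons.
by case: ifP => _; rewrite ?add0r.
Qed.

(* The presentation attached to the flats above [Z]: all other variables are zero. *)
Inductive FY_gen ls Z s : tower ls -> Prop :=
| FY_inactive F : F \in ls -> ~~ below Z F -> FY_gen Z s (tower_var ls F)
| FY_incomparable F G : F \in ls -> G \in ls -> ~~ le F G -> ~~ le G F ->
    FY_gen Z s (tower_var ls F * tower_var ls G)
| FY_pair F A : F \in ls -> A \in ls -> below F A ->
    FY_gen Z s (tower_var ls F * upsum ls A ^+ (rk A - rk F))
| FY_single A : A \in ls -> below Z A ->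
    FY_gen Z s (upsum ls A ^+ (rk A - rk Z + s)).

Definition FY_ideal ls Z s : tower ls -> Prop := ideal (@FY_gen ls Z s).

Lemma FY_is_ideal ls Z s : is_ideal (@FY_ideal ls Z s).
Proof. exact: ideal_is_ideal. Qed.

(** A term w_H with [le A H] survives multiplication by w_F only if H is comparable with F; [le H F]
    would give [le A F], so H lies above [join F A]. The ring and [w] are arbitrary because the
    argument serves both the tower and the multivariate presentations. *)
Lemma incomparable_join (R : comNzRingType) (I : R -> Prop) (w : L -> R) ls F A :
  is_ideal I ->
  (forall G H, G \in ls -> H \in ls -> ~~ le G H -> ~~ le H G -> I (w G * w H)) ->
  admissible ls -> F \in ls -> flat A -> ~~ le A F ->
  I (w F * (\sum_(H <- ls | le A H) w H) - w F * (\sum_(H <- ls | le (join F A) H) w H)).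
Proof.
move=> idI Iw adm Fls fA nAF; have fF := admissible_flat adm Fls.
rewrite [X in w F * X - _](bigID (le F)) /=.
have -> : \sum_(H <- ls | le (join F A) H) w H = \sum_(H <- ls | le A H && le F H) w H.
  rewrite big_seq_cond [RHS]big_seq_cond; apply: eq_bigl => H.
  case Hls: (H \in ls) => //=; have fH := admissible_flat adm Hls.
  apply/idP/andP => [lH|[lA lF]]; last exact: join_least.
  by split; apply: flat_le_trans lH; [apply: le_joinr|apply: le_joinl].
rewrite mulrDr addrAC subrr add0r mulr_sumr.
apply: (ideal_sum_seq idI) => H Hls /andP[lAH nFH]; apply: Iw => //.
by apply: contra nAF; apply: flat_le_trans.
Qed.

Lemma var_upsum_join ls Z s F A : admissible ls -> F \in ls -> flat A -> ~~ le A F ->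
  FY_ideal Z s (tower_var ls F * upsum ls A - tower_var ls F * upsum ls (join F A)).
Proof.
move=> adm Fls fA nAF; apply: incomparable_join => //; first exact: FY_is_ideal.
by move=> G H Gls Hls n1 n2; apply: ideal_gen; apply: FY_incomparable.
Qed.

(** Next to x_F the sum h_A may be replaced by h_(join F A), and then the pair relation of F < join
    F A applies. *)
Lemma var_upsum_vanish ls Z s F A c : admissible ls -> F \in ls -> flat A -> ~~ le A F ->
  (rk (join F A) - rk F <= c)%N ->
  FY_ideal Z s (tower_var ls F * upsum ls A ^+ c).
Proof.
move=> adm Fls fA nAF lec; have fF := admissible_flat adm Fls.
have idI := FY_is_ideal ls Z s.
apply/(ideal_eqmod idI (ideal_subX idI c (var_upsum_join Z s adm Fls fA nAF))).
have lFJ : below F (join F A).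
  by rewrite /below le_joinl //=; apply: contra nAF => /eqP ->; apply: le_joinr.
have Jls : join F A \in ls.
  by apply: admissible_up adm Fls _ _; [apply: flat_join|case/andP: lFJ].
rewrite -(subnK lec) addnC exprD mulrA; apply: (ideal_mulr idI).
by apply: ideal_gen; apply: FY_pair.
Qed.

(* [x_F] vanishes unless [G < F], so [h_A] is congruent to [h_(join G A)]. *)
Lemma FY_ideal_mono ls Z G s : admissible ls -> flat Z -> flat G ->
  all (fun F => ~~ le F G) ls -> (forall H, flat H -> below G H -> H \in ls) -> below Z G ->
  forall x, @FY_ideal ls Z s x -> @FY_ideal ls G 0 x.
Proof.
move=> adm fZ fG /allP nle up lZG; have idJ := FY_is_ideal ls G 0.
apply: (ideal_min idJ) => x [F Fls nF|F F' *|F A *|A Als lZA].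
- by apply: ideal_gen; apply: FY_inactive => //; apply: contra nF; apply: below_trans.
- by apply: ideal_gen; apply: FY_incomparable.
- by apply: ideal_gen; apply: FY_pair.
have fA := admissible_flat adm Als.
have fJ : flat (join G A) by apply: flat_join.
have lGJ : below G (join G A).
  rewrite /below le_joinl //=; apply: contra (nle _ Als) => /eqP ->; exact: le_joinr.
have Jls := up _ fJ lGJ.
have hJ : FY_ideal G 0 (1 * upsum ls A - 1 * upsum ls (join G A)).
  rewrite !mul1r; have -> : upsum ls A = \sum_(H <- ls | le A H && le G H) tower_var ls H
                     + \sum_(H <- ls | le A H && ~~ le G H) tower_var ls H.
    by rewrite /upsum (bigID (le G)).
  have -> : upsum ls (join G A) = \sum_(H <- ls | le A H && le G H) tower_var ls H.
    rewrite /upsum big_seq_cond [RHS]big_seq_cond; apply: eq_bigl => H.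
    case Hls: (H \in ls) => //=; have fH := admissible_flat adm Hls.
    apply/idP/andP => [lH|[lA lF]]; last exact: join_least.
    by split; apply: flat_le_trans lH; [apply: le_joinr|apply: le_joinl].
  rewrite addrAC subrr add0r; apply: (ideal_sum_seq idJ) => H Hls /andP[_ nGH].
  by apply: ideal_gen; apply: FY_inactive => //; apply: contra nGH => /andP[].
rewrite -[_ ^+ _]mul1r; apply/(ideal_eqmod idJ (ideal_subX idJ _ hJ)); rewrite mul1r.
have lZG' : le Z G by case/andP: lZG.
have lZA' : le Z A by case/andP: lZA.
have sub := rk_submod fZ fG fA lZG' lZA'.
have l1 := below_rk fZ fG lZG; have l2 := below_rk fG fJ lGJ.
have -> : (rk A - rk Z + s = (rk (join G A) - rk G + 0) + (rk A - rk Z + s - (rk (join G A) - rk G)))%N.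
  by lia.
by rewrite exprD; apply: (ideal_mulr idJ); apply: ideal_gen; apply: FY_single.
Qed.

(** This is P(0) J <= I for P(0) = h_G^c, checked on generators. If Z < F but not G < F, then x_F
    h_G^c = 0, since submodularity bounds rk (join F G) - rk F by rk G - rk Z. For A above G, h_A^a
    kills the x_H with H >= G but not H >= A, so h_A^a h_G^c = h_A^(a + c), and a + c is the
    exponent of A over Z. *)
Lemma FY_colon ls Z G s : admissible ls -> flat Z -> flat G ->
  all (fun F => ~~ le F G) ls -> (forall H, flat H -> below G H -> H \in ls) -> below Z G ->
  forall x, @FY_ideal ls G 0 x -> FY_ideal Z s (x * upsum ls G ^+ (rk G - rk Z + s)).
Proof.
move=> adm fZ fG /allP nle up lZG; set c := (_ + s)%N.
have idI := FY_is_ideal ls Z s.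
apply: (ideal_min (is_ideal_colon idI _)) => x [F Fls nF|F F' *|F A *|A Als lGA].
- have fF := admissible_flat adm Fls.
  have [lZF|nZF] := boolP (below Z F); last first.
    by apply: (ideal_mulr idI); apply: ideal_gen; apply: FY_inactive.
  have nGF : ~~ le G F.
    by apply: contra nF => lGF; rewrite /below lGF; apply/eqP => eGF; have := nle _ Fls; rewrite eGF flat_le_refl.
  apply: var_upsum_vanish => //.
  case/andP: lZF => lZF _; case/andP: lZG => lZG _.
  have := rk_submod fZ fF fG lZF lZG; rewrite /c; lia.
- by apply: (ideal_mulr idI); apply: ideal_gen; apply: FY_incomparable.
- by apply: (ideal_mulr idI); apply: ideal_gen; apply: FY_pair.
have fA := admissible_flat adm Als; rewrite addn0; set a := (rk A - _)%N.
have [lGA' _] := andP lGA.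
have h1 : FY_ideal Z s (upsum ls A ^+ a * upsum ls G - upsum ls A ^+ a * upsum ls A).
  have -> : upsum ls G = \sum_(H <- ls | le G H && le A H) tower_var ls H
                     + \sum_(H <- ls | le G H && ~~ le A H) tower_var ls H.
    by rewrite /upsum (bigID (le A)).
  have -> : \sum_(H <- ls | le G H && le A H) tower_var ls H = upsum ls A.
    apply: eq_bigl => H; apply/andP/idP => [[]//|lAH]; split=> //; exact: flat_le_trans lAH.
  rewrite mulrDr addrAC subrr add0r mulr_sumr.
  apply: (ideal_sum_seq idI) => H Hls /andP[lGH nAH]; rewrite mulrC.
  apply: var_upsum_vanish => //.
  have := rk_submod fG (admissible_flat adm Hls) fA lGH lGA'; rewrite /a; lia.
apply/(ideal_eqmod idI (ideal_subX idI c h1)); rewrite -exprD.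
have lZA := below_trans lZG lGA.
have l1 := below_rk fZ fG lZG; have l2 := below_rk fG fA lGA.
have -> : (a + c = rk A - rk Z + s)%N by rewrite /a /c; lia.
by apply: ideal_gen; apply: FY_single.
Qed.

(** * Adjoining one flat to the list *)

Section Cons.
Variables (ls : seq L) (Z G : L) (s : nat).
Hypotheses (adm : admissible (G :: ls)) (fZ : flat Z).
Local Notation c := (rk G - rk Z + s)%N.
Local Notation R := (tower ls).

Let fG : flat G. Proof. by case: adm. Qed.
Let nle F : F \in ls -> ~~ le F G. Proof. by case: adm => _ /allP h _ _; apply: h. Qed.
Let up H : flat H -> below G H -> H \in ls. Proof. by case: adm => _ _ h _; apply: h. Qed.
Let adm' : admissible ls. Proof. by case: adm. Qed.
Let Gls : G \notin ls. Proof. by apply/negP => /nle; rewrite flat_le_refl. Qed.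
Let ltGG : below G G = false. Proof. by rewrite /below eqxx andbF. Qed.

Let upsum_tail A : A \in ls -> upsum (G :: ls) A = (upsum ls A)%:P.
Proof. by move=> Als; rewrite upsum_cons // (negbTE (nle Als)) add0r. Qed.

Let upsum_head : upsum (G :: ls) G = 'X + (upsum ls G)%:P.
Proof. by rewrite upsum_cons // flat_le_refl. Qed.

Let var_head : tower_var (G :: ls) G = 'X. Proof. by rewrite /= eqxx. Qed.

Section InBlowup.
Variables (I J : R -> Prop) (P : {poly R}).
Hypotheses (idI : is_ideal I) (idJ : is_ideal J).
Let idB := blowup_ideal_is_ideal P idI idJ.

Let blow_const x : I x -> blowup_ideal I J P x%:P.
Proof.
move=> Ix; exists x%:P, 0, 0; split; rewrite ?mul0r ?addr0 //.
  by move=> i; rewrite coefC; case: eqP => // _; apply: ideal_has0.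
exact: (ideal_has0 (coefs_in_ideal idJ)).
Qed.

Let blow_X x : J x -> blowup_ideal I J P (x%:P * 'X).
Proof.
move=> Jx; exists 0, x%:P, 0; split; rewrite ?mul0r ?addr0 ?add0r //.
  exact: (ideal_has0 (coefs_in_ideal idI)).
by move=> i; rewrite coefC; case: eqP => // _; apply: ideal_has0.
Qed.

Let blow_P : blowup_ideal I J P P.
Proof.
exists 0, 0, 1; split; rewrite ?mul0r ?mul1r ?add0r //.
  exact: (ideal_has0 (coefs_in_ideal idI)).
exact: (ideal_has0 (coefs_in_ideal idJ)).
Qed.

(** Each generator for [G :: ls] is a constant, a constant times ['X], or a multiple of [P]: no flat
    of [ls] lies below G, so h_A does not involve ['X] for A in [ls], while h_G is ['X] plus a
    constant. An inactive G, one not above Z, is covered by [P = 'X]. *)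
Lemma FY_ideal_cons_blowup :
  (forall x, FY_gen Z s x -> I x) ->
  (below Z G -> forall x, FY_gen G 0 x -> J x) ->
  (below Z G -> P = ('X + (upsum ls G)%:P) ^+ c) ->
  (~~ below Z G -> P = 'X) ->
  forall f, @FY_ideal (G :: ls) Z s f -> blowup_ideal I J P f.
Proof.
move=> gI gJ hlt hnlt; apply: (ideal_min idB) => f.
have PX : ~~ below Z G -> forall g, blowup_ideal I J P ('X * g).
  by move=> nZG g; apply: (ideal_mulr idB); rewrite -[X in blowup_ideal _ _ _ X](hnlt nZG).
case=> [F Fls nF|F F' Fls Fls' n1 n2|F A Fls Als lFA|A Als lZA].
- move: Fls; rewrite inE => /orP[/eqP eF|Fls]; last first.
    by rewrite tower_var_cons //; apply: blow_const; apply: gI; apply: FY_inactive.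
  by rewrite eF in nF *; rewrite var_head -['X]mulr1; apply: PX.
- wlog Fls2 : F F' Fls Fls' n1 n2 / F' \in ls.
    move=> W; move: (Fls') (Fls); rewrite !inE => /orP[/eqP eF'|]; last by move=> ? _; apply: W.
    move=> /orP[/eqP eF|Fl]; first by rewrite eF eF' flat_le_refl in n1.
    by rewrite mulrC; apply: W.
  rewrite (tower_var_cons Gls Fls2).
  move: Fls; rewrite inE => /orP[/eqP eF|Fls]; last first.
    by rewrite tower_var_cons // -polyCM; apply: blow_const; apply: gI; apply: FY_incomparable.
  rewrite eF in n1 n2 *; rewrite var_head.
  have [lZG|/PX//] := boolP (below Z G).
  rewrite mulrC; apply: blow_X; apply: gJ => //; apply: FY_inactive => //.
  by apply: contra n1 => /andP[].
- have Als2 : A \in ls.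
    move: Als; rewrite inE => /orP[/eqP eA|//]; rewrite eA in lFA.
    move: Fls; rewrite inE => /orP[/eqP eF|/nle]; first by rewrite eF ltGG in lFA.
    by case/andP: lFA => ->.
  rewrite upsum_tail //.
  move: Fls; rewrite inE => /orP[/eqP eF|Fls]; last first.
    by rewrite tower_var_cons // -rmorphXn -polyCM; apply: blow_const; apply: gI; apply: FY_pair.
  rewrite eF in lFA *; rewrite var_head.
  have [lZG|/PX//] := boolP (below Z G).
  rewrite mulrC -rmorphXn; apply: blow_X; apply: gJ => //; rewrite -[X in _ ^+ X]addn0.
  exact: FY_single.
- move: Als; rewrite inE => /orP[/eqP eA|Als]; last first.
    by rewrite upsum_tail // -rmorphXn; apply: blow_const; apply: gI; apply: FY_single.
  by rewrite eA in lZA *; rewrite upsum_head -(hlt lZA).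
Qed.
End InBlowup.

Let P : {poly R} := ('X + (upsum ls G)%:P) ^+ c.

Let P_monic : P \is monic.
Proof. by rewrite /P -[_%:P]opprK -polyCN monic_exp // monicXsubC. Qed.

Let P_size : size P = c.+1.
Proof. by rewrite /P -[_%:P]opprK -polyCN size_exp_XsubC. Qed.

Lemma FY_normal_form (f : {poly R}) : below Z G -> (size f <= c)%N ->
  @FY_ideal (G :: ls) Z s f -> FY_ideal Z s f`_0 /\ coefs_in (@FY_ideal ls G 0) f.
Proof.
move=> lZG szf Kf.
apply: (@blowup_normal_form _ (@FY_ideal ls Z s) (@FY_ideal ls G 0) P c) => //.
- exact: FY_is_ideal.
- exact: FY_is_ideal.
- by apply: FY_ideal_mono => //; apply/allP => F; apply: nle.
- have -> : P`_0 = upsum ls G ^+ c by rewrite -horner_coef0 /P horner_exp hornerD hornerX hornerC add0r.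
  by apply: FY_colon => //; apply/allP => F; apply: nle.
apply: FY_ideal_cons_blowup Kf; try exact: FY_is_ideal.
- by move=> x; apply: ideal_gen.
- by move=> _ x; apply: ideal_gen.
- by [].
- by rewrite lZG.
Qed.

Lemma FY_normal_form_inactive (f : {poly R}) : ~~ below Z G -> (size f <= 1)%N ->
  @FY_ideal (G :: ls) Z s f -> FY_ideal Z s f`_0.
Proof.
move=> nZG szf Kf; have idI := FY_is_ideal ls Z s.
(* An inactive variable is a blow-up with [P = 'X] and c = 1, which adds nothing. *)
suff : blowup_ideal (@FY_ideal ls Z s) (@FY_ideal ls Z s) 'X f.
  case/(@blowup_normal_form _ _ _ _ 1%N) => //.
  - exact: monicX.
  - by rewrite size_polyX.
  - by move=> x; rewrite coefX mulr0 => _; apply: (ideal_has0 idI).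
apply: (FY_ideal_cons_blowup idI idI) Kf => //.
- by move=> x; apply: ideal_gen.
- by rewrite (negbTE nZG).
- by rewrite (negbTE nZG).
Qed.

Let idK := FY_is_ideal (G :: ls) Z s.

(** From here to the end of the section: the inclusions opposite to [FY_ideal_cons_blowup]. They
    serve for spanning, as that one does for independence. *)
Lemma FY_ideal_const x : @FY_ideal ls Z s x -> @FY_ideal (G :: ls) Z s x%:P.
Proof.
apply: (ideal_min (ideal_preim (polyC : {rmorphism R -> {poly R}}) idK)) => {}x.
have cons F : F \in ls -> F \in G :: ls by rewrite inE orbC => ->.
case=> [F Fls nF|F F' Fls Fls' n1 n2|F A Fls Als lFA|A Als lZA] /=.
- by rewrite -(tower_var_cons Gls) //; apply: ideal_gen; apply: FY_inactive => //; apply: cons.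
- by rewrite polyCM -!(tower_var_cons Gls) //; apply: ideal_gen; apply: FY_incomparable => //; apply: cons.
- rewrite polyCM rmorphXn /= -upsum_tail // -(tower_var_cons Gls) //.
  by apply: ideal_gen; apply: FY_pair => //; apply: cons.
- by rewrite rmorphXn /= -upsum_tail //; apply: ideal_gen; apply: FY_single => //; apply: cons.
Qed.

Lemma FY_ideal_top x : @FY_ideal ls G 0 x -> @FY_ideal (G :: ls) Z s (x%:P * 'X).
Proof.
have idL := ideal_preim (polyC : {rmorphism R -> {poly R}}) (is_ideal_colon idK 'X).
apply: (ideal_min idL) => {}x.
have cons F : F \in ls -> F \in G :: ls by rewrite inE orbC => ->.
have Gin : G \in G :: ls by rewrite mem_head.
case=> [F Fls nF|F F' Fls Fls' n1 n2|F A Fls Als lFA|A Als lZA] /=.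
- rewrite -(tower_var_cons Gls) // -[X in _ * X]var_head; apply: ideal_gen.
  apply: (FY_incomparable Z s (cons _ Fls) Gin (nle Fls)).
  apply: contra nF => lGF; rewrite /below lGF; apply/eqP => eGF.
  by have := nle Fls; rewrite eGF flat_le_refl.
- apply: (ideal_mulr idK).
  by rewrite polyCM -!(tower_var_cons Gls) //; apply: ideal_gen; apply: FY_incomparable => //; apply: cons.
- apply: (ideal_mulr idK); rewrite polyCM rmorphXn /= -upsum_tail // -(tower_var_cons Gls) //.
  by apply: ideal_gen; apply: FY_pair => //; apply: cons.
- rewrite rmorphXn /= -upsum_tail // mulrC addn0 -[X in X * _]var_head.
  by apply: ideal_gen; apply: FY_pair => //; apply: cons.
Qed.

Lemma FY_ideal_relation : below Z G -> @FY_ideal (G :: ls) Z s P.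
Proof. by move=> lZG; rewrite /P -upsum_head; apply: ideal_gen; apply: FY_single; rewrite ?mem_head. Qed.

Lemma FY_ideal_X_inactive : ~~ below Z G -> @FY_ideal (G :: ls) Z s 'X.
Proof.
move=> nZG; rewrite -var_head; apply: ideal_gen.
by apply: FY_inactive; rewrite ?mem_head.
Qed.

End Cons.

(** The monomials x_(F_1)^(i_1) ... x_(F_m)^(i_m) of degree [k] along chains Z < F_1 < ... < F_m
    with 0 < i_1 < rk F_1 - rk Z + s and 0 < i_j < rk F_j - rk F_(j-1) for j > 1: the shift [s]
    affects the first flat only. *)
Fixpoint FY_basis ls Z (s k : nat) : seq (tower ls) :=
  match ls return seq (tower ls) with
  | [::] => if k == 0%N then [:: 1] else [::]
  | G :: ls' =>
    [seq (b%:P : {poly tower ls'}) | b <- FY_basis ls' Z s k] ++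
    if below Z G then
      flatten [seq if (i <= k)%N
                   then [seq (b%:P * 'X^i : {poly tower ls'}) | b <- FY_basis ls' G 0 (k - i)]
                   else [::] | i <- iota 1 (rk G - rk Z + s).-1]
    else [::]
  end.

Fixpoint FY_series ls Z (s : nat) : {poly int} :=
  if ls is G :: ls' then
    FY_series ls' Z s +
    (if below Z G then (\sum_(1 <= i < rk G - rk Z + s) 'X^i) * FY_series ls' G 0 else 0)
  else 1.

Lemma size_FY_basis ls Z s k : (size (FY_basis ls Z s k))%:Z = (FY_series ls Z s)`_k.
Proof.
elim: ls Z s k => [|G ls IH] Z s k /=; first by rewrite coef1; case: eqP.
rewrite size_cat size_map PoszD IH coefD; congr (_ + _).
case: ifP => _; last by rewrite coef0.
rewrite size_flatten /shape -map_comp sumnE big_map.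
rewrite (big_morph Posz PoszD (erefl _)) big_distrl /= coef_sum.
rewrite -[in RHS]/(index_iota 1 _) /index_iota subn1; apply: eq_bigr => i _.
rewrite mulrC coefMXn ltnNge; case: leqP => //= _.
by rewrite size_map IH.
Qed.

Section Layers.
Variables (R : comNzRingType) (J : R -> Prop) (e : {rmorphism rat -> R}) (k : nat)
  (bas : nat -> seq R).
Let e' : {rmorphism rat -> {poly R}} := (polyC \o e : {rmorphism rat -> {poly R}}).
Let layer i : seq {poly R} :=
  if (i <= k)%N then [seq (b%:P * 'X^i : {poly R}) | b <- bas (k - i)] else [::].
Let layers m := flatten [seq layer i | i <- iota 1 m].

Lemma comb_layer cs (bs : seq R) i :
  comb e' cs [seq (b%:P * 'X^i : {poly R}) | b <- bs] = (comb e cs bs)%:P * 'X^i.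
Proof.
apply: (comb_map (f := fun b => b%:P * 'X^i)) => [|x y|q x].
- by rewrite polyC0 mul0r.
- by rewrite polyCD mulrDl.
- by rewrite polyCM mulrA.
Qed.

(** Triangularity in the power of the variable: only the top layer contributes to the highest
    coefficient, so its scalars vanish first and induction removes the rest. *)
Lemma comb_layers m cs : is_ideal J -> (forall j, indep e J (bas j)) ->
  size cs = size (layers m) ->
  [/\ (size (comb e' cs (layers m)) <= m.+1)%N, (comb e' cs (layers m))`_0 = 0 &
    coefs_in J (comb e' cs (layers m)) -> all (eq_op^~ 0) cs].
Proof.
move=> idJ ind; elim: m cs => [|m IH] cs.
  by case: cs => // _; rewrite /comb big_nil size_poly0 coef0.
have -> : layers m.+1 = layers m ++ layer m.+1.
  by rewrite {1}/layers -[m.+1]addn1 iotaD map_cat flatten_cat /= cats0 add1n addn1.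
move=> sz.
rewrite -[cs](cat_take_drop (size (layers m))) in sz *.
set c1 := take _ _ in sz *; set c2 := drop _ _ in sz *.
have s1 : size c1 = size (layers m).
  rewrite /c1 size_takel //; move: sz; rewrite cat_take_drop size_cat => ->; exact: leq_addr.
have s2 : size c2 = size (layer m.+1).
  by move/eqP: sz; rewrite !size_cat s1 eqn_add2l => /eqP.
have [h1 h2 h3] := IH c1 s1.
rewrite comb_cat //; set f := comb _ c1 _ in h1 h2 h3 *; rewrite all_cat.
rewrite /layer in s2 *; case: ifP s2 => [lek|nlek] s2; last first.
  have -> : c2 = [::] by apply: size0nil; rewrite s2.
  have -> : comb e' [::] ([::] : seq {poly R}) = 0 by rewrite /comb big_nil.
  rewrite addr0 /= andbT; split=> //; exact: leq_trans h1 _.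
rewrite size_map in s2; rewrite comb_layer; set g := comb e c2 _.
split.
- rewrite (leq_trans (size_polyD _ _)) // geq_max (leq_trans h1) //=.
  rewrite (leq_trans (size_polyMleq _ _)) // size_polyXn.
  have := size_polyC_leq1 g; lia.
- by rewrite coefD h2 add0r coefMXn.
move=> Jf.
have hg : J g.
  have := Jf m.+1; rewrite coefD [f`__]nth_default // add0r coefMXn ltnn subnn coefC eqxx //.
rewrite (ind _ _ s2 hg) andbT; apply: h3 => i.
have := Jf i; rewrite coefD coefMXn coefC; case: ltnP => [_|lemi _]; first by rewrite addr0.
rewrite nth_default; first exact: ideal_has0.
exact: leq_trans h1 lemi.
Qed.
End Layers.

(** For an active head G, a combination of basis elements is a polynomial in ['X] of size at most c,
    already in normal form: its constant term is treated in the ring over Z, its other coefficients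
    in the ring over G. *)
Lemma FY_basis_indep ls Z s k : admissible ls -> flat Z ->
  indep (tower_const ls) (@FY_ideal ls Z s) (FY_basis ls Z s k).
Proof.
elim: ls Z s k => [|G ls IH] Z s k.
  move=> _ _ cs /= sz h.
  have z x : @FY_ideal [::] Z s x -> x = 0 :> rat.
    by elim=> //= a y z [] //.
  move/z: h; case: eqP sz => _; case: cs => [//|c [|//]] //= _.
  by rewrite /comb big_seq1 /= mulr1 => ->.
move=> adm fZ cs; have [fG _ _ adm'] := adm; rewrite /FY_basis -/FY_basis.
set B1 := map _ _; set B2 := (if _ then _ else _) => sz.
rewrite -[cs](cat_take_drop (size B1)) in sz *.
set c1 := take _ _ in sz *; set c2 := drop _ _ in sz *.
have s1 : size c1 = size B1.
  rewrite /c1 size_takel //; move: sz; rewrite cat_take_drop size_cat => ->; exact: leq_addr.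
have s2 : size c2 = size B2.
  by move/eqP: sz; rewrite !size_cat s1 eqn_add2l => /eqP.
rewrite comb_cat // all_cat.
have -> : comb (tower_const (G :: ls)) c1 B1 = (comb (tower_const ls) c1 (FY_basis ls Z s k))%:P.
  rewrite -(comb_map (f := polyC) (e' := tower_const (G :: ls))) //.
  - exact: polyCD.
  - by move=> q x; rewrite polyCM.
rewrite size_map in s1.
rewrite /B2 in s2 *; case: ifP s2 => [lZG|nZG] s2; last first.
  have -> : c2 = [::] by apply: size0nil; rewrite s2.
  rewrite /comb big_nil addr0 -/(comb _ _ _) => /FY_normal_form_inactive h.
  rewrite andbT; apply: (IH Z s k adm' fZ _ s1).
  by move: h; rewrite coefC eqxx; apply => //; rewrite ?nZG // size_polyC_leq1.
have gt : (0 < rk G - rk Z)%N by rewrite subn_gt0; apply: below_rk.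
have := @comb_layers _ (@FY_ideal ls G 0) (tower_const ls) k (FY_basis ls G 0) (rk G - rk Z + s).-1 c2.
set f := comb _ c2 _ => /(_ (FY_is_ideal ls G 0) _ s2) [|h1 h2 h3].
  by move=> j; apply: IH.
move=> /FY_normal_form; rewrite prednK in h1; last by lia.
case=> //.
  rewrite (leq_trans (size_polyD _ _)) // geq_max h1 andbT.
  by rewrite (leq_trans (size_polyC_leq1 _)) //; lia.
rewrite coefD h2 addr0 coefC eqxx => hI hJ.
have a1 := IH Z s k adm' fZ _ s1 hI; rewrite a1 /=.
apply: h3 => -[|i]; first by rewrite h2; apply: ideal_has0; apply: FY_is_ideal.
by have := hJ i.+1; rewrite coefD coefC add0r.
Qed.

Lemma tower_homog_upsum ls A : tower_homog 1 (upsum ls A).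
Proof. by apply: tower_homog_sum => F _; apply: tower_homog_var. Qed.

Lemma FY_basis_spans ls Z s k : admissible ls -> flat Z ->
  forall f, tower_homog k f -> spans (tower_const ls) (@FY_ideal ls Z s) (FY_basis ls Z s k) f.
Proof.
elim: ls Z s k => [|G ls IH] Z s k adm fZ f.
  have idI := FY_is_ideal [::] Z s.
  case: k => [_|k /= /eqP ->].
    by exists [:: (f : rat)] => //; rewrite /comb big_seq1 /= mulr1 subrr; apply: (ideal_has0 idI).
  by exists [::] => //; rewrite /comb big_nil subr0; apply: (ideal_has0 idI).
have idK := FY_is_ideal (G :: ls) Z s; have [fG _ _ adm'] := adm => hf.
have sp0 (g : {poly tower ls}) : @FY_ideal (G :: ls) Z s g ->
    spans (tower_const (G :: ls)) (@FY_ideal (G :: ls) Z s) (FY_basis (G :: ls) Z s k) g.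
  exact: spans0.
have hconst (g : tower ls) : tower_homog k g ->
    spans (tower_const (G :: ls)) (@FY_ideal (G :: ls) Z s) (FY_basis (G :: ls) Z s k) g%:P.
  move=> /(IH Z s k adm' fZ g) [cs sz Kg]; apply: spans_catl.
  exists cs; first by rewrite size_map.
  rewrite (comb_map (f := polyC) (e := tower_const ls)) //.
  - by rewrite -polyCB; apply: FY_ideal_const.
  - exact: polyCD.
  - by move=> q x; rewrite polyCM.
suff hX i (g : tower ls) : (i <= k)%N -> tower_homog (k - i) g ->
    spans (tower_const (G :: ls)) (@FY_ideal (G :: ls) Z s) (FY_basis (G :: ls) Z s k) (g%:P * 'X^i).
  rewrite -[f](coefK f) poly_def.
  apply: (@spans_sum (tower (G :: ls)) (tower_const (G :: ls)) _ idK) => i _.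
  rewrite -mul_polyC; have := hf i; case: leqP => [lei|_ ->]; first exact: hX.
  by rewrite polyC0 mul0r; apply: sp0; apply: (ideal_has0 idK).
(* Exponent 0 is the ring without G, positive exponents below c are reduced modulo the relations
   above G, and higher ones are lowered by the monic relation. *)
elim/ltn_ind: i g => i IHi g lei hg.
case: i => [|i] in IHi lei hg *.
  by rewrite expr0 mulr1; apply: hconst; rewrite subn0 in hg.
have [lZG|nZG] := boolP (below Z G); last first.
  apply: sp0; rewrite exprS mulrCA.
  by apply: (ideal_mulr idK); apply: FY_ideal_X_inactive.
have gt : (0 < rk G - rk Z)%N by rewrite subn_gt0; apply: below_rk.
set c := (rk G - rk Z + s)%N.
have [ltic|leci] := ltnP i.+1 c.
  rewrite /FY_basis -/FY_basis lZG; apply: spans_catr.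
  apply: (spans_flatten (i := i.+1)); first by rewrite mem_iota; lia.
  rewrite lei; have [cs sz Kg] := IH G 0%N _ adm' fG g hg.
  exists cs; first by rewrite size_map.
  rewrite (comb_layer (tower_const ls)) -mulrBl -polyCB.
  by rewrite exprS mulrA; apply: (ideal_mulr idK); apply: FY_ideal_top.
(* Binomial expansion of the relation, solved for its leading power. *)
have -> : g%:P * 'X^(i.+1) =
  g%:P * 'X^(i.+1 - c) * ('X + (upsum ls G)%:P) ^+ c
   - \sum_(j < c) (g * (upsum ls G ^+ (c - j) *+ 'C(c, j)))%:P * 'X^(i.+1 - c + j).
  rewrite ['X + _]addrC exprDn big_ord_recr /= subnn expr0 mul1r binn mulr1n mulrDr.
  rewrite -[X in _ + X - _]mulrA -exprD subnK // addrAC [X in _ = X + _](_ : _ = 0) ?add0r //.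
  rewrite mulr_sumr -sumrB big1 // => j _; apply/eqP; rewrite subr_eq0; apply/eqP.
  rewrite polyCM polyCMn rmorphXn /= exprD -!mulrA; congr (_ * _).
  by rewrite mulrnAl mulrnAr mulrCA.
apply: (spansD idK).
  by apply: sp0; apply: (ideal_mull idK); apply: FY_ideal_relation.
rewrite -sumrN; apply: (@spans_sum (tower (G :: ls)) (tower_const (G :: ls)) _ idK) => j _; rewrite -mulNr -polyCN.
have lj : (j < c)%N by [].
apply: IHi; [lia|lia|].
apply: tower_homogN; have -> : (k - (i.+1 - c + j) = (k - i.+1) + (c - j))%N by lia.
apply: tower_homogM => //; rewrite -mulr_natr -(rmorph_nat (tower_const ls)).
have := tower_homogM (tower_homogX (c - j) (tower_homog_upsum ls G)) (tower_homog_const ls 'C(c, j)%:R).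
by rewrite mul1n addn0.
Qed.

Lemma FY_basis_homog ls Z s k b : b \in FY_basis ls Z s k -> tower_homog k b.
Proof.
elim: ls Z s k b => [|G ls IH] Z s k b.
  by rewrite /=; case: eqP => // _; rewrite inE => /eqP ->.
rewrite /FY_basis -/FY_basis mem_cat => /orP[/mapP[x xb ->]|].
  by apply: (@tower_homog_polyC _ G); apply: IH xb.
case: ifP => // _ /flattenP[r /mapP[i _ ->]]; case: leqP => // lei /mapP[x xb ->].
rewrite -[k](subnK lei); apply: (@tower_homogM _ (G :: ls)).
  by apply: (@tower_homog_polyC _ G); apply: IH xb.
by have := @tower_homogX _ (G :: ls) 1%N _ i (@tower_homog_top _ G ls); rewrite mul1n.
Qed.

(** No flat of the tail lies below the head, so the head contributes nothing to the series over a
    flat of the tail. The recursion thereby takes a form that depends on the set of flats and not on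
    their order. *)
Lemma FY_series_rec ls Z s : admissible ls ->
  FY_series ls Z s = 1 + \sum_(G <- ls | below Z G)
    (\sum_(1 <= i < rk G - rk Z + s) 'X^i) * FY_series ls G 0.
Proof.
elim: ls Z s => [|G ls IH] Z s adm; first by rewrite big_nil addr0.
have [_ /allP nle _ adm'] := adm.
rewrite big_cons /= /below eqxx andbF addr0 -/(below _ _) (IH Z s adm').
have -> : \sum_(j <- ls | below Z j) (\sum_(1 <= i < rk j - rk Z + s) 'X^i) *
    (FY_series ls j 0 + (if below j G then (\sum_(1 <= i < rk G - rk j + 0) 'X^i) * FY_series ls G 0 else 0)) =
  \sum_(j <- ls | below Z j) (\sum_(1 <= i < rk j - rk Z + s) 'X^i) * FY_series ls j 0.
  rewrite big_seq_cond [RHS]big_seq_cond; apply: eq_bigr => j /andP[jls _].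
  by rewrite /below (negbTE (nle _ jls)) /= addr0.
by case: ifP => _; rewrite ?addr0 // -addrA; congr (_ + _); rewrite addrC.
Qed.

End FY.

(** * Hilbert functions of presented graded rings *)

Section Graded.
Variable n : nat.
Implicit Types (p : {mpoly rat[n]}) (gens ps : seq {mpoly rat[n]}).

Lemma is_homogE k p : is_homog k p = (p \is [in rat[n], k.-homog for [measure of mdeg]]).
Proof. by rewrite dhomogE. Qed.

Lemma in_ideal_is_ideal gens : is_ideal (in_ideal gens).
Proof.
split.
- exists (nseq (size gens) 0); rewrite size_nseq; split=> //.
  by rewrite big1 // => i _; rewrite nth_nseq ltn_ord mul0r.
- move=> p q [cs [sc ->]] [ds [sd ->]].
  exists [seq x.1 + x.2 | x <- zip cs ds]; rewrite size_map size1_zip ?sc ?sd //; split=> //.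
  rewrite -big_split; apply: eq_bigr => i _ /=.
  rewrite (nth_map (0, 0)) ?size1_zip ?sc ?sd // nth_zip ?sc ?sd //=.
  by rewrite mulrDl.
- move=> a p [cs [sc ->]]; exists [seq a * x | x <- cs]; rewrite size_map; split=> //.
  by rewrite mulr_sumr; apply: eq_bigr => i _; rewrite (nth_map 0) ?sc // mulrA.
Qed.

Lemma in_ideal_gen gens p : p \in gens -> in_ideal gens p.
Proof.
move=> /[dup] pg /(nthP 0)[i li <-]; exists [seq (j == i)%:R | j <- iota 0 (size gens)].
rewrite size_map size_iota; split=> //.
rewrite (bigD1 (Ordinal li)) //= big1 => [|j nj].
  by rewrite (nth_map 0%N) ?size_iota // nth_iota // eqxx mul1r addr0.
rewrite (nth_map 0%N) ?size_iota // nth_iota // add0n.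
by move: nj; rewrite -val_eqE /= => /negbTE ->; rewrite mul0r.
Qed.

Lemma in_ideal_min gens I : is_ideal I -> (forall p, p \in gens -> I p) ->
  forall p, in_ideal gens p -> I p.
Proof.
move=> idI gI p [cs [_ ->]]; apply: (ideal_sum idI) => i _.
by apply: (ideal_mull idI); apply: gI; apply: mem_nth.
Qed.

Lemma lincomb_comb c ps : size c = size ps -> lincomb c ps = comb (@mpolyC n rat) c ps.
Proof.
rewrite /lincomb /comb => sz; rewrite (big_nth (0, 0)) size2_zip ?sz //.
rewrite big_mkord; apply: eq_bigr => i _.
by rewrite nth_zip //= mul_mpolyC.
Qed.

Lemma lincombE d (c : seq rat) ps : size ps = d -> lincomb c ps = \sum_(i < d) c`_i *: ps`_i.
Proof. by move=> <-. Qed.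

(** If there were more than [d'] independent elements, the matrix expressing them through the [d']
    spanning ones modulo the ideal would have a nonzero left kernel, that is a linear relation among
    them. This pins down the value picked by [epsilon]. *)
Lemma graded_basis_size_le gens k d d' :
  graded_basis_size gens k d -> graded_basis_size gens k d' -> (d <= d')%N.
Proof.
have idI := in_ideal_is_ideal gens.
move=> [ps [sz hom ind _]] [ps' [sz' _ _ span]].
have /(_ _)/cid hC (i : 'I_d) : exists c : seq rat, in_ideal gens (ps`_i - lincomb c ps').
  have /span[c [_ h]] : is_homog k ps`_i by apply: (all_nthP 0 hom); rewrite sz.
  by exists c.
pose C : 'M[rat]_(d, d') := \matrix_(i, j) (projT1 (hC i))`_j.
rewrite leqNgt; apply/negP => lt.
have : kermx C != 0.
  rewrite -mxrank_eq0 mxrank_ker subn_eq0 -ltnNge; exact: leq_ltn_trans (rank_leq_col _) lt.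
case/rowV0Pn => x /sub_kermxP xC /eqP; apply.
apply/rowP => i; rewrite mxE.
have := ind [seq x 0 j | j <- enum 'I_d]; rewrite size_map size_enum_ord => /(_ erefl) h.
have nx (j : 'I_d) : [seq x 0 j | j <- enum 'I_d]`_j = x 0 j.
  by rewrite (nth_map j) ?size_enum_ord // nth_ord_enum.
rewrite -nx; apply: h => //; rewrite (lincombE _ sz).
have -> : \sum_(i0 < d) [seq x 0 j | j <- enum 'I_d]`_i0 *: ps`_i0 =
   \sum_(i0 < d) (x 0 i0)%:MP * (ps`_i0 - lincomb (projT1 (hC i0)) ps').
  under [RHS]eq_bigr do rewrite mulrBr (lincombE _ sz').
  rewrite sumrB [X in _ - X](_ : _ = 0); last first.
    under eq_bigr do rewrite mulr_sumr.
    rewrite exchange_big big1 //= => j _.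
    have : (x *m C) 0 j = 0 by rewrite xC mxE.
    rewrite mxE => e; rewrite -[RHS](scale0r ps'`_j) -[X in _ = X *: _]e scaler_suml.
    by apply: eq_bigr => i0 _; rewrite mul_mpolyC scalerA [C _ _]mxE.
  by rewrite subr0; apply: eq_bigr => j _; rewrite nx mul_mpolyC //.
apply: (ideal_sum idI) => j _; apply: (ideal_mull idI); exact: (projT2 (hC j)).
Qed.

Lemma hilb_coefE gens k d : graded_basis_size gens k d -> hilb_coef gens k = d.
Proof.
move=> h; have h' : graded_basis_size gens k (hilb_coef gens k).
  by apply: ClassicalEpsilon.epsilon_spec; exists d.
by apply/eqP; rewrite eqn_leq !(graded_basis_size_le (gens := gens) (k := k)).
Qed.

Lemma hilb_seriesE gens (h : {poly int}) (d : nat -> nat) :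
  (forall k, graded_basis_size gens k (d k)) -> (forall k, (d k)%:Z = h`_k) ->
  hilb_series gens = h.
Proof.
move=> hd hk; apply/polyP => k; rewrite -hk -(hilb_coefE (hd k)).
apply: (ClassicalEpsilon.epsilon_spec (inhabits (0 : {poly int}))
   (fun h : {poly int} => forall k, h`_k = (hilb_coef gens k)%:Z)).
by exists h => j; rewrite -hk (hilb_coefE (hd j)).
Qed.

Lemma mpoly_gen_ind (P : {mpoly rat[n]} -> Prop) :
  (forall c, P c%:MP) -> (forall i, P 'X_i) ->
  (forall p q, P p -> P q -> P (p + q)) -> (forall p q, P p -> P q -> P (p * q)) ->
  forall p, P p.
Proof.
move=> PC PX PD PM p.
have P1 : P 1 by rewrite -mpolyC1.
rewrite [p]mpolyE; elim/big_ind: _ => //; first by rewrite -mpolyC0.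
move=> m _; rewrite -mul_mpolyC; apply: (PM) => //.
rewrite mpolyXE_id; elim/big_ind: _ => [//|x y Px Py|i _]; first exact: PM.
by elim: (m i) => [|j IH]; rewrite ?expr0 // exprS; apply: PM.
Qed.

End Graded.

(** * Graded isomorphisms given by substitutions of degree one *)

Section Transfer.
Variables (n : nat) (gens : seq {mpoly rat[n]}).
Variables (L : eqType) (X : ranked_lattice L) (ls : seq L) (Z : L) (s : nat).
Hypotheses (adm : admissible X ls) (fZ : flat X Z).
Variables (u : 'I_n -> tower ls) (v : L -> {mpoly rat[n]}).
Hypotheses (hu : forall i, tower_homog 1 (u i))
  (hv : forall F, F \in ls -> is_homog 1 (v F)).

Let phi : {rmorphism {mpoly rat[n]} -> tower ls} := mmap (tower_const ls) u.
Let psi : {rmorphism tower ls -> {mpoly rat[n]}} := tower_eval (@mpolyC n rat) v ls.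
Let K := @FY_ideal L X ls Z s.

Hypotheses (gensK : forall g, g \in gens -> K (phi g))
  (Kgens : forall x, FY_gen X Z s x -> in_ideal gens (psi x))
  (psi_u : forall i, in_ideal gens (psi (u i) - 'X_i))
  (phi_v : forall F, F \in ls -> K (phi (v F) - tower_var ls F)).

Let idK : is_ideal K := FY_is_ideal X ls Z s.
Let idI : is_ideal (in_ideal gens) := in_ideal_is_ideal gens.

Lemma transfer_phi p : in_ideal gens p -> K (phi p).
Proof. by apply: (in_ideal_min (ideal_preim phi idK)). Qed.

Lemma transfer_psi x : K x -> in_ideal gens (psi x).
Proof. by apply: (ideal_min (ideal_preim psi idI)). Qed.

Let phiC c : phi c%:MP = tower_const ls c.
Proof. by rewrite /phi /= mmapC. Qed.

Let phiX i : phi 'X_i = u i.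
Proof. by rewrite /phi /= mmapX mmap1U. Qed.

Lemma transfer_psi_phi p : in_ideal gens (psi (phi p) - p).
Proof.
elim/mpoly_gen_ind: p => [c|i|p q hp hq|p q hp hq].
- by rewrite phiC /psi tower_eval_const subrr; apply: ideal_has0.
- by rewrite phiX.
- rewrite !rmorphD opprD addrACA; exact: (ideal_add idI).
- rewrite !rmorphM /=; have -> : psi (phi p) * psi (phi q) - p * q =
    psi (phi q) * (psi (phi p) - p) + p * (psi (phi q) - q) by ring.
  by apply: (ideal_add idI); apply: (ideal_mull idI).
Qed.

Lemma transfer_phi_psi x : K (phi (psi x) - x).
Proof.
apply: (@tower_const_var_ind _ ls (fun x => K (phi (psi x) - x))) (admissible_uniq adm) x
  => [q|F Fls|x y hx hy|x y hx hy].
- by rewrite /psi tower_eval_const phiC subrr; apply: ideal_has0.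
- by rewrite /psi tower_eval_var //; apply: phi_v.
- rewrite !rmorphD opprD addrACA; exact: (ideal_add idK).
- rewrite !rmorphM /=; have -> : phi (psi x) * phi (psi y) - x * y =
    phi (psi y) * (phi (psi x) - x) + x * (phi (psi y) - y) by ring.
  by apply: (ideal_add idK); apply: (ideal_mull idK).
Qed.

Lemma tower_homog_phi k p : is_homog k p -> tower_homog k (phi p).
Proof.
move=> /allP hp; rewrite /phi /= /mmap big_seq; apply: tower_homog_sum => m /hp /eqP <-.
rewrite -[mdeg m]add0n; apply: tower_homogM; first exact: tower_homog_const.
rewrite mdegE /mmap1; elim/big_ind2: _ => [|a x b y|i _]; first exact: tower_homog1.
  exact: tower_homogM.
by have := tower_homogX (m i) (hu i); rewrite mul1n.
Qed.
End Transfer.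

Lemma tower_eval_homog n (L : eqType) (v : L -> {mpoly rat[n]}) (ls : seq L) :
  uniq ls -> (forall F, F \in ls -> is_homog 1 (v F)) ->
  forall k (x : tower ls), tower_homog k x -> is_homog k (tower_eval (@mpolyC n rat) v ls x).
Proof.
elim: ls => [|G ls IH] /=.
  move=> _ _ k x; rewrite is_homogE; case: eqP => [-> _|_ /= /eqP ->].
    by rewrite -[x%:MP]mulr1 mul_mpolyC; apply: dhomogZ; apply: dhomog1.
  by rewrite rmorph0; apply: dhomog0.
move=> /andP[_ uls] hv k x hx; rewrite is_homogE /horner_morph horner_coef.
apply: rpred_sum => i _; rewrite coef_map /=; have := hx i; case: leqP => [lei h|_ ->].
  rewrite -[k](subnK lei); apply: dhomogM.
    by rewrite -is_homogE; apply: IH => // F Fls; apply: hv; rewrite inE Fls orbT.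
  have : v G \is [in rat[n], 1.-homog for [measure of mdeg]].
    by rewrite -is_homogE; apply: hv; rewrite mem_head.
  by move/dhomogMn => /(_ i); rewrite mul1n.
by rewrite rmorph0 mul0r; apply: dhomog0.
Qed.

(** [u] and [v] induce mutually inverse graded maps between the two quotients, so [psi] carries the
    basis to a basis: [phi] takes a relation back to the tower, and [psi (phi p)] is congruent to
    [p]. *)
Theorem hilb_series_FY n (gens : seq {mpoly rat[n]}) (L : eqType) (X : ranked_lattice L)
  (ls : seq L) (Z : L) (s : nat) (u : 'I_n -> tower ls) (v : L -> {mpoly rat[n]}) :
  admissible X ls -> flat X Z ->
  (forall i, tower_homog 1 (u i)) -> (forall F, F \in ls -> is_homog 1 (v F)) ->
  (forall g, g \in gens -> FY_ideal X Z s (mmap (tower_const ls) u g)) ->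
  (forall x, FY_gen X Z s x -> in_ideal gens (tower_eval (@mpolyC n rat) v ls x)) ->
  (forall i, in_ideal gens (tower_eval (@mpolyC n rat) v ls (u i) - 'X_i)) ->
  (forall F, F \in ls -> FY_ideal X Z s (mmap (tower_const ls) u (v F) - tower_var ls F)) ->
  hilb_series gens = FY_series X ls Z s.
Proof.
move=> adm fZ hu hv gK Kg pu pv.
have idK := FY_is_ideal X ls Z s; have idI := in_ideal_is_ideal gens.
apply: (hilb_seriesE (d := fun k => size (FY_basis X ls Z s k))) => k; last exact: size_FY_basis.
pose psi : {rmorphism tower ls -> {mpoly rat[n]}} := tower_eval (@mpolyC n rat) v ls.
pose phi : {rmorphism {mpoly rat[n]} -> tower ls} := mmap (tower_const ls) u.
have psiI := transfer_psi Kg; have phiK := transfer_phi gK.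
set bs := FY_basis X ls Z s k.
have combE cs : size cs = size bs ->
    lincomb cs (map psi bs) = psi (comb (tower_const ls) cs bs).
  move=> sz; rewrite lincomb_comb ?size_map // (comb_map (f := psi) (e := tower_const ls)) //.
  - exact: rmorph0.
  - exact: rmorphD.
  - by move=> q x; rewrite rmorphM; congr (_ * _); exact: tower_eval_const.
exists (map psi bs); split.
- by rewrite size_map.
- apply/allP => p /mapP[b bb ->]; apply: tower_eval_homog hv _ _ (FY_basis_homog bb).
  exact: admissible_uniq adm.
- move=> c sz; rewrite combE // => /phiK h i li.
  have hK : FY_ideal X Z s (comb (tower_const ls) c bs).
    by move/(ideal_eqmod idK (transfer_phi_psi adm pv _)): h.
  have /allP/(_ c`_i) := FY_basis_indep adm fZ sz hK.
  by rewrite mem_nth ?sz // => /(_ isT) /eqP.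
- move=> p /(tower_homog_phi hu)/(FY_basis_spans s adm fZ)[cs sz h].
  exists cs; split=> //; rewrite combE //.
  have := psiI _ h; rewrite rmorphB => h2.
  have h3 := transfer_psi_phi pu p.
  have -> : p - psi (comb (tower_const ls) cs bs) =
    (psi (phi p) - psi (comb (tower_const ls) cs bs)) - (psi (phi p) - p) by ring.
  exact: (ideal_sub idI).
Qed.

(** * Rank function and lattice of flats *)

Section MatroidRank.
Variables (M : matroid) (hM : is_matroid M).
Implicit Types (A B F G H T : {fset nat}).
Local Notation E := (ground M).
Local Notation r := (mrank M).

Let bases_sub B : B \in bases M -> B `<=` E. Proof. by case: hM => _ _ h _; apply: h. Qed.

Let exchange B1 B2 a : B1 \in bases M -> B2 \in bases M -> a \in B1 `\` B2 ->
  exists2 b, b \in B2 `\` B1 & (B1 `\ a) `|` [fset b] \in bases M.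
Proof. by case: hM => _ _ _ h h1 h2; apply: h. Qed.

Lemma mrank_ge A B : B \in bases M -> (#|` A `&` B| <= r A)%N.
Proof. by move=> Bb; rewrite /mrank; exact: (leq_bigmax_seq (P := xpredT) (F := fun B => #|` A `&` B|) B Bb). Qed.

Lemma mrank_attained A : exists2 B, B \in bases M & r A = #|` A `&` B|.
Proof.
have [B0 B0b] : exists B, B \in bases M by case: hM => _ /fset0Pn.
pose B1 := [arg max_(i > [` B0b]) #|` A `&` val i|]%N.
exists (val B1); first exact: valP.
rewrite /B1; case: arg_maxnP => //= i _ hi.
apply/eqP; rewrite eqn_leq mrank_ge ?(valP i) // andbT.
by apply/bigmax_leqP_seq => B Bb _; apply: (hi [` Bb]).
Qed.

Lemma mrank_mono A A' : A `<=` A' -> (r A <= r A')%N.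
Proof.
move=> sA; have [B Bb ->] := mrank_attained A.
by apply: leq_trans (mrank_ge A' Bb); apply: fsubset_leq_card; apply: fsetSI.
Qed.

Section Weight.
Variable w : nat -> nat.
Definition weight B := (\sum_(e <- B) w e)%N.

Lemma weight_exchange B a b : a \in B -> b \notin B ->
  (weight ((B `\ a) `|` [fset b]) + w a = weight B + w b)%N.
Proof.
move=> aB bB; rewrite /weight (big_fsetD1 a aB) /= fsetUC big_fsetU1 /=; first lia.
by rewrite !inE (negbTE bB) andbF.
Qed.

(* Exchanging a lightest element of [B' \ B] towards [B] never decreases the weight. *)
Lemma weight_local_max B : B \in bases M ->
  (forall a b, a \in B -> b \notin B -> (B `\ a) `|` [fset b] \in bases M -> (w b <= w a)%N) ->
  forall B', B' \in bases M -> (weight B' <= weight B)%N.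
Proof.
move=> Bb loc B'; have [m] := ubnP #|` B' `\` B|; elim: m B' => // m IH B' lm B'b.
have [/eqP e0|/fset0Pn[a0 a0in]] := boolP (B' `\` B == fset0).
  have [/eqP e1|/fset0Pn[b bin]] := boolP (B `\` B' == fset0).
    have -> // : B' = B.
    by apply/eqP; rewrite eqEfsubset -!fsetD_eq0 e0 e1 eqxx.
  by have [c] := exchange Bb B'b bin; rewrite e0 inE.
have [a ain amin] : exists2 a, a \in B' `\` B & forall a', a' \in B' `\` B -> (w a <= w a')%N.
  pose a1 := [arg min_(i < [` a0in]) w (val i)]%N.
  exists (val a1); first exact: valP.
  by rewrite /a1; case: arg_minnP => //= i _ hi a' ha'; apply: (hi [` ha']).
have [b bin Bb2] := exchange B'b Bb ain.
have [aB' aB] : a \in B' /\ a \notin B by move: ain; rewrite !inE => /andP[].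
have [bB bB'] : b \in B /\ b \notin B' by move: bin; rewrite !inE => /andP[].
(* Exchanging [b] out of [B] brings in some [a'] of B' outside B: local maximality bounds its weight
   by that of [b], and [a] is lightest. *)
have lab : (w a <= w b)%N.
  have [a' a'in Bb3] := exchange Bb B'b bin.
  apply: leq_trans (amin _ a'in) _; apply: loc => //.
  by move: a'in; rewrite !inE => /andP[].
have := weight_exchange aB' bB'; suff : (weight ((B' `\ a) `|` [fset b]) <= weight B)%N by lia.
apply: IH => //; rewrite -ltnS (leq_trans _ lm) // ltnS; apply: fproper_ltn_card.
rewrite fproperEneq; apply/andP; split.
  apply/negP => /eqP/fsetP/(_ a); rewrite ain !inE eqxx /= (negbTE aB) /=.
  by case: eqP bB' => // <-; rewrite aB'.
apply/fsubsetP => x; rewrite !inE => /andP[nx] /orP[/andP[_ ->]|/eqP ex]; first by rewrite nx.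
by rewrite ex bB in nx.
Qed.

Lemma weight_max_exists : exists2 B, B \in bases M & forall B', B' \in bases M -> (weight B' <= weight B)%N.
Proof.
have [B0 B0b] : exists B, B \in bases M by case: hM => _ /fset0Pn.
pose B1 := [arg max_(i > [` B0b]) weight (val i)]%N.
exists (val B1); first exact: valP.
by rewrite /B1; case: arg_maxnP => //= i _ hi B' hB'; apply: (hi [` hB']).
Qed.
End Weight.

Lemma card_weight A B : #|` A `&` B| = weight (fun e => (e \in A : nat)) B.
Proof.
rewrite card_fset_sum1 /weight.
have -> : A `&` B = [fset e in B | e \in A] by apply/fsetP => e; rewrite !inE andbC.
by rewrite big_fset big_mkcond; apply: eq_bigr => e _; case: (e \in A).
Qed.

(** The case of 0-1 weights in [weight_local_max]: optimality for a single set can be tested on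
    single exchanges. *)
Lemma mrank_exchange_opt A B : B \in bases M ->
  (forall a b, a \in B -> b \notin B -> (B `\ a) `|` [fset b] \in bases M ->
     b \in A -> a \in A) -> #|` A `&` B| = r A.
Proof.
move=> Bb loc; apply/eqP; rewrite eqn_leq mrank_ge //=.
have [B' B'b ->] := mrank_attained A; rewrite !card_weight.
apply: weight_local_max => // a b aB bB Bex; have := loc a b aB bB Bex.
by case: (b \in A) => //= -> //.
Qed.

Definition fchain (As : seq {fset nat}) : Prop :=
  forall A A', A \in As -> A' \in As -> A `<=` A' \/ A' `<=` A.

Lemma fchain2 A A' : A `<=` A' -> fchain [:: A; A'].
Proof.
move=> s C D; rewrite !inE => /orP[]/eqP-> /orP[]/eqP->; rewrite ?fsubset_refl ?s; by [left|right].
Qed.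

(* A basis of maximal weight for the sum of the indicators of the chain: by
   [weight_local_max] it is also optimal for each of the indicators. *)
Lemma mrank_chain_basis As : fchain As ->
  exists2 B, B \in bases M & forall A, A \in As -> #|` A `&` B| = r A.
Proof.
move=> ch; pose w e := count (fun A : {fset nat} => e \in A) As.
have [B Bb Bmax] := weight_max_exists w; exists B => // A AAs.
apply: mrank_exchange_opt => // a b aB bB Bex bA.
have := Bmax _ Bex; have := weight_exchange w aB bB.
(* A member of the chain containing [a] is not inside [A], hence contains [A] and with it [b]; as
   [A] itself counts only for [b], the exchange would raise the weight. *)
suff : a \notin A -> (w a < w b)%N by case: (a \in A) => // /(_ isT); lia.
move=> aA; rewrite /w.
have sub : subpred (fun A' : {fset nat} => (a \in A') && (A' \in As)) (fun A' => b \in A').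
  move=> A' /andP[aA' A'As]; have [/fsubsetP s|/fsubsetP s] := ch A A' AAs A'As; first exact: s.
  by rewrite (s _ aA') in aA.
have eqr := perm_to_rem AAs.
rewrite (permP eqr) [X in (_ < X)%N](permP eqr) /= bA (negbTE aA) add0n add1n ltnS.
rewrite (@eq_in_count _ _ (fun A' : {fset nat} => (a \in A') && (A' \in As))); last first.
  by move=> A' /mem_rem /= ->; rewrite andbT.
exact: sub_count.
Qed.

(** One basis attains the ranks of both the intersection and the union. For it the counts satisfy
    the modular equality, and those for [A] and [B] are at most the ranks. *)
Lemma mrank_submod A B : (r (A `|` B) + r (A `&` B) <= r A + r B)%N.
Proof.
have [|X Xb hX] := @mrank_chain_basis [:: A `&` B; A `|` B].
  by apply: fchain2; apply: fsubset_trans (fsubsetIl _ _) (fsubsetUl _ _).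
have h1 := mrank_ge A Xb; have h2 := mrank_ge B Xb.
rewrite -(hX (A `|` B)) ?inE ?eqxx ?orbT // -(hX (A `&` B)) ?inE ?eqxx //.
have := cardfsUI (A `&` X) (B `&` X).
rewrite -fsetIUl; have -> : (A `&` X) `&` (B `&` X) = (A `&` B) `&` X.
  by rewrite fsetIACA fsetIid.
lia.
Qed.

Lemma mrank0 : r fset0 = 0%N.
Proof. by have [B _ ->] := mrank_attained fset0; rewrite fset0I cardfs0. Qed.

Definition mclosure A := [fset e in E | r (A `|` [fset e]) == r A].

Lemma sub_closure A : A `<=` E -> A `<=` mclosure A.
Proof.
move=> /fsubsetP AE; apply/fsubsetP => e eA; rewrite !inE AE //=.
by have /fsetUidPl -> : [fset e] `<=` A by rewrite fsub1set.
Qed.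

(** On a basis attaining both ranks, a larger rank of the closure would exhibit an element e of it
    outside [A] with r (A + e) > r A. *)
Lemma mrank_closure A : A `<=` E -> r (mclosure A) = r A.
Proof.
move=> AE; have sA := sub_closure AE.
have [|B Bb hB] := @mrank_chain_basis [:: A; mclosure A].
  exact: fchain2.
apply/eqP; rewrite eqn_leq (mrank_mono sA) andbT leqNgt; apply/negP.
rewrite -!hB ?inE ?eqxx ?orbT // => lt.
have : ~~ (mclosure A `&` B `<=` A `&` B) by apply/negP => /fsubset_leq_card; rewrite leqNgt lt.
case/fsubsetPn => e; rewrite [e \in mclosure A `&` B]in_fsetI => /andP[eC eB].
rewrite in_fsetI eB andbT => eA.
move: eC; rewrite !inE => /andP[_ /eqP re].
have := mrank_ge (A `|` [fset e]) Bb; rewrite re -(hB A) ?inE ?eqxx //.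
rewrite leqNgt => /negP; apply; apply: fproper_ltn_card.
rewrite fproperE; apply/andP; split; first by apply: fsetSI; apply: fsubsetUl.
by apply/fsubsetPn; exists e; rewrite !inE ?eqxx ?orbT ?eB // (negbTE eA).
Qed.

Lemma is_flatP F : reflect (F `<=` E /\ forall e, e \in E -> e \notin F -> (r F < r (F `|` [fset e]))%N)
  (is_flat M F).
Proof.
apply: (iffP andP) => [[FE /allP h]|[FE h]]; split=> //.
  by move=> e eE eF; apply: h; rewrite !inE eF.
by apply/allP => e; rewrite !inE => /andP[eF eE]; apply: h.
Qed.

Lemma flat_closure A : A `<=` E -> is_flat M (mclosure A).
Proof.
move=> AE; apply/is_flatP; split; first by apply/fsubsetP => e; rewrite !inE => /andP[].
move=> e eE eC; rewrite mrank_closure //.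
have : (r A < r (A `|` [fset e]))%N.
  rewrite ltn_neqAle mrank_mono ?fsubsetUl // andbT eq_sym.
  by apply: contra eC; rewrite !inE eE.
move=> /leq_trans; apply; apply: mrank_mono; apply: fsetSU; exact: sub_closure.
Qed.

(** Submodularity for [H] and A + e: an e that does not raise the rank of [A] does not raise that of
    [H] either. *)
Lemma closure_least A H : A `<=` E -> is_flat M H -> A `<=` H -> mclosure A `<=` H.
Proof.
move=> AE /is_flatP[HE fH] AH; apply/fsubsetP => e; rewrite !inE => /andP[eE /eqP re].
apply: contraT => eH; have := fH e eE eH; rewrite ltnNge => /negP[].
have := mrank_submod H (A `|` [fset e]); rewrite re fsetUA.
have /fsetUidPl -> := AH.
have : (r A <= r (H `&` (A `|` [fset e])))%N.
  by apply: mrank_mono; rewrite fsubsetI AH fsubsetUl.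
lia.
Qed.

Lemma flat_rank_lt F G : is_flat M F -> is_flat M G -> F `<=` G -> F != G -> (r F < r G)%N.
Proof.
move=> /is_flatP[_ fF] /is_flatP[GE _] FG nFG.
have : F `<` G by rewrite fproperEneq nFG.
rewrite fproperE FG => /fsubsetPn[e eG eF]; apply: leq_trans (fF e _ eF) _; first exact: (fsubsetP GE).
by apply: mrank_mono; rewrite fsubUset FG fsub1set.
Qed.

Lemma flat_sub F : is_flat M F -> F `<=` E. Proof. by case/andP. Qed.

Lemma flat_joins F G : is_flat M F -> is_flat M G -> F `|` G `<=` E.
Proof. by move=> /flat_sub ? /flat_sub ?; rewrite fsubUset; apply/andP. Qed.

Definition flat_lattice : ranked_lattice {fset nat}.
Proof.
refine (@RankedLattice _ (is_flat M) (fun F G => F `<=` G) (fun F G => mclosure (F `|` G)) r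
  _ _ _ _ _ _ _ _ _).
- exact: fsubset_refl.
- by move=> F G; rewrite -eqEfsubset => /eqP.
- by move=> F G H; apply: fsubset_trans.
- by move=> F G fF fG; apply: flat_closure; apply: flat_joins.
- by move=> F G fF fG; apply: fsubset_trans (fsubsetUl _ G) (sub_closure (flat_joins fF fG)).
- by move=> F G fF fG; apply: fsubset_trans (fsubsetUr F _) (sub_closure (flat_joins fF fG)).
- move=> F G H fF fG fH FH GH; apply: closure_least => //; first exact: flat_joins.
  by rewrite fsubUset FH.
- exact: flat_rank_lt.
- move=> Z F G fZ fF fG ZF ZG; rewrite mrank_closure ?flat_joins //.
  apply: leq_trans (mrank_submod F G); rewrite leq_add2l; apply: mrank_mono.
  by rewrite fsubsetI ZF.
Defined.

(** Ordering by cardinality is a linear extension of inclusion, as [admissible] demands. *)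
Definition sorted_flats : seq {fset nat} :=
  sort (fun F G => #|` F| <= #|` G|)%N (enum_fset (flats M)).

Lemma mem_flats F : (F \in flats M) = is_flat M F.
Proof.
rewrite /flats !inE fpowersetE; case fF: (is_flat M F); rewrite ?andbF // andbT.
exact: flat_sub.
Qed.

Lemma mem_sorted_flats F : (F \in sorted_flats) = is_flat M F.
Proof. by rewrite mem_sort mem_flats. Qed.

Lemma sorted_flats_uniq : uniq sorted_flats.
Proof. by rewrite sort_uniq; apply: fset_uniq. Qed.

Lemma sorted_flats_admissible : admissible flat_lattice sorted_flats.
Proof.
have tr : transitive (fun F G : {fset nat} => #|` F| <= #|` G|)%N by move=> ? ? ?; apply: leq_trans.
have : sorted (fun F G : {fset nat} => #|` F| <= #|` G|)%N sorted_flats.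
  by apply: sort_sorted => F G; apply: leq_total.
rewrite sorted_pairwise // => srt.
have : forall s1 s2, sorted_flats = s1 ++ s2 -> admissible flat_lattice s2; last by move/(_ [::] sorted_flats erefl).
move=> s1 s2; elim: s2 s1 => //= G s2 IH s1 es.
have un := sorted_flats_uniq.
split.
- by rewrite -mem_sorted_flats es mem_cat mem_head orbT.
- apply/allP => F Fs2; apply/negP => FG.
  move: srt un; rewrite es pairwise_cat cat_uniq /= => /and3P[_ _ /andP[/allP/(_ _ Fs2) lGF _]].
  case/and3P => _ _ /andP[Gs2 _].
  have eFG : F = G by apply/eqP; rewrite eqEfcard FG lGF.
  by rewrite -eFG Fs2 in Gs2.
- move=> H fH /andP[GH nGH]; have : H \in sorted_flats by rewrite mem_sorted_flats.
  rewrite es mem_cat inE [H == G]eq_sym (negbTE nGH) /= => /orP[Hs1|//].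
  move: srt; rewrite es pairwise_cat => /and3P[/allrelP/(_ H G Hs1)].
  rewrite mem_head => /(_ isT) lHG _ _.
  by move: nGH; rewrite eqEfcard lHG andbT => /negP[]; exact: GH.
- by apply: (IH (rcons s1 G)); rewrite cat_rcons.
Qed.

End MatroidRank.

(** * The two Chow rings *)

Section ChowRelations.
Variables (M : matroid) (hM : is_matroid M).
Variables (R : comNzRingType) (I : R -> Prop) (idI : is_ideal I) (w : {fset nat} -> R).
Implicit Types (A F G H J : {fset nat}).
Local Notation E := (ground M).
Local Notation r := (mrank M).
Local Notation ls := (sorted_flats M).
Local Notation X := (flat_lattice hM).
Local Notation cl := (mclosure M).

Definition upper A : R := \sum_(H <- ls | A `<=` H) w H.
Definition star i : R := \sum_(H <- ls | i \in H) w H.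

Hypotheses (w_incomp : forall G H, G \in ls -> H \in ls -> ~~ (G `<=` H) -> ~~ (H `<=` G) ->
   I (w G * w H)).

Let flE F : (F \in ls) = is_flat M F. Proof. exact: mem_sorted_flats. Qed.

Let w_join F A : is_flat M F -> is_flat M A -> ~~ (A `<=` F) ->
  I (w F * upper A - w F * upper (cl (F `|` A))).
Proof.
move=> fF fA nAF.
have := @incomparable_join _ X R I w ls F A idI w_incomp (sorted_flats_admissible hM).
by rewrite flE; apply.
Qed.

(** A flat contains [i] exactly when it contains the closure of [i], so the linear forms of the
    presentations are themselves upper sums. *)
Lemma star_closure i : i \in E -> star i = upper (cl [fset i]).
Proof.
move=> iE; rewrite /star /upper big_seq_cond [RHS]big_seq_cond; apply: eq_bigl => H.
rewrite flE; case fH: (is_flat M H) => //=.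
have iE' : [fset i] `<=` E by rewrite fsub1set.
apply/idP/idP => [iH|/fsubsetP]; first by apply: closure_least; rewrite ?fsub1set.
by apply; rewrite (fsubsetP (sub_closure iE')) // inE.
Qed.

Lemma closure1_rank_le F i : is_flat M F -> i \in E ->
  (r (cl (F `|` cl [fset i])) <= (r F).+1)%N.
Proof.
move=> fF iE; have iE' : [fset i] `<=` E by rewrite fsub1set.
rewrite (mrank_closure hM) ?(flat_joins fF) ?flat_closure //.
apply: leq_trans (leq_trans (leq_addr _ _) (mrank_submod hM F _)) _.
rewrite (mrank_closure hM) // -addn1 leq_add2l.
have [B _ ->] := mrank_attained hM [fset i].
by rewrite (leq_trans (fsubset_leq_card (fsubsetIl _ _))) // cardfs1.
Qed.

Hypothesis w_star : forall F i, is_flat M F -> i \in E -> i \notin F -> I (w F * star i).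

(* Writing [F'] for the closure of [F + i] with [i \in J \ F], the hypothesis gives
   [w F * upper F' = 0], so that in [w F * upper J ^ c] one factor [upper J] may be
   replaced by the sum of the [w H] with [F' <= H] and [J </= H]. *)
Lemma upper_vanish c F A : is_flat M F -> is_flat M A -> ~~ (A `<=` F) ->
  (r (cl (F `|` A)) <= r F + c)%N -> I (w F * upper A ^+ c).
Proof.
elim: c F A => [|c IH] F A fF fA nAF.
  rewrite addn0 leqNgt => /negP[]; apply: (rk_lt (r := X) (F := F)) => //.
  - exact: (flat_join (r := X)).
  - exact: (le_joinl (r := X)).
  - by apply: contra nAF => /eqP ->; apply: (le_joinr (r := X)).
set J := cl _ => leJ.
have fJ : is_flat M J by apply: (flat_join (r := X)).
have FJ : F `<=` J by apply: (le_joinl (r := X)).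
have nJF : ~~ (J `<=` F) by apply: contra nAF; apply: fsubset_trans; apply: (le_joinr (r := X)).
apply/(ideal_eqmod idI (ideal_subX idI c.+1 (w_join fF fA nAF))); rewrite -/J.
have /fsubsetPn[i iJ iF] := nJF.
have iE : i \in E by apply: (fsubsetP (flat_sub fJ)).
have iE' : [fset i] `<=` E by rewrite fsub1set.
have FiE : F `|` [fset i] `<=` E by rewrite fsubUset (flat_sub fF).
set F' := cl (F `|` [fset i]).
have fF' : is_flat M F' by apply: flat_closure.
have FF' : F `|` [fset i] `<=` F' by apply: sub_closure.
have F'J : F' `<=` J by apply: closure_least => //; rewrite fsubUset FJ fsub1set.
have rF' : (r F < r F')%N.
  apply: (flat_rank_lt hM) => //; first by apply: fsubset_trans FF'; apply: fsubsetUl.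
  by apply: contra iF => /eqP ->; apply: (fsubsetP FF'); rewrite !inE eqxx orbT.
have h0 : I (w F * upper F').
  have fci : is_flat M (cl [fset i]) by apply: flat_closure.
  have nci : ~~ (cl [fset i] `<=` F).
    by apply: contra iF => /fsubsetP; apply; apply: (fsubsetP (sub_closure iE')); rewrite inE.
  have -> : F' = cl (F `|` cl [fset i]).
    apply/eqP; rewrite eqEfsubset; apply/andP; split.
      apply: closure_least => //; first exact: (flat_join (r := X) fF fci).
      rewrite fsubUset; apply/andP; split; first exact: (le_joinl (r := X) fF fci).
      exact: fsubset_trans (sub_closure iE') (le_joinr (r := X) fF fci).
    apply: closure_least => //; first exact: flat_joins.
    rewrite fsubUset (fsubset_trans (fsubsetUl _ _) FF') /=.
    by apply: closure_least => //; apply: fsubset_trans FF'; apply: fsubsetUr.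
  by apply/(ideal_eqmod idI (w_join fF fci nci)); rewrite -star_closure //; apply: w_star.
have eF' : upper F' = upper J + \sum_(H <- ls | (F' `<=` H) && ~~ (J `<=` H)) w H.
  rewrite /upper (bigID (fun H => J `<=` H)) /=; congr (_ + _); apply: eq_bigl => H.
  by case JH: (J `<=` H); rewrite ?andbF // andbT (fsubset_trans F'J).
have -> : w F * upper J ^+ c.+1 = w F * upper F' * upper J ^+ c -
   w F * ((\sum_(H <- ls | (F' `<=` H) && ~~ (J `<=` H)) w H) * upper J ^+ c).
  by rewrite eF' exprS; ring.
apply: (ideal_sub idI); first exact: (ideal_mulr idI _ h0).
apply: (ideal_mull idI); rewrite mulr_suml; apply: (ideal_sum_seq idI) => H.
rewrite flE => fH /andP[F'H JH]; apply: IH => //.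
(* Since [r F'] exceeds [r F] and [r J] is at most r F + c + 1, the join of H and J has rank at most
   r H + c, as the induction hypothesis needs. *)
have : (r (cl (H `|` J)) + r F' <= r H + r J)%N by exact: (rk_submod (r := X) fF' fH fJ F'H F'J).
move: rF' leJ; clear; lia.
Qed.

Hypothesis f0 : is_flat M fset0.

Lemma flat_rank_gt0 A i : is_flat M A -> i \in A -> (0 < r A)%N.
Proof.
move=> fA iA; apply: leq_ltn_trans (flat_rank_lt hM f0 fA (fsub0set _) _) => //.
by apply: contraTneq iA => <-; rewrite inE.
Qed.

(** Being h of the closure of [i], star_i exceeds h_A by the w_H with H containing [i] but not [A].
    Submodularity against this closure, of positive rank, bounds r (join H A) - r H by r A - 1, so
    [upper_vanish] kills these terms. *)
Lemma upper_pow_star A i : is_flat M A -> i \in A ->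
  I (upper A ^+ r A - upper A ^+ (r A).-1 * star i).
Proof.
move=> fA iA; have iE : i \in E by apply: (fsubsetP (flat_sub fA)).
have iE' : [fset i] `<=` E by rewrite fsub1set.
rewrite star_closure //; set F' := cl _.
have fF' : is_flat M F' by apply: flat_closure.
have F'A : F' `<=` A by apply: closure_least; rewrite // fsub1set.
have eF' : upper F' = upper A + \sum_(H <- ls | (F' `<=` H) && ~~ (A `<=` H)) w H.
  rewrite /upper (bigID (fun H => A `<=` H)) /=; congr (_ + _); apply: eq_bigl => H.
  by case AH: (A `<=` H); rewrite ?andbF // andbT (fsubset_trans F'A).
have rF' : (0 < r F')%N.
  by apply: (flat_rank_gt0 (i := i)) => //; apply: (fsubsetP (sub_closure iE')); rewrite inE.
have rA := flat_rank_gt0 fA iA.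
rewrite -{1}(prednK rA) exprSr -mulrBr eF' opprD addNKr mulrN; apply: (ideal_opp idI).
rewrite mulrC mulr_suml; apply: (ideal_sum_seq idI) => H.
rewrite flE => fH /andP[F'H AH]; apply: upper_vanish => //.
have : (r (cl (H `|` A)) + r F' <= r H + r A)%N by exact: (rk_submod (r := X) fF' fH fA F'H F'A).
move: rF' rA; clear; lia.
Qed.

(** For the single relations, h_A^(r A + s) is congruent to h_A^(r A - 1) star_i^(s + 1) for any i
    in A; this is where the value of [s] enters. *)
Lemma FY_relations s :
  (forall i, i \in E -> I (star i ^+ s.+1)) -> w fset0 = 0 -> (s <= 1)%N ->
  forall (e : {rmorphism rat -> R}) x, @FY_gen _ X ls fset0 s x -> I (tower_eval e w ls x).
Proof.
move=> hs w0 s1 e x.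
have ev F : F \in ls -> tower_eval e w ls (tower_var ls F) = w F by apply: tower_eval_var.
have eu A : tower_eval e w ls (upsum X ls A) = upper A.
  rewrite /upsum rmorph_sum /= big_seq_cond [RHS]big_seq_cond; apply: eq_bigr => H /andP[Hls _].
  exact: ev.
case=> [F Fls|F G Fls Gls|F A Fls Als /andP[FA nFA]|A Als /andP[_ nA]].
- by rewrite /below /= fsub0set /= negbK => /eqP e0; rewrite -e0 in Fls *; rewrite ev // w0; apply: ideal_has0.
- by move=> n1 n2; rewrite rmorphM !ev //; apply: w_incomp.
- rewrite rmorphM rmorphXn ev // eu.
  have fF : is_flat M F by rewrite -flE.
  have fA : is_flat M A by rewrite -flE.
  apply: upper_vanish => //.
    by apply: contra nFA => AF; rewrite eqEfsubset AF andbT; exact: FA.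
  have : (r (cl (F `|` A)) <= r A)%N.
    apply: mrank_mono => //; apply: closure_least => //; first exact: flat_joins.
    by rewrite fsubUset fsubset_refl andbT; exact: FA.
  rewrite /=; lia.
have fA : is_flat M A by rewrite -flE.
have /fset0Pn[i iA] : A != fset0 by rewrite eq_sym.
have iE : i \in E by apply: (fsubsetP (flat_sub fA)).
rewrite rmorphXn eu /= mrank0 // subn0.
suff h : I (upper A ^+ (r A + s) - upper A ^+ (r A).-1 * star i ^+ s.+1).
  by apply/(ideal_eqmod idI h); apply: (ideal_mull idI); apply: hs.
have h := upper_pow_star fA iA.
case: s s1 hs => [|[|//]] _ hs; first by rewrite addn0 expr1.
have -> : upper A ^+ (r A + 1) - upper A ^+ (r A).-1 * star i ^+ 2 =
  upper A * (upper A ^+ r A - upper A ^+ (r A).-1 * star i) +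
  star i * (upper A ^+ (r A).-1 * upper A - upper A ^+ (r A).-1 * star i).
  by rewrite addn1 exprS; ring.
apply: (ideal_add idI); apply: (ideal_mull idI) => //.
by rewrite -exprSr prednK // (flat_rank_gt0 fA iA).
Qed.

End ChowRelations.

(** * The reduced and the augmented presentation of a loopless matroid *)

Section Presentations.
Variables (M : matroid) (hM : is_matroid M) (f0 : is_flat M fset0).
Implicit Types (A F G H J : {fset nat}).
Local Notation E := (ground M).
Local Notation r := (mrank M).
Local Notation ls := (sorted_flats M).
Local Notation X := (flat_lattice hM).
Local Notation cl := (mclosure M).
Local Notation var := (tower_var ls).
Local Notation K s := (@FY_ideal _ X ls fset0 s).

Let flE F : (F \in ls) = is_flat M F. Proof. exact: mem_sorted_flats. Qed.

Lemma flat_ground : is_flat M E.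
Proof. by apply/is_flatP; split=> // e ->. Qed.

Lemma mmap_sumX (L : Type) (x0 : L) (lbl : seq L) (P : pred L) (uu : L -> tower ls) :
  mmap (tower_const ls) (fun i : 'I_(size lbl) => uu (lab x0 i)) (sumX x0 lbl P) =
  \sum_(l <- lbl | P l) uu l.
Proof.
rewrite /sumX rmorph_sum /= (big_nth x0) big_mkord; apply: eq_bigr => i _.
by rewrite mmapX mmap1U.
Qed.

Lemma sumX_homog (L : Type) (x0 : L) (lbl : seq L) (P : pred L) : is_homog 1 (sumX x0 lbl P).
Proof.
rewrite is_homogE; apply: rpred_sum => i _.
by rewrite /Xv dhomogX; apply/eqP; apply: mdeg1.
Qed.

Lemma sumX_pred1 (L : eqType) (x0 : L) (lbl : seq L) (i : 'I_(size lbl)) :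
  uniq lbl -> sumX x0 lbl (pred1 (lab x0 i)) = 'X_i.
Proof.
move=> ul; rewrite /sumX (bigD1 i) /= ?eqxx // big1 ?addr0 // => j /andP[/eqP].
by rewrite /lab => /eqP; rewrite nth_uniq // => /eqP/val_inj ->; rewrite eqxx.
Qed.

Lemma sumX_big (L : eqType) (x0 : L) (lbl : seq L) (P : pred L) : uniq lbl ->
  sumX x0 lbl P = \sum_(l <- lbl | P l) sumX x0 lbl (pred1 l).
Proof.
move=> ul; rewrite {1}/sumX [RHS](big_nth x0) big_mkord; apply: eq_bigr => i _.
by rewrite sumX_pred1.
Qed.

Lemma quad_gensP (L : Type) (x0 : L) (lbl : seq L) (P : L -> L -> bool) g :
  g \in quad_gens x0 lbl P ->
  exists i j : 'I_(size lbl), P (lab x0 i) (lab x0 j) /\ g = 'X_i * 'X_j.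
Proof.
case/flattenP => s /mapP[i _ ->] /mapP[j]; rewrite mem_filter => /andP[Pij _] ->.
by exists i, j.
Qed.

Lemma quad_gens_in (L : eqType) (x0 : L) (lbl : seq L) (P : L -> L -> bool) a b :
  uniq lbl -> a \in lbl -> b \in lbl -> P a b ->
  sumX x0 lbl (pred1 a) * sumX x0 lbl (pred1 b) \in quad_gens x0 lbl P.
Proof.
move=> ul /(nthP x0)[i li <-] /(nthP x0)[j lj <-] Pab.
rewrite (sumX_pred1 x0 (Ordinal li) ul) (sumX_pred1 x0 (Ordinal lj) ul).
apply/flatten_mapP; exists (Ordinal li); first by rewrite mem_enum.
by apply/mapP; exists (Ordinal lj); rewrite // mem_filter Pab mem_enum.
Qed.

Lemma closure1_flat i : i \in E -> is_flat M (cl [fset i]).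
Proof. by move=> iE; apply: flat_closure; rewrite ?fsub1set. Qed.

Lemma mem_closure1 i : i \in E -> i \in cl [fset i].
Proof. by move=> iE; apply: (fsubsetP (sub_closure _)); rewrite ?fsub1set ?inE. Qed.

Lemma closure1_rank i : i \in E -> r (cl [fset i]) = 1%N.
Proof.
move=> iE; apply/eqP; rewrite eqn_leq (flat_rank_gt0 hM f0 (closure1_flat iE) (mem_closure1 iE)) andbT.
rewrite (mrank_closure hM) ?fsub1set //; have [B _ ->] := mrank_attained hM [fset i].
by rewrite (leq_trans (fsubset_leq_card (fsubsetIl _ _))) // cardfs1.
Qed.

Lemma tower_star i : i \in E -> star M var i = upsum X ls (cl [fset i]).
Proof. by move=> iE; apply: star_closure. Qed.

Lemma FY_ideal_star s i : i \in E -> K s (star M var i ^+ s.+1).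
Proof.
move=> iE; rewrite tower_star //; apply: ideal_gen.
have -> : s.+1 = (r (cl [fset i]) - r fset0 + s)%N by rewrite closure1_rank // mrank0.
apply: (FY_single (X := X) s); rewrite ?flE ?closure1_flat // /below /= fsub0set /=.
by apply: contraTneq (mem_closure1 iE) => <-; rewrite inE.
Qed.

Lemma FY_ideal_empty s : K s (var fset0).
Proof. by apply: ideal_gen; apply: FY_inactive; rewrite ?flE // /below eqxx andbF. Qed.

Lemma FY_ideal_incomparable s F G : is_flat M F -> is_flat M G -> incomparable F G ->
  K s (var F * var G).
Proof.
by move=> fF fG /andP[n1 n2]; apply: ideal_gen; apply: FY_incomparable; rewrite ?flE.
Qed.

Definition red_label_var (i : 'I_(size (red_labels M))) : tower ls := var (lab fset0 i).

Let mem_red_labels F : (F \in red_labels M) = [&& is_flat M F, F != fset0 & F != E].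
Proof.
rewrite -mem_flats; have -> : (F \in red_labels M) =
  (F \in [fset F in flats M | (F != fset0) && (F != E)]) by [].
by rewrite in_fset.
Qed.

Let red_labels_uniq : uniq (red_labels M). Proof. exact: fset_uniq. Qed.

Lemma red_labels_perm : E != fset0 ->
  perm_eq ls (fset0 :: E :: red_labels M).
Proof.
move=> E0; apply: uniq_perm; first exact: sorted_flats_uniq.
  by rewrite /= in_cons !mem_red_labels eq_sym (negbTE E0) !eqxx !andbF /= red_labels_uniq.
move=> F; rewrite flE !in_cons mem_red_labels.
by case: eqP => [->|_]; rewrite ?f0 //; case: eqP => [->|_]; rewrite ?flat_ground ?andbT.
Qed.

Lemma red_labels_sum (V : nmodType) (w : {fset nat} -> V) (P : pred {fset nat}) : E != fset0 ->
  \sum_(F <- ls | P F) w F = (if P fset0 then w fset0 else 0) + (if P E then w E else 0)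
    + \sum_(F <- red_labels M | P F) w F.
Proof.
move=> E0; rewrite (perm_big _ (red_labels_perm E0)) !big_cons -addrA.
by case: (P fset0); case: (P E); rewrite ?add0r.
Qed.

Theorem red_hilb_series : hilb_series (red_gens M) = FY_series X ls fset0 0.
Proof.
pose rl := red_labels M; pose n := size rl.
pose Xf F : {mpoly rat[n]} := sumX fset0 rl (pred1 F).
(* The variable of [E] is recovered from one fixed element of [E]; when [E] is empty its only flat
   is [fset0], so the default of [head] is never reached. *)
pose v F : {mpoly rat[n]} := if F == fset0 then 0 else
  if F == E then - sumX fset0 rl (fun H => head 0%N (enum_fset E) \in H) else Xf F.
have h0E : E != fset0 -> head 0%N (enum_fset E) \in E.
  have hd (s : seq nat) x : x \in s -> head 0%N s \in s by case: s => //= y s _; rewrite mem_head.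
  by case/fset0Pn => x xE; apply: (hd _ x).
have idI := in_ideal_is_ideal (red_gens M); have idK := FY_is_ideal X ls fset0 0.
have nE F : F != fset0 -> is_flat M F -> E != fset0.
  by move=> F0 /flat_sub FE; apply: contra F0 => /eqP e; rewrite -fsubset0 -e.
have vr F : F \in rl -> v F = Xf F.
  by rewrite mem_red_labels /v => /and3P[_ /negbTE -> /negbTE ->].
have star_v i : i \in E -> in_ideal (red_gens M) (star M v i).
  move=> iE; have E0 : E != fset0 by apply: contraTneq iE => ->; rewrite inE.
  rewrite /star (red_labels_sum _ _ E0) inE iE add0r /v (negbTE E0) eqxx addrC.
  rewrite -/v; have -> : \sum_(F <- rl | i \in F) v F = sumX fset0 rl (fun F => i \in F).
    rewrite sumX_big //; rewrite big_seq_cond [RHS]big_seq_cond.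
    by apply: eq_bigr => F /andP[Fr _]; apply: vr.
  apply: in_ideal_gen; rewrite mem_cat; apply/orP; right; apply/flatten_mapP; exists i => //.
  by apply/mapP; exists (head 0%N (enum_fset E)) => //; apply: h0E.
apply: (@hilb_series_FY n (red_gens M) _ X ls fset0 0 red_label_var v).
- exact: sorted_flats_admissible.
- exact: f0.
- by move=> i; apply: tower_homog_var.
- move=> F _; rewrite /v; case: ifP => _; first by rewrite is_homogE; apply: dhomog0.
  by case: ifP => _; last exact: sumX_homog; rewrite is_homogE dhomogN -is_homogE; apply: sumX_homog.
- move=> g; rewrite mem_cat => /orP[|/flatten_mapP[i iE /mapP[j jE ->]]].
    move/(@quad_gensP _ fset0) => [i [j [Pij ->]]].
    rewrite rmorphM /= !mmapX !mmap1U; apply: FY_ideal_incomparable => //.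
      by have := mem_nth fset0 (ltn_ord i); rewrite -/rl mem_red_labels => /and3P[].
    by have := mem_nth fset0 (ltn_ord j); rewrite -/rl mem_red_labels => /and3P[].
  have E0 : E != fset0 by apply: contraTneq iE => ->; rewrite inE.
  rewrite rmorphB /= !(mmap_sumX (L := {fset nat}) fset0 _ _ var).
  (* Both sums lack only the term of [E], which cancels in their difference. *)
  have st k : k \in E -> \sum_(l <- red_labels M | k \in l) var l = star M var k - var E.
    by move=> kE; rewrite /star (red_labels_sum _ _ E0) inE kE add0r addrC addrK.
  rewrite !st // opprB addrA subrK; apply: (ideal_sub idK).
    by have := FY_ideal_star 0 iE.
  by have := FY_ideal_star 0 jE.
- move=> x; apply: (FY_relations (hM := hM) idI) => //.
  + move=> G H; rewrite !flE => fG fH n1 n2.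
    have [G0|G0] := eqVneq G fset0; first by rewrite G0 fsub0set in n1.
    have [H0|H0] := eqVneq H fset0; first by rewrite H0 fsub0set in n2.
    have [GE|GE] := eqVneq G E; first by rewrite GE (flat_sub fH) in n2.
    have [HE|HE] := eqVneq H E; first by rewrite HE (flat_sub fG) in n1.
    rewrite !vr ?mem_red_labels ?fG ?fH ?G0 ?H0 //; apply: in_ideal_gen; rewrite mem_cat; apply/orP; left.
    by apply: quad_gens_in; rewrite ?mem_red_labels ?fG ?fH ?G0 ?H0 // /incomparable n1.
  + by move=> F i _ iE _; apply: (ideal_mull idI); apply: star_v.
- move=> i; rewrite /red_label_var tower_eval_var.
    by rewrite vr ?mem_nth // /Xf sumX_pred1 // subrr; apply: (ideal_has0 idI).
  by have := mem_nth fset0 (ltn_ord i); rewrite flE -/rl mem_red_labels => /and3P[].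
- move=> F; rewrite flE => fF; rewrite /v; case: eqP => [->|/eqP F0].
    by rewrite rmorph0 sub0r; apply: (ideal_opp idK); apply: FY_ideal_empty.
  have E0 := nE F F0 fF.
  case: eqP => [->|/eqP FE].
    rewrite rmorphN /= (mmap_sumX (L := {fset nat}) fset0 _ _ var) -opprD; apply: (ideal_opp idK).
    have := FY_ideal_star 0 (h0E E0); rewrite expr1.
    by rewrite /star (red_labels_sum _ _ E0) inE h0E // add0r addrC.
  rewrite /Xf (mmap_sumX (L := {fset nat}) fset0 _ _ var) -big_filter.
  have -> : [seq i <- red_labels M | pred1 F i] = [:: F].
    by rewrite filter_pred1_uniq // mem_red_labels fF F0.
  by rewrite big_seq1 subrr; apply: (ideal_has0 idK).
Qed.


Local Notation x0 := (inl fset0 : {fset nat} + nat).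

Definition proper_flats : seq {fset nat} := enum_fset [fset F in flats M | F != E].

Let mem_proper_flats F : (F \in proper_flats) = is_flat M F && (F != E).
Proof.
rewrite -mem_flats; have -> : (F \in proper_flats) = (F \in [fset F in flats M | F != E]) by [].
by rewrite in_fset.
Qed.

Let proper_flats_uniq : uniq proper_flats. Proof. exact: fset_uniq. Qed.

Let flats_sum (V : nmodType) (w : {fset nat} -> V) (P : pred {fset nat}) :
  \sum_(F <- ls | P F) w F = (if P E then w E else 0) + \sum_(F <- proper_flats | P F) w F.
Proof.
have eqp : perm_eq ls (E :: proper_flats).
  apply: uniq_perm; first exact: sorted_flats_uniq.
    by rewrite /= mem_proper_flats eqxx andbF.
  move=> F; rewrite flE in_cons mem_proper_flats.
  by case: eqP => [->|_]; rewrite ?flat_ground ?andbT.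
by rewrite (perm_big _ eqp) big_cons; case: (P E); rewrite ?add0r.
Qed.

Let aug_uniq : uniq (aug_labels M).
Proof.
rewrite cat_uniq !map_inj_uniq ?fset_uniq ?andbT; try by move=> ? ? [].
by apply/hasPn => l /mapP[i _ ->]; apply/mapP => -[].
Qed.

Let aug_sum (V : nmodType) (w : {fset nat} + nat -> V) P :
  \sum_(l <- aug_labels M | P l) w l =
  \sum_(F <- proper_flats | P (inl F)) w (inl F) + \sum_(i <- enum_fset E | P (inr i)) w (inr i).
Proof. by rewrite big_cat !big_map. Qed.

Let mem_aug_inl F : (inl F \in aug_labels M) = is_flat M F && (F != E).
Proof.
rewrite -mem_proper_flats mem_cat mem_map; last by move=> ? ? [].
by rewrite orbC; case: mapP => // -[].
Qed.

Let mem_aug_inr i : (inr i \in aug_labels M) = (i \in E).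
Proof.
rewrite mem_cat orbC mem_map; last by move=> ? ? [].
by rewrite orbC; case: mapP => // -[].
Qed.

(* Image of the variables of the augmented presentation: [x_0 = - sum_H x_H], where the
   variable of the empty flat vanishes on the right, and [y_i = - sum_(H containing i) x_H]. *)
Definition aug_var (l : {fset nat} + nat) : tower ls :=
  match l with
  | inl F => if F == fset0 then - \sum_(H <- ls) var H else var F
  | inr i => - star M var i
  end.

Let aug_var_sum (P : pred {fset nat}) : P fset0 ->
  \sum_(F <- ls | P F) aug_var (inl F) = \sum_(F <- ls | P F) var F - var fset0 - \sum_(H <- ls) var H.
Proof.
move=> P0; rewrite -big_filter -[X in _ = X - _ - _]big_filter.
have e0 : fset0 \in [seq F <- ls | P F] by rewrite mem_filter P0 flE.
have un : uniq [seq F <- ls | P F] by rewrite filter_uniq ?sorted_flats_uniq.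
rewrite (bigD1_seq fset0 e0 un) [X in _ = X - _ - _](bigD1_seq fset0 e0 un) /= ?eqxx.
rewrite [X in _ = X - _]addrC addKr addrC; congr (_ + _); apply: eq_bigr => F /negbTE F0.
by rewrite F0.
Qed.

Theorem aug_hilb_series : hilb_series (aug_gens M) = FY_series X ls fset0 1.
Proof.
pose al := aug_labels M; pose n := size al.
pose Xf F : {mpoly rat[n]} := sumX x0 al (pred1 (inl F)).
pose Yf i : {mpoly rat[n]} := sumX x0 al (pred1 (inr i)).
(* Inverse to [aug_var]: the variable of the ground set goes to minus the sum of all x_F, the empty
   flat included. *)
pose v F : {mpoly rat[n]} := if F == fset0 then 0 else
  if F == E then - sumX x0 al is_x else Xf F.
have idI := in_ideal_is_ideal (aug_gens M); have idK := FY_is_ideal X ls fset0 1.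
have vr F : F != fset0 -> F != E -> v F = Xf F by rewrite /v => /negbTE -> /negbTE ->.
have v0 : v fset0 = 0 by rewrite /v eqxx.
have vE : E != fset0 -> v E = - sumX x0 al is_x by rewrite /v => /negbTE ->; rewrite eqxx.
have nE i : i \in E -> E != fset0 by move=> iE; apply: contraTneq iE => ->; rewrite inE.
have sumx : sumX x0 al is_x = \sum_(F <- proper_flats) Xf F.
  by rewrite sumX_big // aug_sum /= [X in _ + X]big_pred0 ?addr0.
have sumn i : sumX x0 al (fun l => if l is inl F then i \notin F else false) =
    \sum_(F <- proper_flats | i \notin F) Xf F.
  by rewrite sumX_big // aug_sum /= [X in _ + X]big_pred0 ?addr0.
have gY i : i \in E -> in_ideal (aug_gens M) (Yf i - \sum_(F <- proper_flats | i \notin F) Xf F).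
  move=> iE; rewrite -sumn; apply: in_ideal_gen; rewrite mem_cat; apply/orP; left.
  by apply/mapP; exists i.
have gYX i F : i \in E -> is_flat M F -> F != E -> i \notin F -> in_ideal (aug_gens M) (Yf i * Xf F).
  move=> iE fF FE iF; apply: in_ideal_gen; rewrite mem_cat; apply/orP; right.
  by apply: quad_gens_in; rewrite ?mem_aug_inl ?mem_aug_inr ?fF.
(* The flats through [i] cancel against part of the image of the variable of [E]; what is left is
   -y_i modulo the linear generators. *)
have starE i : i \in E -> star M v i = - \sum_(F <- proper_flats | i \notin F) Xf F.
  move=> iE; rewrite /star flats_sum iE vE ?(nE i) // sumx.
  have -> : \sum_(F <- proper_flats | i \in F) v F = \sum_(F <- proper_flats | i \in F) Xf F.
    rewrite big_seq_cond [RHS]big_seq_cond; apply: eq_bigr => F /andP[].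
    rewrite mem_proper_flats => /andP[_ FE] iF; apply: vr => //.
    by apply: contraTneq iF => ->; rewrite inE.
  by rewrite (bigID (fun F => i \in F)) /= opprD addrAC addNr add0r.
have starY i : i \in E -> in_ideal (aug_gens M) (star M v i + Yf i).
  by move=> iE; rewrite starE // addrC; apply: gY.
have starX F i : is_flat M F -> i \in E -> i \notin F -> in_ideal (aug_gens M) (v F * star M v i).
  move=> fF iE iF; have FE : F != E by apply: contraNneq iF => ->.
  have [->|F0] := eqVneq F fset0; first by rewrite v0 mul0r; apply: (ideal_has0 idI).
  rewrite vr //; have -> : Xf F * star M v i = Xf F * (star M v i + Yf i) - Yf i * Xf F by ring.
  by apply: (ideal_sub idI); [apply: (ideal_mull idI); apply: starY|apply: gYX].
apply: (@hilb_series_FY n (aug_gens M) _ X ls fset0 1 (fun i => aug_var (lab x0 i)) v).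
- exact: sorted_flats_admissible.
- exact: f0.
- move=> i; case: (lab x0 i) => [F|j] /=; last first.
    by apply: tower_homogN; apply: tower_homog_sum => F _; apply: tower_homog_var.
  case: ifP => _; last exact: tower_homog_var.
  by apply: tower_homogN; apply: tower_homog_sum => H _; apply: tower_homog_var.
- move=> F _; rewrite /v; case: ifP => _; first by rewrite is_homogE; apply: dhomog0.
  by case: ifP => _; last exact: sumX_homog; rewrite is_homogE dhomogN -is_homogE; apply: sumX_homog.
- move=> g; rewrite mem_cat => /orP[/mapP[i iE ->]|].
    rewrite rmorphB /= !(mmap_sumX x0 _ _ aug_var) !aug_sum /=.
    rewrite [X in X + _ - _]big_pred0 // add0r [X in _ - (_ + X)]big_pred0 // addr0.
    rewrite [X in X - _](_ : _ = - star M var i); last first.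
      by rewrite -big_filter (filter_pred1_uniq (x := i)) ?fset_uniq // big_seq1.
    have -> : \sum_(F <- proper_flats | i \notin F) aug_var (inl F) =
        \sum_(F <- ls | i \notin F) aug_var (inl F) by rewrite flats_sum iE add0r.
    rewrite aug_var_sum ?inE //.
    have -> : \sum_(H <- ls) var H = star M var i + \sum_(F <- ls | i \notin F) var F.
      by rewrite (bigID (fun F => i \in F)).
    (* All that survives of the linear generator is the variable of the empty flat. *)
    have -> : forall a b c : tower ls, - a - (b - c - (a + b)) = c by move=> a b c; ring.
    exact: FY_ideal_empty.
  move/(@quad_gensP _ x0) => [i [j [Pij ->]]].
  rewrite rmorphM /= !mmapX !mmap1U.
  have := mem_nth x0 (ltn_ord i); have := mem_nth x0 (ltn_ord j); rewrite -/(lab x0 i) -/(lab x0 j).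
  case: (lab x0 i) Pij => [F|k]; case: (lab x0 j) => [G|l] //=.
    move=> FG; rewrite !mem_aug_inl => /andP[fG _] /andP[fF _].
    case/andP: (FG) => n1 n2.
    rewrite (negbTE (_ : F != fset0)); last by apply: contraNneq n1 => ->; apply: fsub0set.
    rewrite (negbTE (_ : G != fset0)); last by apply: contraNneq n2 => ->; apply: fsub0set.
    exact: FY_ideal_incomparable.
  move=> kG; rewrite mem_aug_inl mem_aug_inr => /andP[fG _] kE.
  rewrite mulNr; apply: (ideal_opp idK).
  have starv H : is_flat M H -> k \notin H -> K 1 (var H * star M var k).
    move=> fH kH; rewrite tower_star // -[upsum _ _ _]expr1.
    apply: (var_upsum_vanish (X := X) fset0 1 (sorted_flats_admissible hM)).
    - by rewrite flE.
    - exact: closure1_flat.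
    - by apply: contra kH => /fsubsetP; apply; apply: mem_closure1.
    - have := closure1_rank_le hM fH kE; rewrite /=; lia.
  case: eqP => [_|_]; last by rewrite mulrC; apply: starv.
  (* Now the flat is empty, with image - sum_H x_H: the flats through k contribute star_k^2, which
     is zero for s = 1, and the others vanish one by one. *)
  rewrite mulrN mulrC; apply: (ideal_opp idK).
  rewrite (bigID (fun H => k \in H)) /= mulrDl; apply: (ideal_add idK).
    by have := FY_ideal_star 1 kE; rewrite expr2.
  rewrite mulr_suml; apply: (ideal_sum_seq idK) => H; rewrite flE => fH kH.
  exact: starv.
- move=> x; apply: (FY_relations (hM := hM) idI) => //.
  + move=> G H; rewrite !flE => fG fH n1 n2.
    have [G0|G0] := eqVneq G fset0; first by rewrite G0 fsub0set in n1.
    have [H0|H0] := eqVneq H fset0; first by rewrite H0 fsub0set in n2.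
    have [GE|GE] := eqVneq G E; first by rewrite GE (flat_sub fH) in n2.
    have [HE|HE] := eqVneq H E; first by rewrite HE (flat_sub fG) in n1.
    rewrite !vr //; apply: in_ideal_gen; rewrite mem_cat; apply/orP; right.
    by apply: quad_gens_in; rewrite ?mem_aug_inl ?fG ?fH //= /incomparable n1.
  + move=> i iE; set st := star M v i.
    (* Modulo the ideal star_i is -y_i, and y_i^2 is a sum of generators y_i x_F with [i] not in
       F. *)
    have -> : st ^+ 2 = (st - Yf i) * (st + Yf i) +
        Yf i * (Yf i - \sum_(F <- proper_flats | i \notin F) Xf F) +
        Yf i * (\sum_(F <- proper_flats | i \notin F) Xf F) by ring.
    apply: (ideal_add idI); first apply: (ideal_add idI).
    * by apply: (ideal_mull idI); apply: starY.
    * by apply: (ideal_mull idI); apply: gY.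
    * rewrite mulr_sumr; apply: (ideal_sum_seq idI) => F.
      by rewrite mem_proper_flats => /andP[fF FE] iF; apply: gYX.
- move=> i; rewrite -(sumX_pred1 x0 i aug_uniq).
  have := mem_nth x0 (ltn_ord i); rewrite -/(lab x0 i).
  case: (lab x0 i) => [F|j] /=.
    rewrite mem_aug_inl => /andP[fF FE]; case: eqP => [F0|/eqP F0]; last first.
      by rewrite tower_eval_var ?flE // vr // subrr; apply: (ideal_has0 idI).
    rewrite F0 in FE fF *.
    have -> : tower_eval (@mpolyC n rat) v ls (- \sum_(H <- ls) var H) = Xf fset0.
      rewrite rmorphN rmorph_sum /=.
      have -> : \sum_(H <- ls) tower_eval (@mpolyC n rat) v ls (var H) = \sum_(H <- ls) v H.
        rewrite big_seq [RHS]big_seq; apply: eq_bigr => H Hls.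
        by rewrite tower_eval_var.
      rewrite flats_sum vE 1?eq_sym // sumx.
      have e0 : fset0 \in proper_flats by rewrite mem_proper_flats fF.
      rewrite (bigD1_seq fset0 e0) //= [X in _ + X](bigD1_seq fset0 e0) //= v0 add0r opprD opprK.
      rewrite [X in _ - X](_ : _ = \sum_(F <- proper_flats | F != fset0) Xf F) ?addrK //.
      rewrite big_seq_cond [RHS]big_seq_cond; apply: eq_bigr => H /andP[].
      by rewrite mem_proper_flats => /andP[_ HE] H0; apply: vr.
    by rewrite subrr; apply: (ideal_has0 idI).
  rewrite mem_aug_inr => jE; rewrite rmorphN -opprD; apply: (ideal_opp idI).
  have -> : tower_eval (@mpolyC n rat) v ls (star M var j) = star M v j.
    rewrite /star rmorph_sum /= big_seq_cond [RHS]big_seq_cond; apply: eq_bigr => H /andP[Hls _].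
    by rewrite tower_eval_var.
  exact: starY.
- move=> F; rewrite flE => fF; rewrite /v; case: eqP => [->|/eqP F0].
    by rewrite rmorph0 sub0r; apply: (ideal_opp idK); apply: FY_ideal_empty.
  case: eqP => [eFE|/eqP FE].
    rewrite eFE in F0 *.
    rewrite rmorphN /= (mmap_sumX x0 _ _ aug_var) aug_sum /= [X in - (_ + X)]big_pred0 // addr0.
    have := flats_sum (fun F => aug_var (inl F)) xpredT; rewrite aug_var_sum //= (negbTE F0).
    rewrite addrAC subrr sub0r => e.
    have -> : \sum_(F <- proper_flats) aug_var (inl F) = - var fset0 - var E by rewrite e; ring.
    have -> : - (- var fset0 - var E) - var E = var fset0 by ring.
    exact: FY_ideal_empty.
  rewrite /Xf (mmap_sumX x0 _ _ aug_var) -big_filter (filter_pred1_uniq (x := inl F)) //.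
    by rewrite big_seq1 /= (negbTE F0) subrr; apply: (ideal_has0 idK).
  by rewrite mem_aug_inl fF.
Qed.

End Presentations.

(** * Euler characteristic of relatively open convex sets *)

Section EulerLine.
Variable R : realType.

Variant line_cell := LPoint of R | LOpen of R & R.
Definition cell_mem (t : R) J := match J with LPoint a => t == a | LOpen a b => a < t < b end.
(** Membership of the points immediately to the right of [t], as [cell_germ] makes precise. *)
Definition cell_right_mem (t : R) J := match J with LPoint a => false | LOpen a b => a <= t < b end.
Definition cell_lo J := match J with LPoint a => a | LOpen a b => a end.
(** The truth value of [a < b] gives Euler characteristic 0 to an empty interval, which encodes an
    empty projection. *)
Definition cell_euler J : int := match J with LPoint a => 1 | LOpen a b => - (a < b)%R%:R end.

Lemma cell_germ (s : seq line_cell) (t : R) :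
  exists2 e, t < e & forall u, t < u <= e -> all (fun J => cell_mem u J == cell_right_mem t J) s.
Proof.
elim: s => [|J s [e te IH]]; first by exists (t + 1) => //; rewrite ltrDl.
have gap a : exists2 d, t < d & forall u, t < u <= d -> (u < a) = (t < a) /\ (a < u) = (a <= t) /\ (u == a) = false.
  have [at_|ta] := leP a t.
    exists (t + 1); first by rewrite ltrDl.
    move=> u /andP[tu _]; have au := le_lt_trans at_ tu.
    by rewrite au ltNge (ltW au) gt_eqF // ltNge at_.
  exists ((t + a) / 2); first lra.
  move=> u /andP[tu ud]; have ua : u < a by lra.
  by rewrite ua lt_gtF // lt_eqF // ta leNgt ta.
have [d td hd] : exists2 d, t < d & forall u, t < u <= d -> cell_mem u J = cell_right_mem t J.
  case: J => [a|a b] /=.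
    by have [d td hd] := gap a; exists d => // u /hd [_ [_]].
  have [d td hd] := gap a; have [d' td' hd'] := gap b; exists (Num.min d d').
    by rewrite lt_min td.
  move=> u /andP[tu]; rewrite le_min => /andP[ud ud'].
  have [_ [-> _]] := hd u (introT andP (conj tu ud)).
  by have [-> _] := hd' u (introT andP (conj tu ud')).
exists (Num.min d e); first by rewrite lt_min td.
move=> u /andP[tu]; rewrite le_min => /andP[ud ue] /=.
by rewrite hd ?tu // eqxx IH ?tu.
Qed.

(* The jump [cell_mem t - cell_right_mem t] of a cell is its Euler characteristic at
   its left end point, and zero elsewhere. *)
Lemma euler_line (I : finType) (c : I -> int) (J : I -> line_cell) :
  (forall t, \sum_i c i * (cell_mem t (J i))%:R = 0) ->
  \sum_i c i * cell_euler (J i) = 0.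
Proof.
move=> h; pose T := undup [seq cell_lo (J i) | i <- enum I].
have jump t i : cell_euler (J i) * (cell_lo (J i) == t)%:R =
    (cell_mem t (J i))%:R - (cell_right_mem t (J i))%:R.
  case: (J i) => [a|a b] /=; first by rewrite mul1r subr0 eq_sym.
  case: (ltgtP a t) => [_|_|->] /=; rewrite ?mulr0 ?subrr // mulr1.
  by case: (t < b); rewrite ?subr0 ?sub0r ?oppr0.
have hT t : \sum_i c i * (cell_euler (J i) * (cell_lo (J i) == t)%:R) = 0.
  have [e te he] := cell_germ [seq J i | i <- enum I] t.
  under eq_bigr => i _.
    have := he e; rewrite te lexx all_map => /(_ isT) /allP/(_ i).
    rewrite mem_enum => /(_ isT) /eqP /= ei; rewrite jump mulrBr -ei.
    over.
  by rewrite sumrB !h subrr.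
have : \sum_(t <- T) \sum_i c i * (cell_euler (J i) * (cell_lo (J i) == t)%:R) = 0.
  by rewrite big1.
rewrite exchange_big /= => h0; rewrite -[RHS]h0; apply: eq_bigr => i _; rewrite -mulr_sumr -mulr_sumr.
have iT : cell_lo (J i) \in T by rewrite mem_undup; apply: map_f; rewrite mem_enum.
rewrite (bigD1_seq _ iT) ?undup_uniq //= eqxx big1 ?addr0 ?mulr1 // => t.
by rewrite eq_sym => /negbTE ->.
Qed.
End EulerLine.

Section Euler.
Variables (R : realType) (n : nat).
Implicit Types (D : 'rV[R]_n -> Prop) (A : 'M[R]_n).

(* [D] is a bounded convex set that is open in its affine hull, whose direction space
   is spanned by the rows of [A]; if [D] is empty then [A] is arbitrary. *)
Definition open_cell D A :=
  [/\ forall x y, D x -> D y -> (x - y <= A)%MS,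
      forall z v, D z -> (v <= A)%MS -> exists2 e, 0 < e & forall d, `|d| <= e -> D (z + d *: v),
      forall x y t, D x -> D y -> 0 <= t <= 1 -> D (x + t *: (y - x)) &
      exists b, forall x j, D x -> `|x 0 j| <= b].

Definition coord_dir (j : 'I_n) : 'cV[R]_n := delta_mx j 0.

Lemma coord_dirE (u : 'rV[R]_n) j : u *m coord_dir j = (u 0 j)%:M.
Proof.
apply/matrixP => a b; rewrite !ord1 mxE /= mxE eqxx (bigD1 j) //= big1 => [|k kj].
  by rewrite mxE !eqxx mulr1 addr0.
by rewrite mxE (negbTE kj) mulr0.
Qed.

Lemma sub_ker_coord (u : 'rV[R]_n) j : (u <= kermx (coord_dir j))%MS = (u 0 j == 0).
Proof.
apply/sub_kermxP/eqP; rewrite coord_dirE; last by move=> ->; rewrite raddf0.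
by move/matrixP/(_ 0 0); rewrite !mxE eqxx.
Qed.

Lemma open_cell_fibre D A j t : open_cell D A ->
  open_cell (fun x => D x /\ x 0 j = t) (A :&: kermx (coord_dir j))%MS.
Proof.
move=> [g1 g2 g3 [b g4]]; split.
- move=> x y [Dx xt] [Dy yt]; rewrite sub_capmx g1 //= sub_ker_coord.
  by rewrite !mxE xt yt subrr.
- move=> z v [Dz zt]; rewrite sub_capmx sub_ker_coord => /andP[vA /eqP v0].
  have [e e0 he] := g2 z v Dz vA; exists e => // d de; split; first exact: he.
  by rewrite !mxE v0 mulr0 addr0.
- move=> x y s [Dx xt] [Dy yt] hs; split; first exact: g3.
  by rewrite !mxE xt yt subrr mulr0 addr0.
- by exists b => x i [Dx _]; apply: g4.
Qed.

(** Multiplicativity of the Euler characteristic for the projection to coordinate [j]. If the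
    coordinate is constant on [D], all directions lie in its kernel and the fibre keeps the rank;
    otherwise the image is a bounded open interval and the rank drops by one, matching the factor
    -1. *)
Lemma open_cell_projection D A j : open_cell D A ->
  exists2 J : line_cell R, (forall t, cell_mem t J <-> exists2 x, D x & x 0 j = t) &
    cell_euler J * (-1) ^+ \rank (A :&: kermx (coord_dir j))%MS =
    (`[< exists x, D x >] : nat)%:R * (-1) ^+ \rank A :> int.
Proof.
move=> [g1 g2 g3 [b g4]].
have rk := mxrank_mul_ker A (coord_dir j).
case: (asboolP (exists x, D x)) => [[x0 Dx0]|nD]; last first.
  exists (LOpen 0 0) => [t|]; last by rewrite /= ltxx oppr0 !mul0r.
  rewrite /=; split=> [/andP[h1 h2]|[x Dx _]]; last by case: nD; exists x.
  by have := lt_trans h1 h2; rewrite ltxx.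
rewrite mul1r.
have [cst|ncst] := pselect (forall x y, D x -> D y -> x 0 j = y 0 j).
  exists (LPoint (x0 0 j)) => [t|].
    by rewrite /=; split=> [/eqP ->|[x Dx <-]]; [exists x0|rewrite (cst x x0)].
  rewrite /= mul1r -rk; suff -> : A *m coord_dir j = 0 by rewrite mxrank0.
  apply/row_matrixP => i; rewrite row_mul row0 coord_dirE.
  have [e e0 he] := g2 x0 (row i A) Dx0 (row_sub i A).
  have := cst _ _ (he e _) Dx0; rewrite ger0_norm ?(ltW e0) // => /(_ (lexx _)).
  rewrite !mxE => /eqP; rewrite -subr_eq0 addrAC subrr add0r mulf_eq0 gt_eqF //= => /eqP ->.
  by rewrite raddf0.
have [x1 [y1 [Dx1 Dy1 nxy]]] : exists x y, [/\ D x, D y & x 0 j != y 0 j].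
  apply: contrapT => h; apply: ncst => x y Dx Dy; apply/eqP; apply: contraT => nxy.
  by case: h; exists x, y.
pose T : R -> Prop := fun t => exists2 x, D x & x 0 j = t.
have T0 : classical_sets.nonempty T by exists (x0 0 j); exists x0.
(* Moving along a direction on which the coordinate is nonzero shows that the image is open; with
   convexity it is the interval from [inf T] to [sup T]. *)
have opn t : T t -> exists2 d, 0 < d & T (t - d) /\ T (t + d).
  move=> [x Dx <-]; pose v := if y1 0 j < x1 0 j then x1 - y1 else y1 - x1.
  have vA : (v <= A)%MS by rewrite /v; case: ifP => _; apply: g1.
  have v0 : 0 < v 0 j.
    rewrite /v; case: (ltP (y1 0 j) (x1 0 j)) => h; rewrite !mxE subr_gt0 //.
    by rewrite lt_neqAle nxy.
  have [e e0 he] := g2 x v Dx vA; exists (e * v 0 j); first exact: mulr_gt0.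
  split.
    exists (x + (- e) *: v); last by rewrite !mxE mulNr.
    by apply: he; rewrite normrN ger0_norm // ltW.
  exists (x + e *: v); last by rewrite !mxE.
  by apply: he; rewrite ger0_norm // ltW.
have cvx s t u : T s -> T t -> s <= u <= t -> T u.
  move=> [x Dx <-] [y Dy <-] /andP[xu uy].
  have [exy|nxy'] := eqVneq (x 0 j) (y 0 j).
    by exists x => //; apply/eqP; rewrite eq_le xu exy uy.
  have lt : 0 < y 0 j - x 0 j by rewrite subr_gt0 lt_neqAle nxy' (le_trans xu).
  exists (x + ((u - x 0 j) / (y 0 j - x 0 j)) *: (y - x)).
    apply: g3 => //; rewrite divr_ge0 ?subr_ge0 ?(le_trans xu) //=.
    by rewrite ler_pdivrMr // mul1r lerD2r.
  by rewrite !mxE divfK ?gt_eqF // addrC subrK.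
have ubT : classical_sets.has_ubound T.
  by exists b => t [x Dx <-]; apply: le_trans (ler_norm _) (g4 _ _ Dx).
have lbT : classical_sets.has_lbound T.
  exists (- b) => t [x Dx <-]; have := g4 x j Dx; rewrite ler_norml; by case/andP.
exists (LOpen (inf T) (sup T)) => [t|].
  split=> [/andP[lt tu]|Tt].
    have [s Ts st] := inf_lt T0 lt; have [u Tu tu'] := sup_gt T0 tu.
    by apply: (cvx s u) => //; rewrite !ltW.
  have [d d0 [Tm Tp]] := opn t Tt; rewrite /=.
  have h1 := ge_inf lbT Tm; have h2 := ub_le_sup ubT Tp.
  by apply/andP; split; [apply: le_lt_trans h1 _|apply: lt_le_trans h2]; lra.
have [d d0 [Tm Tp]] := opn _ (ex_intro2 _ _ x0 Dx0 erefl : T (x0 0 j)).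
have lt : inf T < sup T.
  by apply: le_lt_trans (ge_inf lbT Tm) _; apply: lt_le_trans (ub_le_sup ubT Tp); lra.
rewrite /= lt -rk; have -> : \rank (A *m coord_dir j) = 1%N.
  apply/eqP; rewrite eqn_leq rank_leq_col lt0n mxrank_eq0.
  apply: contra nxy => /eqP A0; rewrite -subr_eq0.
  have /submxP[w ew] := g1 _ _ Dx1 Dy1.
  have : (x1 - y1) *m coord_dir j = 0 by rewrite ew -mulmxA A0 mulmx0.
  by rewrite coord_dirE => /matrixP/(_ 0 0); rewrite !mxE eqxx mulr1n => ->.
by rewrite exprD expr1.
Qed.

(** A Fubini argument: the sum over the fibres at each value t of a coordinate vanishes by
    induction, and [euler_line] integrates over t. The induction is on the number [k] of coordinates
    still free, all points of all cells agreeing in the others. *)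
Theorem euler_additive (I : finType) (c : I -> int) (D : I -> 'rV[R]_n -> Prop) (A : I -> 'M[R]_n) :
  (forall i, open_cell (D i) (A i)) ->
  (forall x, \sum_i c i * (`[< D i x >] : nat)%:R = 0) ->
  \sum_i c i * ((`[< exists x, D i x >] : nat)%:R * (-1) ^+ \rank (A i)) = 0.
Proof.
suff gen k : (k <= n)%N -> forall (c : I -> int) (D : I -> 'rV[R]_n -> Prop) (A : I -> 'M[R]_n),
    (forall i i' x x', D i x -> D i' x' -> forall j : 'I_n, (k <= j)%N -> x 0 j = x' 0 j) ->
    (forall i, open_cell (D i) (A i)) ->
    (forall x, \sum_i c i * (`[< D i x >] : nat)%:R = 0) ->
    \sum_i c i * ((`[< exists x, D i x >] : nat)%:R * (-1) ^+ \rank (A i)) = 0.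
  by apply: (gen n) => // i i' x x' _ _ j; rewrite leqNgt ltn_ord.
elim: k => [|k IH] lek {}c {}D {}A com op h.
  have [[i0 [p Dp]]|none] := pselect (exists i x, D i x); last first.
    apply: big1 => i _; case: asboolP => [[x Dx]|_]; last by rewrite mul0r mulr0.
    by case: none; exists i, x.
  have eqp i x : D i x -> x = p.
    by move=> Dx; apply/rowP => j; apply: (com i i0).
  rewrite -[RHS](h p); apply: eq_bigr => i _; congr (_ * _).
  case: (asboolP (D i p)) => [Dip|nDip]; last first.
    case: asboolP => [[x Dx]|_]; last by rewrite mul0r.
    by case: nDip; rewrite -(eqp i x Dx).
  case: asboolP => [_|[]]; last by exists p.
  suff -> : A i = 0 by rewrite mxrank0 mulr1.
  have [_ g2 _ _] := op i; apply/row_matrixP => r; rewrite row0.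
  have [e e0 he] := g2 p _ Dip (row_sub r (A i)).
  have : p + e *: row r (A i) = p by apply: (eqp i); apply: he; rewrite ger0_norm // ltW.
  move/eqP; rewrite -subr_eq0 addrAC subrr add0r scaler_eq0 gt_eqF //= => /eqP //.
pose j := Ordinal lek; have lek' := ltnW lek.
have fib t : \sum_i c i * ((`[< exists x, D i x /\ x 0 j = t >] : nat)%:R *
    (-1) ^+ \rank (A i :&: kermx (coord_dir j))%MS) = 0.
  apply: (IH lek' c (fun i x => D i x /\ x 0 j = t)).
  - move=> i i' x x' [Dx xt] [Dx' xt'] l; rewrite leq_eqVlt => /orP[/eqP kl|]; last exact: (com i i').
    by have -> : l = j by [apply/val_inj]; rewrite xt xt'.
  - by move=> i; apply: open_cell_fibre.
  - move=> x; have [xt|nxt] := eqVneq (x 0 j) t.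
      rewrite -[RHS](h x); apply: eq_bigr => i _; congr (_ * (nat_of_bool _)%:R).
      by apply: asbool_equiv_eq; split=> [[]|].
    apply: big1 => i _; case: asboolP => [[_ e]|_]; last by rewrite mulr0.
    by rewrite e eqxx in nxt.
have hJ i := cid2 (open_cell_projection j (op i)).
pose J i := projT1 (cid2 (open_cell_projection j (op i))).
have J1 i t : cell_mem t (J i) <-> exists2 x, D i x & x 0 j = t.
  by rewrite /J; case: cid2.
have J2 i : cell_euler (J i) * (-1) ^+ \rank (A i :&: kermx (coord_dir j))%MS =
    (`[< exists x, D i x >] : nat)%:R * (-1) ^+ \rank (A i) :> int.
  by rewrite /J; case: cid2.
have := @euler_line R I (fun i => c i * (-1) ^+ \rank (A i :&: kermx (coord_dir j))%MS) J.
move=> el; rewrite -[RHS]el => [|t].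
  by apply: eq_bigr => i _; rewrite -J2 -mulrA [cell_euler _ * _]mulrC.
rewrite -[RHS](fib t); apply: eq_bigr => i _; rewrite -mulrA; congr (_ * _); rewrite mulrC.
congr ((nat_of_bool _)%:R * _); apply/idP/asboolP => [/J1[x Dx xt]|[x [Dx xt]]]; first by exists x.
by apply/J1; exists x.
Qed.
End Euler.

(** * Stiemke's lemma and relative interiors *)

Section Stiemke.
Variables (F : realFieldType) (n : nat) (T : eqType).
Implicit Types (s : seq T) (f : T -> 'rV[F]_n) (w : 'cV[F]_n).

Definition pairing (v : 'rV[F]_n) w : F := (v *m w) 0 0.

Lemma pairingD u v w : pairing (u + v) w = pairing u w + pairing v w.
Proof. by rewrite /pairing mulmxDl mxE. Qed.
Lemma pairingZ a v w : pairing (a *: v) w = a * pairing v w.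
Proof. by rewrite /pairing -scalemxAl mxE. Qed.
Lemma pairing0 w : pairing 0 w = 0.
Proof. by rewrite /pairing mul0mx mxE. Qed.
Lemma pairingN v w : pairing (- v) w = - pairing v w.
Proof. by rewrite /pairing mulNmx mxE. Qed.
Lemma pairing_sum (J : Type) (r : seq J) P (g : J -> 'rV[F]_n) w :
  pairing (\sum_(i <- r | P i) g i) w = \sum_(i <- r | P i) pairing (g i) w.
Proof. by rewrite /pairing mulmx_suml summxE. Qed.

Lemma dominate s (a l : T -> F) : (forall i, i \in s -> 0 < l i) ->
  exists2 C, 0 < C & forall i, i \in s -> a i < C * l i.
Proof.
elim: s => [|i s IH] h; first by exists 1.
have [|C C0 hC] := IH; first by move=> j js; apply: h; rewrite inE js orbT.
have li : 0 < l i by apply: h; rewrite mem_head.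
exists (C + `|a i| / l i + 1); first by have : 0 <= `|a i| / l i; [rewrite divr_ge0 // ltW|lra].
move=> j; rewrite inE => /orP[/eqP ->|js].
  rewrite !mulrDl divfK ?gt_eqF // mul1r.
  by have := ler_norm (a i); have := mulr_gt0 C0 li; lra.
have lj : 0 < l j by apply: h; rewrite inE js orbT.
apply: lt_le_trans (hC j js) _; rewrite -addrA mulrDl lerDl.
by apply: mulr_ge0 (ltW lj); rewrite addr_ge0 // divr_ge0 // ltW.
Qed.

Lemma span_or_functional s f v : uniq s ->
  (exists a : T -> F, v = \sum_(i <- s) a i *: f i) \/
  (exists2 w, forall i, i \in s -> pairing (f i) w = 0 & 0 < pairing v w).
Proof.
move=> us; pose M := \matrix_(k < size s) f (tnth (in_tuple s) k).
have [/submxP[D eD]|] := boolP (v <= M)%MS.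
  left; exists (fun i => oapp (fun k => D 0 k) 0 (insub (index i s))).
  rewrite eD mulmx_sum_row [RHS]big_tnth; apply: eq_bigr => k _.
  rewrite rowK (tnth_nth (tnth (in_tuple s) k)) /= index_uniq //.
  by rewrite insubT //= => lk; congr (D 0 _ *: _); apply/val_inj.
rewrite submxE => /rV0Pn[c nc]; right; pose w0 := col c (cokermx M).
have e0 u : pairing u w0 = (u *m cokermx M) 0 c by rewrite /pairing /w0 colE mulmxA -colE mxE.
(* Scaling by its own value at [v] turns a nonzero value into a positive square. *)
exists (pairing v w0 *: w0) => [i si|]; rewrite /pairing -scalemxAr mxE -!/(pairing _ _) !e0.
  have li : (index i s < size s)%N by rewrite index_mem.
  have -> : f i = row (Ordinal li) M by rewrite rowK (tnth_nth i) /= nth_index.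
  by rewrite -row_mul mulmx_coker row0 [X in _ * X]mxE mulr0.
by rewrite -expr2 exprn_even_gt0.
Qed.

(* Stiemke's alternative; the induction step passes to the vectors [g i], which are
   the [f i] projected along [f a]. *)
Lemma stiemke s f : uniq s ->
  (exists2 l : T -> F, forall i, i \in s -> 0 < l i & \sum_(i <- s) l i *: f i = 0) \/
  (exists2 w, forall i, i \in s -> 0 <= pairing (f i) w & exists2 i, i \in s & 0 < pairing (f i) w).
Proof.
elim: s f => [|a s IH] f /=; first by left; exists (fun => 1); rewrite ?big_nil.
case/andP=> nas us; have ne i : i \in s -> (i == a) = false by move=> si; apply: contraNF nas => /eqP <-.
pose ext (b : F) (l : T -> F) i := if i == a then b else l i.
have ext_pos b l : 0 < b -> (forall i, i \in s -> 0 < l i) -> forall i, i \in a :: s -> 0 < ext b l i.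
  by move=> b0 l0 i; rewrite inE /ext; case: eqP => //= _; apply: l0.
have ext_sum b l : \sum_(i <- a :: s) ext b l i *: f i = b *: f a + \sum_(i <- s) l i *: f i.
  rewrite big_cons /ext eqxx; congr (_ + _); rewrite big_seq [RHS]big_seq; apply: eq_bigr => i si.
  by rewrite ne.
have [fa0|/rV0Pn[j nj]] := eqVneq (f a) 0.
  case: (IH f us) => [[l l0 le]|[w w0 [i si wi]]].
    by left; exists (ext 1 l); [apply: ext_pos|rewrite ext_sum fa0 scaler0 add0r].
  right; exists w; last by exists i => //; rewrite inE si orbT.
  by move=> k; rewrite inE => /orP[/eqP ->|]; [rewrite fa0 pairing0|apply: w0].
pose g i := f i - (f i 0 j / f a 0 j) *: f a.
case: (IH g us) => [[l l0 le]|[w w0 [i si wi]]]; last first.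
  (* Pairing with [w'] amounts to projecting along [f a] and then pairing with [w], so [w'] vanishes
     on [f a]. *)
  pose w' := w - (pairing (f a) w / f a 0 j) *: delta_mx j 0.
  have pw' u : pairing u w' = pairing (u - (u 0 j / f a 0 j) *: f a) w.
    rewrite pairingD pairingN pairingZ /pairing mulmxBr !mxE -!/(pairing _ _); congr (_ - _).
    rewrite (bigD1 j) //= big1 => [|k kj]; last by rewrite !mxE (negbTE kj) !mulr0.
    by rewrite !mxE !eqxx mulr1 addr0 /pairing mxE; field.
  right; exists w'; last by exists i; rewrite ?inE ?si ?orbT // pw'.
  move=> k; rewrite inE => /orP[/eqP ->|ks]; rewrite pw'; last exact: w0.
  by rewrite divff // scale1r subrr pairing0.
(* The relation among the projections lifts to sum_i l_i f_i = mu f_a. A negative [mu] completes it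
   to a positive relation; otherwise the induction hypothesis is used again, on the f_i
   themselves. *)
pose mu := \sum_(i <- s) l i * (f i 0 j / f a 0 j).
have lf : \sum_(i <- s) l i *: f i = mu *: f a.
  apply/eqP; rewrite -subr_eq0 /mu scaler_suml -sumrB -[X in _ == X]le; apply/eqP.
  by apply: eq_bigr => i _; rewrite /g scalerBr scalerA.
have [mu0|mu0] := ltP mu 0.
  left; exists (ext (- mu) l); first by apply: ext_pos => //; rewrite oppr_gt0.
  by rewrite ext_sum lf scaleNr addNr.
case: (IH f us) => [[l' l'0 le']|[w w0 [i si wi]]].
  case: (span_or_functional f (f a) us) => [[b eb]|[w w0 wa]]; last first.
    right; exists w; last by exists a; rewrite ?mem_head.
    by move=> k; rewrite inE => /orP[/eqP ->|/w0 ->]; [exact: ltW|].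
  (* Adding a large multiple of the positive relation makes the coefficients of the relation for
     [f a] positive. *)
  have [C C0 hC] := dominate b l'0.
  left; exists (ext 1 (fun i => C * l' i - b i)).
    by apply: ext_pos => // i si; rewrite subr_gt0; apply: hC.
  rewrite ext_sum scale1r; under eq_bigr do rewrite scalerBl -scalerA.
  by rewrite sumrB -scaler_sumr le' scaler0 sub0r -eb subrr.
(* The functional is nonnegative on the f_i and positive on one of them, hence positive on mu f_a;
   as [mu] is nonnegative, both factors are positive. *)
have mw : 0 < mu * pairing (f a) w.
  rewrite -pairingZ -lf pairing_sum (big_rem i) //= pairingZ.
  apply: ltr_wpDr; last by rewrite mulr_gt0 ?l0.
  rewrite big_seq sumr_ge0 // => k /mem_rem ks; rewrite pairingZ mulr_ge0 ?w0 //.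
  by rewrite ltW ?l0.
right; exists w; last by exists i; rewrite ?inE ?si ?orbT.
move=> k; rewrite inE => /orP[/eqP ->|]; last exact: w0.
have mu1 : 0 < mu by rewrite lt_neqAle mu0 andbT; apply: contraTneq mw => <-; rewrite mul0r ltxx.
by rewrite pmulr_rgt0 // in mw; rewrite ltW.
Qed.

End Stiemke.

Local Notation R := Rdefinitions.R.

(** * Hulls of indicator vectors, relative interiors and threshold cells *)

Section Polytope.
Variable n : nat.
Implicit Types (bs : {fset {fset nat}}) (B : {fset nat}) (v : 'rV[R]_n) (w : 'cV[R]_n).

Definition indicator B : 'rV[R]_n := \row_j (val j \in B)%:R.

Definition hull bs v := exists lam : {fset nat} -> R,
  [/\ forall B, B \in bs -> 0 <= lam B, \sum_(B <- bs) lam B = 1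
    & v = \sum_(B <- bs) lam B *: indicator B].

(** Positive weights on all of [bs] characterise the relative interior of the hull; the weights of a
    point are in general not unique. *)
Definition rel_interior bs v := exists lam : {fset nat} -> R,
  [/\ forall B, B \in bs -> 0 < lam B, \sum_(B <- bs) lam B = 1
    & v = \sum_(B <- bs) lam B *: indicator B].

Lemma rel_interior_hull bs v : rel_interior bs v -> hull bs v.
Proof. by move=> [l [l0 l1 ->]]; exists l; split=> // B Bb; apply: ltW; apply: l0. Qed.

Lemma indicator_hull bs B : B \in bs -> hull bs (indicator B).
Proof.
move=> Bb; exists (fun C => (C == B)%:R); split.
- by move=> C _; rewrite ler0n.
- rewrite (big_fsetD1 B Bb) /= eqxx big_seq big1 ?addr0 // => C.
  by rewrite !inE => /andP[/negbTE ->].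
- rewrite (big_fsetD1 B Bb) /= eqxx scale1r big_seq big1 ?addr0 // => C.
  by rewrite !inE => /andP[/negbTE ->]; rewrite scale0r.
Qed.

Lemma rel_interior_nonempty bs : bs != fset0 -> exists v, rel_interior bs v.
Proof.
move=> bs0; have c0 : (0 : R) < #|` bs|%:R by rewrite ltr0n cardfs_gt0.
exists (\sum_(B <- bs) (#|` bs|%:R^-1) *: indicator B), (fun => #|` bs|%:R^-1); split=> //.
  by move=> B _; rewrite invr_gt0.
rewrite big_const_seq count_predT iter_addr addr0 -[RHS](mulVf (lt0r_neq0 c0)).
by rewrite mulr_natr.
Qed.

Lemma pairing_mix bs (lam : {fset nat} -> R) w :
  pairing (\sum_(B <- bs) lam B *: indicator B) w = \sum_(B <- bs) lam B * pairing (indicator B) w.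
Proof. by rewrite pairing_sum; apply: eq_bigr => B _; rewrite pairingZ. Qed.

Lemma hull_pairing_le bs v w c :
  (forall B, B \in bs -> pairing (indicator B) w <= c) -> hull bs v -> pairing v w <= c.
Proof.
move=> h [l [l0 l1 ->]]; rewrite pairing_mix -[c]mul1r -l1 mulr_suml big_seq [X in _ <= X]big_seq.
by apply: ler_sum => B Bb; apply: ler_wpM2l; [apply: l0|apply: h].
Qed.

Lemma hull_pairing_eq bs v w c :
  (forall B, B \in bs -> pairing (indicator B) w = c) -> hull bs v -> pairing v w = c.
Proof.
move=> h [l [l0 l1 ->]]; rewrite pairing_mix -[c]mul1r -l1 mulr_suml big_seq [RHS]big_seq.
by apply: eq_bigr => B Bb; rewrite h.
Qed.

(** The defects c - <e_B, w> are nonnegative, and a combination of them with positive coefficients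
    is zero, so each is zero. *)
Lemma rel_interior_max bs v w c :
  (forall u, hull bs u -> pairing u w <= c) -> rel_interior bs v -> pairing v w = c ->
  forall u, hull bs u -> pairing u w = c.
Proof.
move=> hc [l [l0 l1 ev]] vc; suff h B : B \in bs -> pairing (indicator B) w = c.
  by move=> u; apply: hull_pairing_eq.
move=> Bb; have hB C : C \in bs -> 0 <= l C * (c - pairing (indicator C) w).
  move=> Cb; rewrite mulr_ge0 ?(ltW (l0 _ Cb)) // subr_ge0; apply: hc; exact: indicator_hull.
have : \sum_(C <- bs) l C * (c - pairing (indicator C) w) = 0.
  under eq_bigr do rewrite mulrBr.
  by rewrite sumrB -mulr_suml l1 mul1r -pairing_mix -ev vc subrr.
rewrite (big_fsetD1 B Bb) /= => e0.
have : l B * (c - pairing (indicator B) w) = 0.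
  apply: le_anti; rewrite hB // andbT -e0 lerDl big_seq sumr_ge0 // => C.
  by rewrite !inE => /andP[_]; apply: hB.
by move/eqP; rewrite mulf_eq0 gt_eqF ?l0 //= subr_eq0 => /eqP.
Qed.

(** Stiemke for the vectors v - e_B: a positive relation, divided by its total weight, would place
    [v] in the relative interior; the alternative is a functional maximal at [v] and not constant,
    that is a proper face through [v]. *)
Lemma hull_separation bs v : hull bs v -> ~ rel_interior bs v ->
  exists w, (forall u, hull bs u -> pairing u w <= pairing v w) /\
    exists2 B, B \in bs & pairing (indicator B) w < pairing v w.
Proof.
move=> [m [m0 m1 ev]] nrel.
case: (stiemke (fun B => v - indicator B) (fset_uniq bs)) => [[l l0 le]|[w w0 [B Bb wB]]].
  case: nrel; pose L := \sum_(B <- bs) l B.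
  have L0 : 0 < L.
    have [B Bb] : exists B, B \in bs.
      apply/fset0Pn; apply/negP => /eqP b0; move: m1; rewrite b0 big_nil => /eqP.
      by rewrite eq_sym oner_eq0.
    rewrite /L (big_fsetD1 B Bb) /=; apply: ltr_wpDr; last exact: l0.
    by rewrite big_seq sumr_ge0 // => C; rewrite !inE => /andP[_ Cb]; apply: ltW; apply: l0.
  have Lv : L *: v = \sum_(B <- bs) l B *: indicator B.
    apply/eqP; rewrite -subr_eq0 /L scaler_suml -sumrB -[X in _ == X]le; apply/eqP.
    by apply: eq_bigr => B _; rewrite scalerBr.
  exists (fun B => L^-1 * l B); split.
  - by move=> B Bb; rewrite mulr_gt0 ?invr_gt0 // l0.
  - by rewrite -mulr_sumr mulVf // gt_eqF.
  - under eq_bigr do rewrite -scalerA.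
    by rewrite -scaler_sumr -Lv scalerA mulVf ?scale1r // gt_eqF.
exists w; split; last by exists B => //; move: wB; rewrite pairingD pairingN subr_gt0.
move=> u; apply: hull_pairing_le => C Cb; have := w0 C Cb.
by rewrite pairingD pairingN subr_ge0.
Qed.

(** Vertices of the cube are extreme: a set of positive weight must agree with [B] in every
    coordinate. Thus a family of bases can be recovered from its hull. *)
Lemma hull_indicator_mem bs B : (forall C, C \in bs -> forall e, e \in C -> (e < n)%N) ->
  (forall e, e \in B -> (e < n)%N) -> hull bs (indicator B) -> B \in bs.
Proof.
move=> bn Bn [l [l0 l1 eB]].
have [C Cb lC] : exists2 C, C \in bs & 0 < l C.
  apply: contrapT => h; suff : \sum_(B <- bs) l B = 0 by rewrite l1 => /eqP; rewrite oner_eq0.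
  rewrite big_seq big1 // => C Cb; apply: le_anti; rewrite l0 // andbT leNgt; apply/negP => lC.
  by apply: h; exists C.
suff -> : B = C by [].
have hj (j : 'I_n) : (val j \in B)%:R = \sum_(C <- bs) l C * (val j \in C)%:R :> R.
  have := congr1 (fun v : 'rV[R]_n => v 0 j) eB; rewrite mxE summxE => ->.
  by apply: eq_bigr => D _; rewrite !mxE.
have key (j : 'I_n) : (val j \in C) = (val j \in B).
  have := hj j; case jB: (_ \in B) => e; last first.
    apply/negP => jC; have : 0 < \sum_(C <- bs) l C * (val j \in C)%:R.
      rewrite (big_fsetD1 C Cb) /= jC mulr1; apply: ltr_wpDr => //.
      by rewrite big_seq sumr_ge0 // => D; rewrite !inE => /andP[_ Db]; rewrite mulr_ge0 ?l0 ?ler0n.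
    by rewrite -e ltxx.
  apply: contraT => jC; have : 0 < \sum_(D <- bs) l D * (1 - (val j \in D)%:R).
    rewrite (big_fsetD1 C Cb) /= (negbTE jC) subr0 mulr1; apply: ltr_wpDr => //.
    rewrite big_seq sumr_ge0 // => D; rewrite !inE => /andP[_ Db]; rewrite mulr_ge0 ?l0 //.
    by rewrite subr_ge0 lern1 leq_b1.
  under eq_bigr do rewrite mulrBr mulr1.
  by rewrite sumrB l1 -e subrr ltxx.
apply/fsetP => e; apply/idP/idP => eh.
  by have := key (Ordinal (Bn _ eh)); rewrite /= => ->.
by have := key (Ordinal (bn _ Cb _ eh)); rewrite /= => <-.
Qed.

Definition directions bs : 'M[R]_n :=
  (\sum_(p : bs * bs) <<indicator (val p.1) - indicator (val p.2)>>)%MS.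

Lemma directionsP bs v : (v <= directions bs)%MS <->
  exists2 nu : {fset nat} -> R, \sum_(B <- bs) nu B = 0 & v = \sum_(B <- bs) nu B *: indicator B.
Proof.
split=> [/sub_sumsmxP[u ->]|[nu nu0 ->]].
  elim/big_ind: _ => [|x y [a a0 ->] [b b0 ->]|p _].
  - by exists (fun => 0); rewrite big1 // => B _; rewrite scale0r.
  - exists (fun B => a B + b B); first by rewrite big_split /= a0 b0 addr0.
    by rewrite -big_split; apply: eq_bigr => B _; rewrite scalerDl.
  have /sub_rVP[a ->] : (u p *m <<indicator (val p.1) - indicator (val p.2)>> <=
      (indicator (val p.1) - indicator (val p.2) : 'rV[R]_n))%MS.
    by rewrite -(genmxE (indicator _ - _)); apply: submxMl.
  have one B (Bb : B \in bs) : \sum_(C <- bs) (a * (C == B)%:R) *: indicator C = a *: indicator B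
      /\ \sum_(C <- bs) a * (C == B)%:R = a.
    rewrite !(big_fsetD1 B Bb) /= eqxx mulr1.
    rewrite [X in _ *: _ + X]big_seq [X in _ *: _ + X]big1; last first.
      by move=> C; rewrite !inE => /andP[/negbTE ->]; rewrite mulr0 scale0r.
    rewrite [X in _ /\ _ + X = _]big_seq [X in _ /\ _ + X = _]big1 ?addr0 // => C.
    by rewrite !inE => /andP[/negbTE ->]; rewrite mulr0.
  have [s1 s2] := one _ (valP p.1); have [t1 t2] := one _ (valP p.2).
  exists (fun C => a * (C == val p.1)%:R - a * (C == val p.2)%:R).
    by rewrite sumrB s2 t2 subrr.
  under eq_bigr do rewrite scalerBl.
  by rewrite sumrB s1 t1 scalerBr.
have [->|/fset0Pn[B0 B0b]] := eqVneq bs fset0; first by rewrite big_nil sub0mx.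
have -> : \sum_(B <- bs) nu B *: indicator B = \sum_(B <- bs) nu B *: (indicator B - indicator B0).
  under [RHS]eq_bigr do rewrite scalerBr.
  by rewrite sumrB -scaler_suml nu0 scale0r subr0.
rewrite big_seq; apply: summx_sub => B Bb; apply: scalemx_sub.
have -> : indicator B - indicator B0 = indicator (val [` Bb]) - indicator (val [` B0b]) by [].
rewrite -(genmxE (indicator _ - _)).
by apply: (sumsmx_sup ([` Bb], [` B0b])).
Qed.

Lemma hull_directions bs u v : hull bs u -> hull bs v -> (u - v <= directions bs)%MS.
Proof.
move=> [l [_ l1 ->]] [m [_ m1 ->]]; apply/directionsP; exists (fun B => l B - m B).
  by rewrite sumrB l1 m1 subrr.
by rewrite -sumrB; apply: eq_bigr => B _; rewrite scalerBl.
Qed.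

Lemma rel_interior_open bs z v : rel_interior bs z -> (v <= directions bs)%MS ->
  exists2 e, 0 < e & forall d, `|d| <= e -> rel_interior bs (z + d *: v).
Proof.
move=> [l [l0 l1 ->]] /directionsP[nu nu0 ->].
have [C C0 hC] := dominate (fun B => `|nu B|) l0.
exists C^-1; first by rewrite invr_gt0.
move=> d hd; exists (fun B => l B + d * nu B); split.
- move=> B Bb; have h : `|d * nu B| < l B.
    rewrite normrM; apply: le_lt_trans (ler_wpM2r (normr_ge0 _) hd) _.
    by rewrite mulrC ltr_pdivrMr // mulrC hC.
  by move: h; rewrite ltr_norml => /andP[h _]; rewrite -ltrBlDl sub0r ltrNl; lra.
- by rewrite big_split /= -mulr_sumr nu0 mulr0 addr0.
- rewrite scaler_sumr -big_split; apply: eq_bigr => B _.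
  by rewrite scalerDl scalerA.
Qed.

Lemma rel_interior_convex bs x y t : rel_interior bs x -> hull bs y -> 0 <= t < 1 ->
  rel_interior bs (x + t *: (y - x)).
Proof.
move=> [l [l0 l1 ->]] [m [m0 m1 ->]] /andP[t0 t1].
exists (fun B => (1 - t) * l B + t * m B); split.
- move=> B Bb; apply: ltr_wpDr; first by rewrite mulr_ge0 ?m0.
  by rewrite mulr_gt0 ?l0 // subr_gt0.
- by rewrite big_split /= -!mulr_sumr l1 m1 !mulr1 subrK.
- rewrite -sumrB scaler_sumr -big_split; apply: eq_bigr => B _ /=.
  by rewrite scalerDl -!scalerA scalerBl scale1r scalerBr [_ *: _ - _]addrC addrA.
Qed.

Lemma hull_bounded bs v j : hull bs v -> 0 <= v 0 j <= 1.
Proof.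
move=> [l [l0 l1 ->]]; rewrite summxE; apply/andP; split.
  by rewrite big_seq sumr_ge0 // => B Bb; rewrite !mxE mulr_ge0 ?l0 ?ler0n.
rewrite -l1 big_seq [X in _ <= X]big_seq; apply: ler_sum => B Bb; rewrite !mxE.
by rewrite ler_piMr ?l0 // lern1 leq_b1.
Qed.

(* The functional [v |-> \sum_(j in A) v_j], whose maximum over a base polytope is the rank of [A]. *)
Definition count_dir (A : {fset nat}) : 'cV[R]_n := \col_j (val j \in A)%:R.

(** As ranks are integers, a bound lowered by 1/2 still separates r >= s from r < s, while the
    strict inequality is an open condition that relative interior points can meet even when r =
    s. *)
Definition threshold_cell bs (Ts : seq ({fset nat} * nat)) v :=
  rel_interior bs v /\ forall T, T \in Ts -> T.2%:R - 2^-1 < pairing v (count_dir T.1).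

Lemma threshold_cell_open bs Ts : open_cell (threshold_cell bs Ts) (directions bs).
Proof.
split.
- by move=> x y [Dx _] [Dy _]; apply: hull_directions; apply: rel_interior_hull.
- move=> z v [Dz Tz] vA; have [e e0 he] := rel_interior_open Dz vA.
  have [C C0 hC] := @dominate R _ Ts (fun T => `|pairing v (count_dir T.1)|)
    (fun T => pairing z (count_dir T.1) - (T.2%:R - 2^-1)) (fun T TT => etrans (subr_gt0 _ _) (Tz T TT)).
  exists (Num.min e C^-1); first by rewrite lt_min e0 invr_gt0.
  move=> d; rewrite le_min => /andP[de dC]; split; first exact: he.
  move=> T TT; rewrite pairingD pairingZ; set p := pairing v _; set q := pairing z _.
  have h : `|d * p| < q - (T.2%:R - 2^-1).
    rewrite normrM; apply: le_lt_trans (ler_wpM2r (normr_ge0 _) dC) _.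
    by rewrite mulrC ltr_pdivrMr // mulrC hC.
  by move: h; rewrite ltr_norml => /andP[h _]; lra.
- move=> x y t [Dx Tx] [Dy Ty] /andP[t0 t1]; split.
    have [->|nt] := eqVneq t 1; first by rewrite scale1r addrC subrK.
    by apply: rel_interior_convex => //; [apply: rel_interior_hull|rewrite t0 lt_neqAle nt].
  move=> T TT; rewrite pairingD pairingZ pairingD pairingN.
  have := Tx T TT; have := Ty T TT; set p := pairing x _; set q := pairing y _ => h1 h2.
  have : (1 - t) * (T.2%:R - 2^-1) + t * (T.2%:R - 2^-1) < (1 - t) * p + t * q.
    have [->|nt] := eqVneq t 1; first by rewrite subrr !mul0r !add0r !mul1r.
    apply: ltr_leD; first by rewrite ltr_pM2l // subr_gt0 lt_neqAle nt.
    by apply: ler_wpM2l => //; apply: ltW.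
  by lra.
- exists 1 => x j [/rel_interior_hull h _]; have /andP[h0 h1] := hull_bounded j h.
  by rewrite ger0_norm.
Qed.

Lemma pairing_indicator B A : (forall e, e \in B -> (e < n)%N) ->
  pairing (indicator B) (count_dir A) = #|` A `&` B|%:R.
Proof.
move=> Bn; rewrite /pairing mxE.
have -> : #|` A `&` B| = (\sum_(0 <= i < n) ((i \in A) && (i \in B) : nat))%N.
  rewrite -big_mkcond sum1_count -size_filter /=; apply: perm_size.
  apply: uniq_perm; rewrite ?filter_uniq ?fset_uniq ?iota_uniq // => e.
  rewrite mem_filter mem_index_iota -[e \in enum_fset _]/(e \in A `&` B) !inE.
  by case eB: (e \in B); rewrite ?andbF // Bn ?andbT.
rewrite natr_sum big_mkord; apply: eq_bigr => j _; rewrite !mxE.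
by rewrite -natrM mulnb andbC.
Qed.

Lemma pairing_count_ge0 bs v A : hull bs v -> 0 <= pairing v (count_dir A).
Proof.
move=> hv; rewrite /pairing mxE sumr_ge0 // => j _; rewrite mxE mulr_ge0 ?ler0n //.
by have /andP[] := hull_bounded j hv.
Qed.

Lemma threshold_cell_nonempty (M : matroid) Ts : is_matroid M ->
  (forall B, B \in bases M -> forall e, e \in B -> (e < n)%N) ->
  fchain [seq T.1 | T <- Ts] ->
  (exists v, threshold_cell (bases M) Ts v) <-> all (fun T => T.2 <= mrank M T.1)%N Ts.
Proof.
move=> hM bn ch; split=> [[v [hv Tv]]|/allP h].
  apply/allP => T TT; have := Tv T TT.
  have : pairing v (count_dir T.1) <= (mrank M T.1)%:R.
    apply: hull_pairing_le (rel_interior_hull hv) => B Bb.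
    by rewrite pairing_indicator ?ler_nat ?mrank_ge //; apply: bn.
  move=> h1 h2; have h3 := lt_le_trans h2 h1.
  rewrite leqNgt; apply/negP => lt.
  have : (mrank M T.1)%:R + 1 <= T.2%:R :> R by rewrite natr1 ler_nat.
  by lra.
have [B Bb hB] := mrank_chain_basis hM ch.
have [|z hz] := rel_interior_nonempty (bs := bases M); first by case: hM.
(* From an interior point one goes the fraction 1 - e of the way to the vertex of a basis attaining
   all the ranks. With e = 1 / (2 (N + 1)) and every threshold at most [N], the loss e T.2 is below
   1/2. *)
pose N := (\sum_(T <- Ts) T.2)%N; pose e : R := (2 * N.+1%:R)^-1.
have N0 : (0 : R) < N.+1%:R by rewrite ltr0Sn.
have e0 : 0 < e by rewrite invr_gt0; lra.
have e1 : e <= 1.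
  by rewrite invf_le1; [rewrite -natrM ler1n|lra].
exists (z + (1 - e) *: (indicator B - z)); split.
  by apply: rel_interior_convex => //; [apply: indicator_hull|apply/andP; split; lra].
move=> T TT; rewrite pairingD pairingZ pairingD pairingN pairing_indicator; last exact: bn.
rewrite hB; last exact: map_f.
have p0 := pairing_count_ge0 T.1 (rel_interior_hull hz); set p := pairing z _ in p0 *.
have hT : T.2%:R <= (mrank M T.1)%:R :> R by rewrite ler_nat h.
have lN : (T.2 <= N)%N by rewrite /N (big_rem T TT) /= leq_addr.
have h2 : e * T.2%:R < 2^-1.
  apply: le_lt_trans (_ : e * N%:R < _); first by rewrite ler_pM2l // ler_nat.
  have -> : 2^-1 = e * N.+1%:R by rewrite /e invfM -mulrA mulVf ?mulr1 // lt0r_neq0.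
  by rewrite ltr_pM2l // ltr_nat.
have h3 : (1 - e) * T.2%:R <= (1 - e) * (mrank M T.1)%:R by apply: ler_wpM2l => //; lra.
have h4 : 0 <= e * p by apply: mulr_ge0 => //; apply: ltW.
by lra.
Qed.

End Polytope.

(** * Convex hulls of bases and their dimension *)

Section Points.
Variable n : nat.
Implicit Types (bs : {fset {fset nat}}) (B E : {fset nat}) (v : 'rV[R]_n) (x : point).

Definition point_of v : point := fun i => oapp (fun j => v 0 j) 0 (insub i).
Definition vector_of x : 'rV[R]_n := \row_j x (val j).

Lemma point_of_val v (j : 'I_n) : point_of v (val j) = v 0 j.
Proof. by rewrite /point_of valK. Qed.

Lemma point_of_ge v i : (n <= i)%N -> point_of v i = 0.
Proof. by move=> h; rewrite /point_of insubF // ltnNge h. Qed.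

Definition bounded_sets bs := forall B, B \in bs -> forall e, e \in B -> (e < n)%N.

Lemma conv_basesP bs x : conv_bases bs x <-> exists lam : {fset nat} -> R,
  [/\ forall B, B \in bs -> 0 <= lam B, \sum_(B <- bs) lam B = 1 &
      forall i, x i = \sum_(B <- bs) lam B * (i \in B)%:R].
Proof.
have e i (lam : {fset nat} -> R) :
   \sum_(B <- bs) lam B * (i \in B)%:R = \big[Rdefinitions.Rplus/Rdefinitions.R0]_(B <- bs)
     (Rdefinitions.Rmult (lam B) (if i \in B then Rdefinitions.R1 else Rdefinitions.R0)).
  by apply: eq_bigr => B _; case: (i \in B).
split=> -[lam [l0 l1 lx]]; exists lam; split=> //.
- by move=> B Bb; apply/RleP; apply: l0.
- by move=> i; rewrite lx e.
- by move=> B Bb; apply/RleP; apply: l0.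
- by move=> i; rewrite lx e.
Qed.

Lemma conv_bases_point bs v : bounded_sets bs -> conv_bases bs (point_of v) <-> hull bs v.
Proof.
move=> bn; rewrite conv_basesP; split=> -[lam [l0 l1 lx]]; exists lam; split=> //.
  apply/rowP => j; rewrite -point_of_val lx summxE; apply: eq_bigr => B _.
  by rewrite !mxE.
move=> i; have [lt|le] := ltnP i n.
  rewrite -[i]/(val (Ordinal lt)) point_of_val lx summxE; apply: eq_bigr => B _.
  by rewrite !mxE.
rewrite point_of_ge // big_seq big1 // => B Bb.
by case iB: (i \in B); rewrite ?mulr0 //; have := bn B Bb i iB; rewrite ltnNge le.
Qed.

Lemma conv_bases_vector bs x : bounded_sets bs -> conv_bases bs x -> x = point_of (vector_of x).
Proof.
move=> bn /conv_basesP[lam [l0 l1 lx]]; apply/funext => i.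
have [lt|le] := ltnP i n.
  by rewrite -[i]/(val (Ordinal lt)) point_of_val mxE.
rewrite point_of_ge // lx big_seq big1 // => B Bb.
by case iB: (i \in B); rewrite ?mulr0 //; have := bn B Bb i iB; rewrite ltnNge le.
Qed.

Lemma conv_basesE bs x : bounded_sets bs ->
  conv_bases bs x <-> exists2 v, hull bs v & x = point_of v.
Proof.
move=> bn; split=> [cx|[v hv ->]]; last exact/conv_bases_point.
have ex := conv_bases_vector bn cx; exists (vector_of x) => //.
by apply/(conv_bases_point _ bn); rewrite -ex.
Qed.

Lemma dotE_pairing E bs w v : (forall e, e \in E -> (e < n)%N) ->
  (forall B, B \in bs -> B `<=` E) -> hull bs v ->
  dotE E w (point_of v) = pairing v (\col_j w (val j)).
Proof.
move=> En BE hv; have v0 (j : 'I_n) : val j \notin E -> v 0 j = 0.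
  case: hv => l [_ _ ->] jE; rewrite summxE big_seq big1 // => B Bb; rewrite !mxE.
  by rewrite (negbTE (contra (fsubsetP (BE B Bb) _) jE)) mulr0.
rewrite /dotE -[LHS]/(\sum_(i <- E) w i * point_of v i) /pairing mxE.
have -> : \sum_(i <- E) w i * point_of v i = \sum_(0 <= i < n | i \in E) w i * point_of v i.
  rewrite -[RHS]big_filter; apply: perm_big; apply: uniq_perm; rewrite ?filter_uniq ?fset_uniq ?iota_uniq //.
  move=> e; rewrite mem_filter mem_index_iota -[e \in enum_fset _]/(e \in E).
  by case eE: (e \in E); rewrite // En.
rewrite big_mkord big_mkcond; apply: eq_bigr => j _ /=; rewrite point_of_val mxE.
by case: ifP => [_|/negbT/v0 ->]; rewrite ?mul0r // mulrC.
Qed.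

Definition functional_of (w : 'cV[R]_n) : point := fun i => oapp (fun j => w j 0) 0 (insub i).

Lemma functional_ofK w : \col_j functional_of w (val j) = w.
Proof. by apply/matrixP => j k; rewrite ord1 mxE /functional_of valK. Qed.

Section Dimension.
Variable bs : {fset {fset nat}}.
Hypotheses (bn : bounded_sets bs) (bs0 : bs != fset0).

Lemma aff_indep_le ps k : size ps = k.+1 -> all_in (conv_bases bs) ps -> aff_indep ps ->
  (k <= \rank (directions n bs))%N.
Proof.
move=> sz inps ind; pose p i := vector_of (nth (fun _ => Rdefinitions.R0) ps i).
have hp i : (i < k.+1)%N -> hull bs (p i) /\ nth (fun _ => Rdefinitions.R0) ps i = point_of (p i).
  rewrite -sz => li; have ci := inps i li; have ei := conv_bases_vector bn ci.
  by split=> //; apply/(conv_bases_point _ bn); rewrite -ei.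
pose P := \matrix_(i < k) (p i.+1 - p 0%N).
have PA : (P <= directions n bs)%MS.
  apply/row_subP => i; rewrite rowK; apply: hull_directions; first exact: (hp i.+1 (ltn_ord i)).1.
  exact: (hp 0%N isT).1.
apply: leq_trans (mxrankS PA); rewrite leqNgt; apply/negP => lt.
have : kermx P != 0 by rewrite -mxrank_eq0 mxrank_ker subn_eq0 -ltnNge.
case/rowV0Pn => x /sub_kermxP xP /eqP; apply; apply/rowP => i; rewrite mxE.
(* A relation among the differences becomes an affine relation when the first point receives minus
   the total. *)
pose c := - (\sum_(j < k) x 0 j) :: [seq x 0 j | j <- enum 'I_k].
have cn (j : 'I_k) : nth Rdefinitions.R0 c j.+1 = x 0 j.
  by rewrite /= (nth_map j) ?size_enum_ord // nth_ord_enum.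
rewrite -cn; apply: ind; last by rewrite sz ltnS.
- by rewrite /= size_map size_enum_ord sz.
- rewrite sz -[LHS]/(\sum_(j < k.+1) nth Rdefinitions.R0 c j) big_ord_recl.
  under eq_bigr do rewrite cn.
  by rewrite /= addNr.
- move=> j; rewrite sz -[LHS]/(\sum_(i < k.+1) nth Rdefinitions.R0 c i * nth (fun _ => Rdefinitions.R0) ps i j).
  have [lt'|le'] := ltnP j n; last first.
    by rewrite big1 // => l _; rewrite (hp l _).2 // point_of_ge // mulr0.
  rewrite -[j]/(val (Ordinal lt')); under eq_bigr => l _ do rewrite (hp l (ltn_ord l)).2 point_of_val.
  rewrite big_ord_recl; under eq_bigr do rewrite cn.
  have hs : \sum_(l < k) x 0 l * p l.+1 0 (Ordinal lt') - (\sum_(l < k) x 0 l) * p 0%N 0 (Ordinal lt') = 0.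
    have xP0 : (x *m P) 0 (Ordinal lt') = 0 by rewrite xP mxE.
    rewrite mulr_suml -sumrB -[RHS]xP0 [RHS]mxE; apply: eq_bigr => l _.
    by rewrite -mulrBr; congr (_ * _); rewrite !mxE.
  move/eqP: hs; rewrite subr_eq0 => /eqP hs.
  have -> : \sum_(i < k) x 0 i * p (lift ord0 i) 0 (Ordinal lt') = \sum_(l < k) x 0 l * p l.+1 0 (Ordinal lt') by [].
  by rewrite hs mulNr addNr.
Qed.

(** The points are an interior point and small steps from it along a basis of the direction
    space. *)
Lemma aff_indep_ex k : (k <= \rank (directions n bs))%N ->
  exists ps, [/\ size ps = k.+1, all_in (conv_bases bs) ps & aff_indep ps].
Proof.
move=> lek; have [z hz] := rel_interior_nonempty n bs0; set A := directions n bs in lek.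
pose d (i : nat) : 'rV[R]_n := if insub i is Some j then row j (row_base A) else 0.
have dA i : (d i <= A)%MS.
  rewrite /d; case: insub => [j|]; last exact: sub0mx.
  by apply: submx_trans (row_sub _ _) _; rewrite eq_row_base.
have he i : exists2 e, 0 < e & rel_interior bs (z + e *: d i).
  have [e e0 h] := rel_interior_open hz (dA i); exists e => //.
  by apply: h; rewrite ger0_norm // ltW.
pose e i := projT1 (cid2 (he i)).
have e0 i : 0 < e i by rewrite /e; case: cid2.
have hq i : rel_interior bs (z + e i *: d i) by rewrite /e; case: cid2.
pose ps := point_of z :: [seq point_of (z + e i *: d i) | i <- iota 0 k].
have psn i : (i < k)%N -> nth (fun _ => Rdefinitions.R0) ps i.+1 = point_of (z + e i *: d i).
  by move=> ik; rewrite /= (nth_map 0%N) ?size_iota // nth_iota.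
have sz : size ps = k.+1 by rewrite /= size_map size_iota.
exists ps; split=> //.
  rewrite /all_in sz => -[_|i ik].
    by apply/(conv_bases_point _ bn); apply: rel_interior_hull.
  by rewrite psn //; apply/(conv_bases_point _ bn); apply: rel_interior_hull.
move=> c; rewrite sz => szc c0 cp.
have {}c0 : \sum_(i < k.+1) nth Rdefinitions.R0 c i = 0 := c0.
have {}cp j : \sum_(i < k.+1) nth Rdefinitions.R0 c i * nth (fun _ => Rdefinitions.R0) ps i j = 0 := cp j.
have cd : \sum_(i < k) (nth Rdefinitions.R0 c i.+1 * e i) *: d i = 0.
  apply/rowP => j; rewrite summxE [RHS]mxE -[RHS](cp (val j)) big_ord_recl.
  have -> : nth (fun _ => Rdefinitions.R0) ps (ord0 : 'I_k.+1) (val j) = z 0 j by exact: point_of_val.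
  have -> : \sum_(i < k) nth Rdefinitions.R0 c (lift ord0 i) * nth (fun _ => Rdefinitions.R0) ps (lift ord0 i) (val j) =
     (\sum_(i < k) nth Rdefinitions.R0 c i.+1) * z 0 j + \sum_(i < k) nth Rdefinitions.R0 c i.+1 * (e i * d i 0 j).
    rewrite mulr_suml -big_split; apply: eq_bigr => i _.
    have -> : nth (fun _ => Rdefinitions.R0) ps (lift ord0 i) = point_of (z + e i *: d i).
      exact: psn (ltn_ord i).
    by rewrite point_of_val !mxE mulrDr.
  rewrite addrA -mulrDl.
  have -> : nth Rdefinitions.R0 c (ord0 : 'I_k.+1) + \sum_(i < k) nth Rdefinitions.R0 c i.+1 = 0.
    by rewrite -[RHS]c0 big_ord_recl.
  by rewrite mul0r add0r; apply: eq_bigr => i _; rewrite mxE mulrA.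
have ci i : (i < k)%N -> nth Rdefinitions.R0 c i.+1 = 0.
  move=> ik; have ilt : (i < \rank A)%N by apply: leq_trans lek.
  pose y : 'rV[R]_(\rank A) := \row_l (if (l < k)%N then nth Rdefinitions.R0 c l.+1 * e l else 0).
  have yA : y *m row_base A = 0.
    rewrite mulmx_sum_row -[RHS]cd (big_ord_widen _ (fun i => (nth Rdefinitions.R0 c i.+1 * e i) *: d i) lek).
    rewrite [RHS]big_mkcond; apply: eq_bigr => l _; rewrite mxE /d valK /=.
    by case: ifP => _ //; rewrite scale0r.
  have : y = 0.
    by apply: (row_free_inj (row_base_free A)); rewrite yA mul0mx.
  move/rowP/(_ (Ordinal ilt)); rewrite !mxE /= ik => /eqP.
  by rewrite mulf_eq0 [e i == 0]gt_eqF // orbF => /eqP.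
case=> [_|i ik]; last exact: ci.
move: c0; rewrite big_ord_recl big1 ?addr0 // => i _; exact: ci.
Qed.

Lemma pdim_rank : pdim (conv_bases bs) = \rank (directions n bs).
Proof.
have : has_dim (conv_bases bs) (pdim (conv_bases bs)).
  apply: ClassicalEpsilon.epsilon_spec; exists (\rank (directions n bs)); split.
    exact: aff_indep_ex.
  by move=> [ps [sz inps ind]]; have := aff_indep_le sz inps ind; rewrite ltnn.
move: (pdim _) => d [[ps [sz inps ind]] max]; apply/eqP; rewrite eqn_leq (aff_indep_le sz) //=.
by rewrite leqNgt; apply/negP => lt; apply: max; apply: aff_indep_ex.
Qed.
End Dimension.
End Points.

(** * Matroid subdivisions *)

Section Subdivision.
Variables (M : matroid) (S : {fset {fset {fset nat}}}).
Hypotheses (hM : is_matroid M) (hS : matroid_subdivision M S).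
Implicit Types (bs : {fset {fset nat}}) (B : {fset nat}) (x : point).
Local Notation E := (ground M).
Local Notation n := (\max_(e <- E) e).+1.
Implicit Types (v : 'rV[R]_n) (w : 'cV[R]_n).

Let En e : e \in E -> (e < n)%N.
Proof. by move=> eE; rewrite ltnS; apply: (leq_bigmax_seq (P := xpredT) (F := id) e eE). Qed.

Let cell_matroid bs : bs \in S -> is_matroid (Matroid E bs).
Proof. by case: hS => h _ _ _; apply: h. Qed.

Let cell_sub bs B : bs \in S -> B \in bs -> B `<=` E.
Proof. by move=> /cell_matroid[_ _ h _]; apply: h. Qed.

Let bases_sub B : B \in bases M -> B `<=` E. Proof. by case: hM => _ _ h _; apply: h. Qed.

Let cell_nonempty bs : bs \in S -> bs != fset0. Proof. by move=> /cell_matroid[]. Qed.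

Let bases_nonempty : bases M != fset0. Proof. by case: hM. Qed.

Let cell_bounded bs : bs \in S -> bounded_sets n bs.
Proof. by move=> bsS B Bb e eB; apply: En; apply: (fsubsetP (cell_sub bsS Bb)). Qed.

Let bases_bounded : bounded_sets n (bases M).
Proof. by move=> B Bb e eB; apply: En; apply: (fsubsetP (bases_sub Bb)). Qed.

Let cell_dot bs (w : point) v : bs \in S -> hull bs v ->
  dotE E w (point_of v) = pairing v (\col_j w (val j)).
Proof. by move=> bsS; apply: dotE_pairing => // B; apply: cell_sub. Qed.

Let bases_dot (w : point) v : hull (bases M) v -> dotE E w (point_of v) = pairing v (\col_j w (val j)).
Proof. by apply: dotE_pairing => // B; apply: bases_sub. Qed.

Let cell_hull bs v : bs \in S -> hull bs v -> hull (bases M) v.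
Proof.
move=> bsS hv; apply/(conv_bases_point _ bases_bounded).
case: hS => _ _ _ /(_ (point_of v)) h; apply/h; exists bs => //.
by apply/(conv_bases_point _ (cell_bounded bsS)).
Qed.

(** A functional that is maximal at a relative interior point is constant on the cell. *)
Let cell_face_whole bs v F : bs \in S -> rel_interior bs v -> is_face E (conv_bases bs) F ->
  F (point_of v) -> forall x, conv_bases bs x -> F x.
Proof.
move=> bsS rv [w [c [hle hF]]] /hF[_ vc] x /[dup] cx /(conv_basesE _ (cell_bounded bsS))[u hu ex].
apply/hF; split=> //; rewrite ex (cell_dot _ bsS hu).
have hc (u' : 'rV[R]_n) : hull bs u' -> pairing u' (\col_j w (val j)) <= c.
  move=> hu'; rewrite -(cell_dot _ bsS hu'); apply/RleP; apply: hle.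
  by apply/(conv_bases_point _ (cell_bounded bsS)).
apply: (rel_interior_max hc rv) => //.
by rewrite -(cell_dot _ bsS) //; apply: rel_interior_hull.
Qed.

(** The intersection is a face of both cells and meets both relative interiors, so it equals both
    hulls; and the hull determines the bases. *)
Lemma cell_unique bs1 bs2 v : bs1 \in S -> bs2 \in S ->
  rel_interior bs1 v -> rel_interior bs2 v -> bs1 = bs2.
Proof.
move=> b1 b2 r1 r2.
have c1 : conv_bases bs1 (point_of v).
  by apply/(conv_bases_point _ (cell_bounded b1)); apply: rel_interior_hull.
have c2 : conv_bases bs2 (point_of v).
  by apply/(conv_bases_point _ (cell_bounded b2)); apply: rel_interior_hull.
case: hS => _ _ /(_ bs1 bs2 b1 b2) /= [h|[f1 f2]] _; first by case: h; exists (point_of v).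
have h1 := cell_face_whole b1 r1 f1 (conj c1 c2).
have h2 := cell_face_whole b2 r2 f2 (conj c1 c2).
have sub bs bs' B : bs \in S -> bs' \in S -> (forall x, conv_bases bs x -> conv_bases bs' x) ->
    B \in bs -> B \in bs'.
  move=> bS bS' hsub Bb; apply: (@hull_indicator_mem n) (cell_bounded bS') _ _.
    exact: (cell_bounded bS Bb).
  apply/(conv_bases_point _ (cell_bounded bS')); apply: hsub.
  by apply/(conv_bases_point _ (cell_bounded bS)); apply: indicator_hull.
apply/fsetP => B; apply/idP/idP; apply: sub => // x.
- by move=> /h1[].
- by move=> /h2[].
Qed.

(** Descent through faces: as long as [v] is not in the relative interior, a separating functional
    cuts out a proper face through [v], again a member of [S] and with fewer bases. *)
Lemma cell_exists v : hull (bases M) v -> exists2 bs, bs \in S & rel_interior bs v.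
Proof.
move=> hv; have [bs bsS hb] : exists2 bs, bs \in S & hull bs v.
  have : base_polytope M (point_of v) by apply/(conv_bases_point _ bases_bounded).
  case: hS => _ _ _ h /h[bs bsS cb]; exists bs => //.
  by apply/(conv_bases_point _ (cell_bounded bsS)).
have [m] := ubnP #|` bs|; elim: m bs bsS hb => // m IH bs bsS hb lm.
have [|nrel] := pselect (rel_interior bs v); first by exists bs.
have [w [hw [B Bb wB]]] := hull_separation hb nrel.
pose F x := conv_bases bs x /\ dotE E (functional_of w) x = pairing v w.
have fF : is_face E (conv_bases bs) F.
  exists (functional_of w), (pairing v w); split=> // x /(conv_basesE _ (cell_bounded bsS))[u hu ->].
  by apply/RleP; rewrite (cell_dot _ bsS hu) functional_ofK; apply: hw.
have Fv : F (point_of v).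
  split; first by apply/(conv_bases_point _ (cell_bounded bsS)).
  by rewrite (cell_dot _ bsS hb) functional_ofK.
case: (hS) => _ hface _ _; have [|bs' bsS' eqF] := hface bs F bsS fF; first by exists (point_of v).
apply: (IH bs' bsS').
  by apply/(conv_bases_point _ (cell_bounded bsS')); apply/eqF.
rewrite -ltnS; apply: leq_trans lm; rewrite ltnS; apply: fproper_ltn_card.
rewrite fproperE; apply/andP; split.
  apply/fsubsetP => C Cb'; apply: (@hull_indicator_mem n) (cell_bounded bsS) _ _.
    exact: (cell_bounded bsS' Cb').
  apply/(conv_bases_point _ (cell_bounded bsS)).
  have /eqF[//] : conv_bases bs' (point_of (indicator n C)).
  by apply/(conv_bases_point _ (cell_bounded bsS')); apply: indicator_hull.
apply/fsubsetPn; exists B => //; apply/negP => Bb'.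
have /eqF[_] : conv_bases bs' (point_of (indicator n B)).
  by apply/(conv_bases_point _ (cell_bounded bsS')); apply: indicator_hull.
rewrite (cell_dot _ bsS) ?functional_ofK; last exact: indicator_hull.
by move=> e; rewrite e ltxx in wB.
Qed.

Lemma interior_cellP bs : reflect (~ (forall x, conv_bases bs x -> boundary E (base_polytope M) x))
  (interior_cell M bs).
Proof. by rewrite /interior_cell; case: ClassicalEpsilon.excluded_middle_informative => h; constructor. Qed.

(** If [v] is not in the relative interior of P(M), a functional cuts out a proper face of P(M)
    through [v]; being maximal at [v] it is constant on the cell, which then lies in that face.
    Conversely a face through a relative interior point of P(M) is all of P(M). *)
Lemma cell_interior bs v : bs \in S -> rel_interior bs v ->
  interior_cell M bs <-> rel_interior (bases M) v.
Proof.
move=> bsS rv; have hv := rel_interior_hull rv; have hMv := cell_hull bsS hv.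
split=> [/interior_cellP nb|rMv].
  apply: contrapT => nrel; apply: nb => x cx.
  have [w [hw [B Bb wB]]] := hull_separation hMv nrel.
  pose F x := base_polytope M x /\ dotE E (functional_of w) x = pairing v w.
  have fF : is_face E (base_polytope M) F.
    exists (functional_of w), (pairing v w); split=> // y /(conv_basesE _ bases_bounded)[u hu ->].
    by apply/RleP; rewrite (bases_dot _ hu) functional_ofK; apply: hw.
  exists F; split=> //; split.
    move=> eqF; have /eqF[_] : base_polytope M (point_of (indicator n B)).
      by apply/(conv_bases_point _ bases_bounded); apply: indicator_hull.
    rewrite (bases_dot) ?functional_ofK; last exact: indicator_hull.
    by move=> e; rewrite e ltxx in wB.
  have [u hu ex] := (conv_basesE _ (cell_bounded bsS)).1 cx.
  have hMu := cell_hull bsS hu.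
  split; first by rewrite ex; apply/(conv_bases_point _ bases_bounded).
  rewrite ex (bases_dot _ hMu) functional_ofK.
  apply: (rel_interior_max _ rv) => // u' hu'; apply: hw; exact: cell_hull hu'.
apply/interior_cellP => /(_ (point_of v)) [|F [[w [c [hle hF]]] [nF /hF[_ vc]]]].
  by apply/(conv_bases_point _ (cell_bounded bsS)).
apply: nF => x; split=> [/hF[]//|px]; apply/hF; split=> //.
have [u hu ex] := (conv_basesE _ bases_bounded).1 px.
rewrite ex (bases_dot _ hu); apply: (rel_interior_max _ rMv) => //.
  move=> u' hu'; rewrite -(bases_dot _ hu'); apply/RleP; apply: hle.
  by apply/(conv_bases_point _ bases_bounded).
by rewrite -(bases_dot _ hMv).
Qed.

Lemma rel_interior_partition v :
  (`[< rel_interior (bases M) v >] : nat) =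
  (\sum_(bs <- S | interior_cell M bs) (`[< rel_interior bs v >] : nat))%N.
Proof.
case: (asboolP (rel_interior (bases M) v)) => [rv|nrv].
  have [bs bsS rb] := cell_exists (rel_interior_hull rv).
  have ib := (cell_interior bsS rb).2 rv.
  rewrite big_mkcond (big_fsetD1 bs bsS) /= ib asboolT // big_seq big1 // => bs'.
  rewrite !inE => /andP[nb bS']; case: ifP => // _; case: asboolP => // rb'.
  by rewrite (cell_unique bS' bsS rb' rb) eqxx in nb.
rewrite big_seq_cond big1 // => bs /andP[bsS ib]; case: asboolP => // rb.
by case: nrv; apply/(cell_interior bsS rb).
Qed.

Lemma interior_pdim bs : bs \in S -> (pdim (conv_bases bs) <= pdim (base_polytope M))%N.
Proof.
move=> bsS; rewrite (pdim_rank (cell_bounded bsS) (cell_nonempty bsS)).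
rewrite (pdim_rank bases_bounded bases_nonempty); apply: mxrankS.
apply/sumsmx_subP => p _; rewrite genmxE.
by apply: hull_directions; apply: (cell_hull bsS); apply: indicator_hull; apply: valP.
Qed.

(** Euler additivity for the family formed by P(M) with coefficient 1 and the interior cells with
    coefficient -1, all cut by the half spaces; the coefficients cancel at every point by
    [rel_interior_partition]. *)
Theorem threshold_valuative (Ts : seq ({fset nat} * nat)) : fchain [seq T.1 | T <- Ts] ->
  ((all (fun T => T.2 <= mrank M T.1)%N Ts : nat)%:R : int) =
  \sum_(bs <- S | interior_cell M bs)
    (all (fun T => T.2 <= mrank (Matroid E bs) T.1)%N Ts : nat)%:R *
      (-1) ^+ (pdim (base_polytope M) - pdim (conv_bases bs)).
Proof.
move=> ch.
pose D (i : unit + S) := match i with inl _ => threshold_cell (n := n) (bases M) Ts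
  | inr b => threshold_cell (n := n) (val b) Ts end.
pose A (i : unit + S) := match i with inl _ => directions n (bases M) | inr b => directions n (val b) end.
pose c (i : unit + S) : int := match i with inl _ => 1 | inr b => - (interior_cell M (val b) : nat)%:R end.
pose thr v := forall T, T \in Ts -> T.2%:R - 2^-1 < pairing v (count_dir n T.1).
have thrE bs v : (`[< threshold_cell bs Ts v >] : nat) = (`[< rel_interior bs v >] * `[< thr v >])%N.
  by rewrite mulnb -asbool_and.
have sumS (G : {fset {fset nat}} -> int) :
    \sum_(i : unit + S) c i * (match i with inl _ => G (bases M) | inr b => G (val b) end) =
    G (bases M) - \sum_(bs <- S | interior_cell M bs) G bs.
  rewrite big_sumType /= (big_pred1 tt) => [|[]//]; rewrite mul1r; congr (_ + _).
  rewrite [in RHS]big_mkcond [in RHS]big_seq_fsetE /= -sumrN; apply: eq_bigr => b _.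
  by case: ifP => _; rewrite ?mulN1r ?oppr0 ?mul0r.
have opn i : open_cell (D i) (A i) by case: i => [u|b]; apply: threshold_cell_open.
have zero v : \sum_i c i * (`[< D i v >] : nat)%:R = 0.
  have e := sumS (fun bs => (`[< threshold_cell bs Ts v >] : nat)%:R).
  have -> : \sum_i c i * (`[< D i v >] : nat)%:R = \sum_(i : unit + S) c i *
     (match i with inl _ => (`[< threshold_cell (bases M) Ts v >] : nat)%:R
       | inr b => (`[< threshold_cell (val b) Ts v >] : nat)%:R end).
    by apply: eq_bigr => -[[]|b] _.
  rewrite e; apply/eqP; rewrite subr_eq0; apply/eqP.
  rewrite thrE rel_interior_partition natrM natr_sum mulr_suml; apply: eq_bigr => bs _.
  by rewrite thrE natrM.
pose G bs : int := (`[< exists v, threshold_cell (n := n) bs Ts v >] : nat)%:R * (-1) ^+ \rank (directions n bs).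
have eG : G (bases M) = \sum_(bs <- S | interior_cell M bs) G bs.
  apply/eqP; rewrite -subr_eq0 -(sumS G) -[X in _ == X](euler_additive opn zero); apply/eqP.
  by apply: eq_bigr => -[[]|b] _.
have nonempty_thr N : is_matroid N -> bounded_sets n (bases N) ->
    `[< exists v, threshold_cell (n := n) (bases N) Ts v >] = all (fun T => T.2 <= mrank N T.1)%N Ts.
  move=> hN bN; have h := threshold_cell_nonempty hN bN ch.
  by apply/asboolP/idP => /h.
have sq k : (-1) ^+ k * (-1) ^+ k = 1 :> int by rewrite -expr2 sqrr_sign.
rewrite -nonempty_thr //; set a := (_%:R : int).
(* Signs square to 1, so the identity may be multiplied by the sign of P(M). *)
have -> : a = G (bases M) * (-1) ^+ \rank (directions n (bases M)) by rewrite /G -mulrA sq mulr1.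
rewrite eG mulr_suml big_seq_cond [RHS]big_seq_cond; apply: eq_bigr => bs /andP[bsS _].
rewrite /G (nonempty_thr (Matroid E bs)) //; last exact: cell_bounded.
  rewrite -mulrA; congr (_ * _).
  rewrite -!pdim_rank //; [|exact: cell_bounded|exact: cell_nonempty].
  by rewrite -{1}(subnK (interior_pdim bsS)) exprD mulrCA sq mulr1.
exact: cell_matroid.
Qed.
End Subdivision.

(** * Valuativity *)

(** The lattice takes a proof that [N] is a matroid; the classical case distinction makes the series
    a function on all of [matroid]. *)
Definition chow_series (N : matroid) (Z : {fset nat}) (s : nat) : {poly int} :=
  if pselect (is_matroid N) is left h then FY_series (flat_lattice h) (sorted_flats N) Z s else 0.

Definition chow_weight (c : nat) : {poly int} := \sum_(1 <= i < c) 'X^i.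

Lemma chow_seriesE N (hN : is_matroid N) Z s :
  chow_series N Z s = FY_series (flat_lattice hN) (sorted_flats N) Z s.
Proof. by rewrite /chow_series; case: pselect => // h; rewrite (Prop_irrelevance h hN). Qed.

Lemma chow_series_rec N Z s : is_matroid N ->
  chow_series N Z s = 1 + \sum_(G <- sorted_flats N | Z `<` G)
    chow_weight (mrank N G - mrank N Z + s) * chow_series N G 0.
Proof.
move=> hN; rewrite chow_seriesE FY_series_rec; last exact: sorted_flats_admissible.
congr (1 + _); apply: eq_big => [G|G _]; last by rewrite chow_seriesE.
by rewrite /below /= fproperEneq andbC.
Qed.

(** The recursion sees only the inclusions and ranks of flats. This serves both for isomorphisms of
    matroids and for the deletion of loops. *)
Lemma chow_series_iso N N' (t : {fset nat} -> {fset nat}) : is_matroid N -> is_matroid N' ->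
  perm_eq (sorted_flats N') [seq t F | F <- sorted_flats N] ->
  {in sorted_flats N &, forall F G, (t F `<` t G) = (F `<` G)} ->
  {in sorted_flats N, forall F, mrank N' (t F) = mrank N F} ->
  forall Z s, is_flat N Z -> chow_series N' (t Z) s = chow_series N Z s.
Proof.
move=> hN hN' pe mono rke Z s; have [m] := ubnP #|` ground N `\` Z|.
elim: m Z s => // m IH Z s lm fZ; have Zin : Z \in sorted_flats N by rewrite mem_sorted_flats.
rewrite !chow_series_rec // (perm_big _ pe) big_map; congr (1 + _).
rewrite big_seq_cond [RHS]big_seq_cond; apply: eq_big => [G|G /andP[Gin]].
  by case Gin: (G \in sorted_flats N); rewrite //= mono.
rewrite mono // => ZG; rewrite !rke //; congr (_ * _).
have fG : is_flat N G by rewrite -mem_sorted_flats.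
apply: IH => //; rewrite -ltnS; apply: leq_trans lm; rewrite ltnS; apply: fproper_ltn_card.
have /fproper_sub ZG' := ZG; rewrite fproperE; apply/andP; split; first exact: fsetDS.
move: ZG; rewrite fproperE => /andP[_ /fsubsetPn[e eG eZ]].
by apply/fsubsetPn; exists e; rewrite !inE ?eG // eZ (fsubsetP (flat_sub fG)).
Qed.

(** * Loops and the flat of rank zero *)

Section RankZero.
Variables (N : matroid) (hN : is_matroid N).
Local Notation E := (ground N).
Local Notation r := (mrank N).

Lemma mem_loopsP e :
  reflect (e \in E /\ forall B, B \in bases N -> e \notin B) (e \in loops N).
Proof.
rewrite /loops in_fset; apply: (iffP andP) => -[eE h]; split=> //.
  exact: (@allP _ (fun B : {fset nat} => e \notin B) (enum_fset (bases N)) h).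
exact/(@allP _ (fun B : {fset nat} => e \notin B) (enum_fset (bases N))).
Qed.

Lemma mem_mclosure A e : (e \in mclosure N A) = (e \in E) && (r (A `|` [fset e]) == r A).
Proof. by rewrite /mclosure in_fset. Qed.

Lemma loopsE : loops N = mclosure N fset0.
Proof.
apply/fsetP => e; rewrite mem_mclosure fset0U mrank0 //.
apply/mem_loopsP/andP => -[eE h]; split=> //.
  have [B Bb ->] := mrank_attained hN [fset e].
  rewrite cardfs_eq0 -fsubset0; apply/fsubsetP => x; rewrite !inE => /andP[/eqP -> eB].
  by have := h B Bb; rewrite eB.
move=> B Bb; apply/negP => eB; have := mrank_ge [fset e] Bb.
rewrite (eqP h) leqn0 cardfs_eq0 => /eqP/fsetP/(_ e).
by rewrite !inE eqxx eB.
Qed.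

Lemma flat_rank0 Z : is_flat N Z -> (r Z == 0%N) = (Z == mclosure N fset0).
Proof.
move=> fZ; have f0 : is_flat N (mclosure N fset0) by apply: flat_closure; rewrite ?fsub0set.
have r0 : r (mclosure N fset0) = 0%N by rewrite mrank_closure ?fsub0set // mrank0.
apply/eqP/eqP => [rZ|->//]; apply/eqP; rewrite eq_sym; apply: contraT => ne.
have sub : mclosure N fset0 `<=` Z by apply: closure_least; rewrite ?fsub0set.
by have := flat_rank_lt hN f0 fZ sub ne; rewrite rZ.
Qed.

Lemma loopless_flat0 : loopless N = is_flat N fset0.
Proof.
have f0 : is_flat N (mclosure N fset0) by apply: flat_closure; rewrite ?fsub0set.
rewrite /loopless loopsE; apply/eqP/idP => [<-//|fe].
by apply/esym/eqP; rewrite -flat_rank0 // mrank0.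
Qed.

(** The convention for matroids with loops turns into a factor testing whether [fset0] is closed,
    the shape treated by [chow_valuation]. *)
Lemma red_HE : red_H N = (is_flat N fset0 : nat)%:R * chow_series N fset0 0.
Proof.
rewrite /red_H loopless_flat0; case: ifP => [f0|_]; last by rewrite mul0r.
by rewrite mul1r (chow_seriesE hN) (red_hilb_series hN f0).
Qed.

Lemma mrank_loops A : r (A `|` mclosure N fset0) = r A.
Proof.
have := mrank_submod hN A (mclosure N fset0).
have := mrank_mono hN (fsubsetUl A (mclosure N fset0)).
rewrite (mrank_closure hN (fsub0set _)) mrank0 //; lia.
Qed.

Lemma delete_loops_matroid : is_matroid (delete_loops N).
Proof.
case: (hN) => pos b0 sub exch; split=> //=.
  by move=> e; rewrite !inE => /andP[_]; apply: pos.
move=> B Bb; apply/fsubsetP => e eB; rewrite inE (fsubsetP (sub _ Bb) _ eB) andbT.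
by apply/negP => /mem_loopsP[_ /(_ _ Bb)]; rewrite eB.
Qed.

(** Adding the loops to a flat of the matroid without loops preserves rank and inclusion and reaches
    every flat, so the recursion may start at the flat of loops of [N] itself. *)
Lemma aug_HE : aug_H N = chow_series N (mclosure N fset0) 1.
Proof.
have hD := delete_loops_matroid; set D := delete_loops N in hD *.
set Lp := mclosure N fset0.
have gD : ground D = E `\` Lp by rewrite /= loopsE.
have rD A : mrank D A = r A by [].
have LE : Lp `<=` E by apply/fsubsetP => e; rewrite !inE => /andP[].
have flatD F : is_flat D F -> is_flat N (F `|` Lp).
  move=> /is_flatP[FE h]; rewrite gD in FE h.
  apply/is_flatP; split.
    by rewrite fsubUset LE andbT (fsubset_trans FE) // fsubsetDl.
  move=> e eE; rewrite inE negb_or => /andP[eF eL]; rewrite mrank_loops.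
  have := h e _ eF; rewrite !rD inE eE eL => /(_ isT) /leq_trans; apply.
  by apply: mrank_mono => //; apply: fsetSU; apply: fsubsetUl.
have subL F : is_flat N F -> Lp `<=` F by move=> fF; apply: closure_least; rewrite ?fsub0set.
have eU F : is_flat N F -> (F `\` Lp) `|` Lp = F.
  move=> fF; apply/fsetP => e; rewrite in_fsetU in_fsetD; case eL: (e \in Lp); rewrite ?orbF //=.
  by rewrite (fsubsetP (subL F fF)).
have flatN F : is_flat N F -> is_flat D (F `\` Lp).
  move=> fF; have eF := eU F fF.
  apply/is_flatP; rewrite gD; split; first by apply: fsetSD; apply: flat_sub.
  move=> e; rewrite inE => /andP[eL eE] eF'; rewrite !rD.
  have eF2 : e \notin F by apply: contra eF' => eF2; rewrite inE eL.
  have /is_flatP[_ /(_ e eE eF2)] := fF.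
  have -> : r F = r (F `\` Lp) by rewrite -{1}eF mrank_loops.
  move/leq_trans; apply; rewrite -[X in (_ <= X)%N]mrank_loops; apply: mrank_mono => //.
  by rewrite fsetUAC eF.
have f0 : is_flat D fset0.
  by have := flatN _ (flat_closure hN (fsub0set _)); rewrite fsetDv.
rewrite /aug_H -/D (aug_hilb_series hD f0) -(chow_seriesE hD).
rewrite -(@chow_series_iso D N (fun F => F `|` Lp)) ?fset0U //.
- apply: uniq_perm; first exact: sorted_flats_uniq.
    rewrite map_inj_in_uniq ?sorted_flats_uniq // => F G; rewrite !mem_sorted_flats => fF fG eFG.
    have dis H : is_flat D H -> H = (H `|` Lp) `\` Lp.
      move=> /flat_sub; rewrite gD fsubsetD => /andP[_ /fsetDidPl dH].
      by rewrite fsetDUl fsetDv fsetU0 dH.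
    by rewrite (dis F fF) eFG -dis.
  move=> F; rewrite mem_sorted_flats; apply/idP/mapP => [fF|[G]].
    exists (F `\` Lp); first by rewrite mem_sorted_flats flatN.
    by rewrite eU.
  by rewrite mem_sorted_flats => /flatD fG ->.
- move=> F G; rewrite !mem_sorted_flats => fF fG; rewrite !fproperE.
  have dis H H' : is_flat D H -> (H `|` Lp `<=` H' `|` Lp) = (H `<=` H').
    move=> /flat_sub; rewrite gD fsubsetD => /andP[_ dH].
    apply/idP/idP => [h|]; last exact: fsetSU.
    apply/fsubsetP => e eH; have : e \in H' `|` Lp by apply: (fsubsetP h); rewrite inE eH.
    rewrite inE => /orP[//|eL]; move/fdisjointP: dH => /(_ e eH); by rewrite eL.
  by rewrite !dis.
- by move=> F _; rewrite mrank_loops.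
Qed.

End RankZero.

(** * Invariance under isomorphism *)

Section Isomorphism.
Variables (M N : matroid) (hM : is_matroid M) (hN : is_matroid N) (s : nat -> nat).
Hypotheses (inj : {in ground M &, injective s})
  (sE : [fset s x | x in ground M] = ground N)
  (sB : bases N = [fset fimg s B | B in bases M]).
Local Notation E := (ground M).
Implicit Types (A B F : {fset nat}).

Let bases_sub B : B \in bases M -> B `<=` E. Proof. by case: hM => _ _ h _; apply: h. Qed.

Lemma mem_fimg A e : A `<=` E -> e \in E -> (s e \in fimg s A) = (e \in A).
Proof.
move=> AE eE; apply/imfsetP/idP => [[x xA es]|eA]; last by exists e.
by rewrite (inj eE _ es) // (fsubsetP AE).
Qed.

Lemma fimg_sub A B : A `<=` E -> B `<=` E -> (fimg s A `<=` fimg s B) = (A `<=` B).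
Proof.
move=> AE BE; apply/idP/idP => [/fsubsetP h|/fsubsetP h]; apply/fsubsetP => e.
  by move=> eA; have eE := fsubsetP AE e eA; rewrite -mem_fimg // h // mem_fimg.
by case/imfsetP => x xA ->; apply/imfsetP; exists x => //; apply: h.
Qed.

Lemma fimg_inj A B : A `<=` E -> B `<=` E -> fimg s A = fimg s B -> A = B.
Proof.
by move=> AE BE e; apply/eqP; rewrite eqEfsubset -fimg_sub // e fsubset_refl -fimg_sub // e fsubset_refl.
Qed.

Lemma fimg_cap A B : A `<=` E -> B `<=` E -> fimg s A `&` fimg s B = fimg s (A `&` B).
Proof.
move=> AE BE; apply/fsetP => y; rewrite inE; apply/andP/imfsetP => [[/imfsetP[x xA ->]]|[x /= xAB ->]].
  rewrite mem_fimg ?(fsubsetP AE) // => xB; exists x => //=.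
  by move: xA => /= xA; rewrite inE xA.
by move: xAB; rewrite inE => /andP[xA xB]; rewrite !mem_fimg // (fsubsetP AE).
Qed.

Lemma card_fimg A : A `<=` E -> #|` fimg s A| = #|` A|.
Proof.
by move=> AE; apply: card_in_imfset => x y xA yA; apply: inj; apply: (fsubsetP AE).
Qed.

Lemma mrank_fimg A : A `<=` E -> mrank N (fimg s A) = mrank M A.
Proof.
move=> AE; have capE B : A `&` B `<=` E by apply: fsubset_trans (fsubsetIl _ _) AE.
apply/eqP; rewrite eqn_leq; apply/andP; split.
  have [B' B'b ->] := mrank_attained hN (fimg s A).
  move: B'b; rewrite sB => /imfsetP[B /= Bb ->].
  have BE := bases_sub Bb; by rewrite fimg_cap // card_fimg // mrank_ge.
have [B Bb ->] := mrank_attained hM A.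
have BE := bases_sub Bb; rewrite -card_fimg // -fimg_cap //; apply: mrank_ge.
by rewrite sB; apply/imfsetP; exists B.
Qed.

Lemma fimg_ground A : A `<=` E -> fimg s A `<=` ground N.
Proof. by move=> AE; rewrite -sE; apply/fsubsetP => y /imfsetP[x /= xA ->]; apply/imfsetP; exists x => //=; apply: (fsubsetP AE). Qed.

Lemma fimg_surj A : A `<=` ground N -> exists2 B, B `<=` E & A = fimg s B.
Proof.
move=> AN; have BE : [fset e in E | s e \in A] `<=` E by apply/fsubsetP => e; rewrite !inE => /andP[].
exists [fset e in E | s e \in A] => //; apply/fsetP => y; apply/idP/imfsetP => [yA|[x /= xB ->]].
  have : y \in ground N by apply: (fsubsetP AN).
  by rewrite -sE => /imfsetP[x /= xE ey]; exists x => //=; rewrite !inE xE -ey.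
by move: xB; rewrite !inE => /andP[].
Qed.

Lemma fimgU1 A e : fimg s (A `|` [fset e]) = fimg s A `|` [fset s e].
Proof.
apply/fsetP => y; rewrite inE; apply/imfsetP/orP => [[x /= xA ->]|[/imfsetP[x /= xA ->]|]].
- move: xA; rewrite !inE => /orP[xA|/eqP ->]; last by right.
  by left; apply/imfsetP; exists x.
- by exists x => //=; rewrite inE xA.
- by rewrite inE => /eqP ->; exists e => //=; rewrite !inE eqxx orbT.
Qed.

Lemma flat_fimg F : F `<=` E -> is_flat N (fimg s F) = is_flat M F.
Proof.
move=> FE; have sub e : e \in E -> F `|` [fset e] `<=` E.
  by move=> eE; rewrite fsubUset FE fsub1set.
apply/is_flatP/is_flatP => -[_ h]; split=> //; [move=> e eE eF|exact: fimg_ground|move=> y yN yF].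
  have := h (s e); rewrite -fimgU1 !mrank_fimg ?sub // mem_fimg //; apply=> //.
  by rewrite -sE; apply/imfsetP; exists e.
move: yN; rewrite -sE => /imfsetP[e /= eE ey]; rewrite ey -fimgU1 !mrank_fimg ?sub //.
by apply: h => //; rewrite -mem_fimg // -ey.
Qed.

Lemma chow_series_fimg Z k : is_flat M Z -> chow_series N (fimg s Z) k = chow_series M Z k.
Proof.
have fE F : F \in sorted_flats M -> F `<=` E by rewrite mem_sorted_flats; apply: flat_sub.
apply: chow_series_iso => //.
- apply: uniq_perm; first exact: sorted_flats_uniq.
    by rewrite map_inj_in_uniq ?sorted_flats_uniq // => F G /fE ? /fE ?; apply: fimg_inj.
  move=> F; rewrite mem_sorted_flats; apply/idP/mapP => [fF|[G Gin ->]].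
    have [G GE eG] := fimg_surj (flat_sub fF); exists G => //.
    by rewrite mem_sorted_flats -flat_fimg // -eG.
  by rewrite flat_fimg ?fE // -mem_sorted_flats.
- by move=> F G /fE ? /fE ?; rewrite !fproperE !fimg_sub.
- by move=> F /fE; apply: mrank_fimg.
Qed.

Lemma red_H_iso : red_H M = red_H N.
Proof.
have e0 : fimg s fset0 = fset0 by rewrite /fimg imfset0.
have ef : is_flat N fset0 = is_flat M fset0 by rewrite -{1}e0 flat_fimg ?fsub0set.
rewrite !red_HE // ef; case f0: (is_flat M fset0); rewrite ?mul0r // !mul1r.
by rewrite -[in RHS]e0 chow_series_fimg.
Qed.

Lemma aug_H_iso : aug_H M = aug_H N.
Proof.
have fM : is_flat M (mclosure M fset0) by apply: flat_closure; rewrite ?fsub0set.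
rewrite !aug_HE //; have <- : fimg s (mclosure M fset0) = mclosure N fset0.
  apply/eqP; rewrite -flat_rank0 ?flat_fimg ?(flat_sub fM) //.
  by rewrite mrank_fimg ?(flat_sub fM) // flat_rank0.
by rewrite chow_series_fimg.
Qed.
End Isomorphism.

(** * Valuations along a fixed subdivision *)

Section Valuations.
Variables (M : matroid) (S : {fset {fset {fset nat}}}).
Hypotheses (hM : is_matroid M) (hS : matroid_subdivision M S).
Local Notation E := (ground M).
Implicit Types (f g : matroid -> {poly int}) (A B F G Z T : {fset nat}).

(** The sum condition of [valuative] at a fixed matroid and subdivision. All matroids that occur
    share the ground set [E], so index sets may depend on [E] but not on the matroid. *)
Definition valuation f := f M = \sum_(bs <- S | interior_cell M bs)
  f (Matroid E bs) *~ ((-1) ^+ (pdim (base_polytope M) - pdim (conv_bases bs))%N).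

Lemma valuation_ext f g : (forall N, is_matroid N -> ground N = E -> f N = g N) ->
  valuation g -> valuation f.
Proof.
move=> fg; rewrite /valuation fg // => ->; rewrite big_seq_cond [RHS]big_seq_cond.
by apply: eq_bigr => bs /andP[bsS _]; rewrite fg //; case: hS => h _ _ _; apply: h.
Qed.

Lemma valuation0 : valuation (fun => 0).
Proof. by rewrite /valuation big1 // => bs _; rewrite mul0rz. Qed.

Lemma valuationD f g : valuation f -> valuation g -> valuation (fun N => f N + g N).
Proof.
by rewrite /valuation => -> ->; rewrite -big_split; apply: eq_bigr => bs _; rewrite mulrzDl.
Qed.

Lemma valuationM f p : valuation f -> valuation (fun N => f N * p).
Proof.
by rewrite /valuation => ->; rewrite mulr_suml; apply: eq_bigr => bs _; rewrite mulrzAl.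
Qed.

Lemma valuationB f g : valuation f -> valuation g -> valuation (fun N => f N - g N).
Proof.
move=> vf vg; apply: (@valuation_ext _ (fun N => f N + g N * (-1))).
  by move=> N _ _; rewrite mulrN1.
by apply: valuationD => //; apply: valuationM.
Qed.

Lemma valuation_sum (I : Type) (r : seq I) (P : pred I) (f : I -> matroid -> {poly int}) :
  (forall i, P i -> valuation (f i)) -> valuation (fun N => \sum_(i <- r | P i) f i N).
Proof.
move=> vf; elim: r => [|i r IH].
  by apply: (@valuation_ext _ (fun => 0)) valuation0 => N _ _; rewrite big_nil.
case Pi: (P i).
  apply: (@valuation_ext _ (fun N => f i N + \sum_(i <- r | P i) f i N)).
    by move=> N _ _; rewrite big_cons Pi.
  by apply: valuationD => //; apply: vf.
by apply: (@valuation_ext _ (fun N => \sum_(i <- r | P i) f i N)) IH => N _ _; rewrite big_cons Pi.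
Qed.

Definition thresholds (Ts : seq ({fset nat} * nat)) (N : matroid) : {poly int} :=
  (all (fun p : {fset nat} * nat => p.2 <= mrank N p.1)%N Ts : nat)%:R.

Lemma valuation_thresholds Ts : fchain [seq p.1 | p <- Ts] -> valuation (thresholds Ts).
Proof.
move=> ch; rewrite /valuation /thresholds.
have /(congr1 (fun z : int => z%:~R : {poly int})) := threshold_valuative hM hS ch.
rewrite rmorph_sum rmorph_nat /= => ->; apply: eq_bigr => bs _.
by rewrite rmorphM /= rmorph_nat mulrzr.
Qed.

Lemma mrank_bound N A : is_matroid N -> ground N = E -> (mrank N A <= #|` E|)%N.
Proof.
move=> hN eN; have [B Bb ->] := mrank_attained hN A; apply: fsubset_leq_card.
rewrite -eN; apply: fsubset_trans (fsubsetIr _ _) _.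
by case: hN => _ _ h _; apply: h.
Qed.

(* Summation by parts in the rank of the first set of the chain. *)
Lemma valuation_ranks Ts As (g : seq nat -> {poly int}) :
  fchain ([seq p.1 | p <- Ts] ++ As) ->
  valuation (fun N => thresholds Ts N * g (map (mrank N) As)).
Proof.
elim: As Ts g => [|A As IH] Ts g ch.
  by apply: valuationM; apply: valuation_thresholds; rewrite cats0 in ch.
have ch' v : fchain ([seq p.1 | p <- (A, v) :: Ts] ++ As).
  move=> B C BA CA; apply: ch; rewrite mem_cat inE.
    by move: BA; rewrite /= inE mem_cat; case/or3P=> ->; rewrite ?orbT.
  by move: CA; rewrite /= inE mem_cat; case/or3P=> ->; rewrite ?orbT.
(* The two threshold terms differ only for v = r A, and |E| bounds the ranks. *)
apply: (@valuation_ext _ (fun N => \sum_(0 <= v < #|` E|.+1)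
   (thresholds ((A, v) :: Ts) N * g (v :: map (mrank N) As)
    - thresholds ((A, v.+1) :: Ts) N * g (v :: map (mrank N) As)))); last first.
  apply: valuation_sum => v _; apply: valuationB;
  exact: (IH _ (fun l => g (v :: l)) (ch' _)).
move=> N hN eN; have lA := mrank_bound A hN eN.
rewrite big_mkord (bigD1 (Ordinal (lA : (mrank N A < #|` E|.+1)%N))) //= big1 ?addr0 => [|v nv].
  by rewrite -mulrBl /thresholds /= leqnn ltnn /= subr0.
rewrite -mulrBl /thresholds /=; have nv' : (v : nat) != mrank N A by rewrite -val_eqE in nv.
case: (ltngtP v (mrank N A)) nv' => //= _ _; rewrite ?subrr ?mul0r //.
Qed.

(** The statement carried through the recursion on flats. The function [g] of the ranks along a
    chain below [Z] absorbs the weights and the closedness tests of the flats already passed. *)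
Definition chow_valuation (Z : {fset nat}) s :=
  forall As (g : seq nat -> {poly int}), fchain As -> (forall A, A \in As -> A `<=` Z) ->
  valuation (fun N => g (map (mrank N) As) * ((is_flat N Z : nat)%:R * chow_series N Z s)).

(* [closed_sum] is the alternating sum of the [r (Z + T + U) == r Z] over the sets
   [U] of members of [es]; for [T = fset0] it tells whether no member of [es] is in
   the closure of [Z]. *)
Fixpoint closed_sum N Z (es : seq nat) T : {poly int} :=
  if es is e :: es' then closed_sum N Z es' T - closed_sum N Z es' (T `|` [fset e])
  else (mrank N (Z `|` T) == mrank N Z : nat)%:R.

(** For e in the closure of [Z] the two terms of the recursion are equal and cancel; otherwise the
    second one vanishes, Z + T + e having larger rank than Z. *)
Lemma closed_sumE N Z es T : is_matroid N ->
  closed_sum N Z es T = ((mrank N (Z `|` T) == mrank N Z) &&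
    all (fun e => mrank N Z < mrank N (Z `|` [fset e]))%N es : nat)%:R.
Proof.
move=> hN; elim: es T => [|e es IH] T /=; first by rewrite andbT.
rewrite !IH fsetUA.
have m1 : (mrank N Z <= mrank N (Z `|` [fset e]))%N by apply: mrank_mono; rewrite ?fsubsetUl.
have m2 : (mrank N (Z `|` [fset e]) <= mrank N (Z `|` T `|` [fset e]))%N.
  by apply: mrank_mono => //; apply: fsetSU; apply: fsubsetUl.
have m3 : (mrank N (Z `|` T) <= mrank N (Z `|` T `|` [fset e]))%N by apply: mrank_mono; rewrite ?fsubsetUl.
have m4 : (mrank N (Z `|` T `|` [fset e]) + mrank N Z <= mrank N (Z `|` T) + mrank N (Z `|` [fset e]))%N.
  have := mrank_submod hN (Z `|` T) (Z `|` [fset e]).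
  have -> : Z `|` T `|` (Z `|` [fset e]) = Z `|` T `|` [fset e].
    by rewrite fsetUACA fsetUid fsetUA.
  have : (mrank N Z <= mrank N ((Z `|` T) `&` (Z `|` [fset e])))%N.
    by apply: mrank_mono => //; rewrite fsubsetI !fsubsetUl.
  lia.
move: m1 m2 m3 m4; case: (all _ _); rewrite ?andbF ?andbT ?subr0 //.
case: ltnP => [lt _ m2 m3 m4|ge m1 m2 m3 m4].
  by rewrite andbT (_ : (mrank N (Z `|` T `|` [fset e]) == mrank N Z) = false) ?subr0 //; lia.
rewrite andbF (_ : (mrank N (Z `|` T `|` [fset e]) == mrank N Z) = (mrank N (Z `|` T) == mrank N Z)) ?subrr //.
by lia.
Qed.

(** Expanded, the alternating sum involves one set Z + T' at a time, and a single such set does fit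
    into a chain. *)
Lemma valuation_closed_sum (Psi : matroid -> {poly int}) Z es T :
  (forall T', (forall e, e \in T' -> e \in T \/ e \in es) ->
     valuation (fun N => Psi N * (mrank N (Z `|` T') == mrank N Z : nat)%:R)) ->
  valuation (fun N => Psi N * closed_sum N Z es T).
Proof.
elim: es T => [|e es IH] T h /=; first by apply: h => e; left.
apply: (@valuation_ext _ (fun N => Psi N * closed_sum N Z es T - Psi N * closed_sum N Z es (T `|` [fset e]))).
  by move=> N _ _; rewrite mulrBr.
apply: valuationB; apply: IH => T' hT'; apply: h => x /hT'.
  by rewrite inE => -[->|->]; rewrite ?orbT; [left|right].
by rewrite !inE => -[/orP[->|->]|->]; rewrite ?orbT; [left|right|right].
Qed.

Lemma fchain_cons A As : fchain As -> (forall B, B \in As -> B `<=` A) -> fchain (A :: As).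
Proof.
move=> ch sub B C; rewrite !inE => /orP[/eqP ->|BA] /orP[/eqP ->|CA].
- by left.
- by right; apply: sub.
- by left; apply: sub.
- exact: ch.
Qed.

(** An e outside the flat [G] raises the rank of [G], hence by submodularity that of [Z]; only the
    elements of G outside Z remain to be tested. *)
Lemma flat_closed_sum N Z G : is_matroid N -> ground N = E -> Z `<=` G -> is_flat N G ->
  closed_sum N Z (enum_fset (G `\` Z)) fset0 = (is_flat N Z : nat)%:R.
Proof.
move=> hN eN ZG fG; rewrite closed_sumE // fsetU0 eqxx /=; congr ((nat_of_bool _)%:R).
have GE := flat_sub fG.
apply/allP/is_flatP => [h|[_ h] e]; last first.
  by rewrite -[e \in enum_fset _]/(e \in G `\` Z) inE => /andP[eZ eG]; apply: h => //; apply: (fsubsetP GE).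
split=> [|e eE eZ]; first exact: fsubset_trans GE.
case eG: (e \in G).
  by apply: h; rewrite -[e \in enum_fset _]/(e \in G `\` Z) inE eG eZ.
have /is_flatP[_ /(_ e eE (negbT eG))] := fG.
have := mrank_submod hN G (Z `|` [fset e]).
have -> : G `|` (Z `|` [fset e]) = G `|` [fset e] by rewrite fsetUA (fsetUidPl _ _ ZG).
have : (mrank N Z <= mrank N (G `&` (Z `|` [fset e])))%N.
  by apply: mrank_mono => //; rewrite fsubsetI ZG fsubsetUl.
lia.
Qed.

(** Makes the index set independent of the matroid, as [valuation_sum] requires. *)
Lemma flat_sum N Z (F : {fset nat} -> {poly int}) : is_matroid N -> ground N = E ->
  \sum_(G <- sorted_flats N | Z `<` G) F G =
  \sum_(G <- enum_fset (fpowerset E) | Z `<` G) (is_flat N G : nat)%:R * F G.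
Proof.
move=> hN eN; have pe : perm_eq (sorted_flats N) [seq G <- enum_fset (fpowerset E) | is_flat N G].
  apply: uniq_perm; rewrite ?sorted_flats_uniq ?filter_uniq ?fset_uniq // => G.
  rewrite mem_sorted_flats mem_filter -[G \in enum_fset _]/(G \in fpowerset E) fpowersetE -eN.
  by case fG: (is_flat N G); rewrite //= flat_sub.
rewrite (perm_big _ pe) big_filter_cond big_mkcond [RHS]big_mkcond; apply: eq_bigr => G _.
by case: (is_flat N G); case: (Z `<` G); rewrite /= ?mul1r ?mul0r.
Qed.

Theorem chow_valuationP Z s : Z `<=` E -> chow_valuation Z s.
Proof.
have [m] := ubnP #|` E `\` Z|; elim: m Z s => // m IH Z s lm ZE As g ch sub.
pose psi N : {poly int} := g (map (mrank N) As).
pose chi N G : {poly int} := psi N * chow_weight (mrank N G - mrank N Z + s) *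
  ((is_flat N G : nat)%:R * chow_series N G 0).
(* The summand 1 of the recursion belongs to the chain ending at [Z], whose closedness is tested
   inside [E]; in the other summands it is tested inside the next flat [G]. *)
apply: (@valuation_ext _ (fun N => psi N * closed_sum N Z (enum_fset (E `\` Z)) fset0 +
  \sum_(G <- enum_fset (fpowerset E) | (Z `<` G) && (G `<=` E))
     chi N G * closed_sum N Z (enum_fset (G `\` Z)) fset0)).
  move=> N hN eN; rewrite chow_series_rec // flat_sum // mulrDr mulr1 mulrDr.
  have fE : is_flat N E by rewrite -eN; apply: flat_ground.
  rewrite flat_closed_sum //; congr (_ + _); rewrite !mulr_sumr.
  rewrite big_seq_cond [RHS]big_seq_cond; apply: eq_big => [G|G].
    rewrite -[G \in enum_fset _]/(G \in fpowerset E) fpowersetE.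
    by case: (G `<=` E); rewrite ?andbT ?andbF.
  rewrite /chi; case fG: (is_flat N G) => /and3P[_ ZG _]; last by rewrite !mul0r !mulr0 mul0r.
  by rewrite flat_closed_sum ?(fproper_sub ZG) // /psi; ring.
apply: valuationD.
  apply: valuation_closed_sum => T' hT'.
  (* The two leading ranks are compared to test r (Z + T') = r Z; the remaining ones go to [g]. *)
  pose gl l := if l is y :: z :: l' then g l' * (y == z : nat)%:R else 0.
  apply: (@valuation_ext _ (fun N => thresholds [::] N * gl (map (mrank N) (Z `|` T' :: Z :: As)))).
    by move=> N _ _; rewrite /thresholds /= mul1r.
  apply: (@valuation_ranks [::] (Z `|` T' :: Z :: As) gl); apply: fchain_cons; first exact: fchain_cons.
  move=> B; rewrite inE => /orP[/eqP ->|/sub BZ]; first exact: fsubsetUl.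
  exact: fsubset_trans BZ (fsubsetUl _ _).
apply: valuation_sum => G /andP[ZG GE]; apply: valuation_closed_sum => T' hT'.
have ZG' := fproper_sub ZG.
have TG : Z `|` T' `<=` G.
  rewrite fsubUset ZG'; apply/fsubsetP => e /hT' [|]; first by rewrite inE.
  by rewrite -[e \in enum_fset _]/(e \in G `\` Z) inE => /andP[].
(* [G], Z + T' and [Z] are put on top of the chain, so that the weight of this step and the test
   become part of the function for [G]. *)
pose gl l := if l is x :: y :: z :: l' then g l' * chow_weight (x - z + s) * (y == z : nat)%:R else 0.
apply: (@valuation_ext _ (fun N => gl (map (mrank N) (G :: Z `|` T' :: Z :: As)) *
   ((is_flat N G : nat)%:R * chow_series N G 0))).
  by move=> N _ _; rewrite /chi /psi /=; ring.
apply: (IH G 0%N _ GE (G :: Z `|` T' :: Z :: As) gl).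
- rewrite -ltnS; apply: leq_trans lm; rewrite ltnS; apply: fproper_ltn_card.
  rewrite fproperE; apply/andP; split; first exact: fsetDS.
  move: ZG; rewrite fproperE => /andP[_ /fsubsetPn[e eG eZ]].
  by apply/fsubsetPn; exists e; rewrite !inE ?eG // eZ (fsubsetP GE).
- apply: fchain_cons; first (apply: fchain_cons; first exact: fchain_cons).
    move=> B; rewrite inE => /orP[/eqP ->|/sub BZ]; first exact: fsubsetUl.
    exact: fsubset_trans BZ (fsubsetUl _ _).
  move=> B; rewrite !inE => /or3P[/eqP ->|/eqP ->|/sub BZ] //.
  exact: fsubset_trans BZ ZG'.
- move=> B; rewrite !inE => /or4P[/eqP ->|/eqP ->|/eqP ->|/sub BZ] //.
  exact: fsubset_trans BZ ZG'.
Qed.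

Lemma red_H_valuation : valuation red_H.
Proof.
apply: (@valuation_ext _ (fun N => 1 * ((is_flat N fset0 : nat)%:R * chow_series N fset0 0))).
  by move=> N hN _; rewrite mul1r red_HE.
by apply: (@chow_valuationP _ 0%N (fsub0set _) [::] (fun=> 1)).
Qed.

(** The series starts at the flat of loops, which depends on the matroid; in a sum over all subsets
    it is singled out as the only flat of rank zero. *)
Lemma aug_H_valuation : valuation aug_H.
Proof.
apply: (@valuation_ext _ (fun N => \sum_(Z <- enum_fset (fpowerset E) | Z `<=` E)
   (mrank N Z == 0%N : nat)%:R * ((is_flat N Z : nat)%:R * chow_series N Z 1))); last first.
  apply: valuation_sum => Z ZE.
  pose gl (l : seq nat) : {poly int} := if l is z :: _ then (z == 0%N : nat)%:R else 0.
  apply: (@chow_valuationP Z 1%N ZE [:: Z] gl).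
    by move=> A B; rewrite !inE => /eqP -> /eqP ->; left.
  by move=> A; rewrite inE => /eqP ->.
move=> N hN eN; rewrite aug_HE //.
have fL : is_flat N (mclosure N fset0) by apply: flat_closure; rewrite ?fsub0set.
have LE : mclosure N fset0 `<=` E by rewrite -eN; apply: flat_sub.
have Lin : mclosure N fset0 \in fpowerset E by rewrite fpowersetE.
rewrite big_mkcond (big_fsetD1 _ Lin) /= LE fL (flat_rank0 hN fL) eqxx !mul1r.
rewrite big_seq big1 ?addr0 // => Z; rewrite !inE => /andP[nZ _]; case: ifP => // _.
by case fZ: (is_flat N Z); rewrite ?mul0r ?mulr0 // flat_rank0 // (negbTE nZ) mul0r.
Qed.

End Valuations.

Theorem theorem1p11 :
  valuative (G := {poly int}) red_H /\ valuative (G := {poly int}) aug_H.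
Proof.
split; split=> [M N hM hN [s [inj sE sB]]|M S hM hS].
- exact: red_H_iso sE sB.
- exact: red_H_valuation.
- exact: aug_H_iso sE sB.
- exact: aug_H_valuation.
Qed.
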